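(* Let $\alpha\in(0,1)$, and let $\hat\beta_n$, $\hat\Sigma_n$, $l_{post}$, $A_{post,k}$, $\hat c_{post,k,n}$, $\widehat{\mathcal B}_{post,n}$, $\widehat{\mathcal Z}_{post,n}$ and $\hat\mu^*_{\alpha,n}$ be as defined in the context. Suppose the following three assumptions hold. (1) There exist vectors $\beta(P)$ and covariance matrices $\Sigma(P)$ (for $P\in\bigcup_n\mathcal P_n$) such that, with $\xi_P\sim N(0,\Sigma(P))$, $$\lim_{n\to\infty}\ \sup_{P\in\mathcal P_n}\ \sup_{f\in BL_1}\left|E_P\left[f\left(\sqrt n(\hat\beta_n-\beta(P))\right)\right]-E[f(\xi_P)]\right|=0,$$ where $BL_1$ is the set of real-valued functions bounded in absolute value by one and with Lipschitz constant at most one. Moreover there is a finite $\bar\lambda>0$ with $1/\bar\lambda\le\lambda_{\min}(\Sigma(P))\le\lambda_{\max}(\Sigma(P))\le\bar\lambda$ for all $P$. (2) For each $\varepsilon>0$, $\lim_{n\to\infty}\sup_{P\in\mathcal P_n}\Pr_P\left(\|n\hat\Sigma_n-\Sigma(P)\|>\varepsilon\right)=0$. (3) For each $k=1,\dots,K$ there exist vectors $c_{post,k}(P)$ such that for each $\varepsilon>0$, $\lim_{n\to\infty}\sup_{P\in\mathcal P_n}\Pr_P\left(\|\sqrt n\,\hat c_{post,k,n}-c_{post,k}(P)\|>\varepsilon\right)=0$. Moreover there is a finite $\bar\lambda_c>0$ with $\|c_{post,k}(P)\|\le\bar\lambda_c$ for all $P$ and $k$. Then $$\lim_{n\to\infty}\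 \sup_{P\in\mathcal P_n}\ \left|\Pr_P\left(\hat\mu^*_{\alpha,n}\ge l_{post}'\beta(P)\,\middle|\,\hat\beta_n\in\widehat{\mathcal B}_{post,n}\right)-\alpha\right|\ \Pr_P\left(\hat\beta_n\in\widehat{\mathcal B}_{post,n}\right)=0 .$$
   Context: For each $n\ge1$, $\mathcal P_n$ is a class of probability distributions for a sample of size $n$; $\Pr_P$, $E_P$ denote probability and expectation when the sample has distribution $P\in\mathcal P_n$. From the sample one computes a random vector $\hat\beta_n\in\mathbb R^{p}$ and a random symmetric $p\times p$ matrix $\hat\Sigma_n$ (a covariance matrix estimator). $l_{post}\in\mathbb R^p$ is a fixed nonzero vector, and $\hat\sigma_{post,n}^2=l_{post}'\hat\Sigma_nl_{post}$. Conditioning event. $K\ge1$ is fixed. For $k=1,\dots,K$, $A_{post,k}$ is a nonrandom $d_k\times p$ matrix all of whose rows are nonzero, and $\hat c_{post,k,n}\in\mathbb R^{d_k}$ is a random vector (computed from the sample). The polyhedra $\{b\in\mathbb R^p:A_{post,k}b\le\hat c_{post,k,n}\}$ (componentwise inequality), $k=1,\dots,K$, are disjoint, and $\widehat{\mathcal B}_{post,n}=\bigcup_{k=1}^K\{b\in\mathbb R^p:A_{post,k}b\le\hat c_{post,k,n}\}$. Truncation set. Let $\hat\gamma_n=\hat\Sigma_nl_{post}/\hat\sigma_{post,n}^2$ and $\hat r_n=\hat\beta_n-\hat\gamma_n\,l_{post}'\hat\beta_n$. With the conventions $\max\varnothing=-\infty$, $\min\varnothing=+\infty$, define $$\hat Z^-_{k,n}=\max_{j:(A_{post,k}\hat\gamma_n)_j<0}\frac{(\hat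 c_{post,k,n})_j-(A_{post,k}\hat r_n)_j}{(A_{post,k}\hat\gamma_n)_j},\qquad \hat Z^+_{k,n}=\min_{j:(A_{post,k}\hat\gamma_n)_j>0}\frac{(\hat c_{post,k,n})_j-(A_{post,k}\hat r_n)_j}{(A_{post,k}\hat\gamma_n)_j},$$ $$\hat Z^0_{k,n}=\min_{j:(A_{post,k}\hat\gamma_n)_j=0}\left[(\hat c_{post,k,n})_j-(A_{post,k}\hat r_n)_j\right].$$ Let $\widehat{\mathcal Z}_{post,k,n}=[\hat Z^-_{k,n},\hat Z^+_{k,n}]$ if $\hat Z^0_{k,n}\ge0$ and $\varnothing$ otherwise, and $\widehat{\mathcal Z}_{post,n}=\bigcup_{k=1}^K\widehat{\mathcal Z}_{post,k,n}$. (The event $\hat\beta_n\in\widehat{\mathcal B}_{post,n}$ is the same as $l_{post}'\hat\beta_n\in\widehat{\mathcal Z}_{post,n}$.) Estimator. Let $$F_{TN}(z;\mu,\sigma^2,\mathcal Z)=\frac{\int_{-\infty}^z\phi\left(\frac{t-\mu}{\sigma}\right)\mathbf 1\{t\in\mathcal Z\}\,dt}{\int_{-\infty}^\infty\phi\left(\frac{t-\mu}{\sigma}\right)\mathbf 1\{t\in\mathcal Z\}\,dt}$$ be the CDF of the $N(\mu,\sigma^2)$ distribution truncated to $\mathcal Z\subseteq\mathbb R$, with $\phi$ the standard normal density. Given $\hat\beta_n\in\widehat{\mathcal B}_{post,n}$, $\hat\mu^*_{\alpha,n}$ is the unique solution $\mu$ of $F_{TN}(l_{post}'\hat\beta_n;\mu,\hat\sigma_{post,n}^2,\widehat{\mathcal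 Z}_{post,n})=1-\alpha$. In degenerate sample realizations in which these quantities are undefined or no unique solution exists, $\hat\mu^*_{\alpha,n}$ may be assigned any value by an arbitrary measurable convention. The product of the conditional-probability discrepancy and $\Pr_P(\hat\beta_n\in\widehat{\mathcal B}_{post,n})$ is understood as $0$ when $\Pr_P(\hat\beta_n\in\widehat{\mathcal B}_{post,n})=0$. *)

(* Defs.v *)
From HB Require Import structures.
From mathcomp Require Import all_boot all_order all_algebra.
From mathcomp Require Import all_classical all_reals all_analysis.

Set Implicit Arguments.
Unset Strict Implicit.
Unset Printing Implicit Defensive.

Import Order.TTheory GRing.Theory Num.Theory.
Import numFieldNormedType.Exports.

Local Open Scope classical_set_scope.
Local Open Scope ring_scope.

Section linear_algebra.
Context {R : realType}.

Definition dotv p (u v : 'cV[R]_p) : R := (u^T *m v) 0 0.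

(* The norm that MathComp-Analysis puts on matrices is the maximum norm; the
   one used here is Frobenius, which is the Euclidean norm on column vectors. *)
Definition frob_norm m n (M : 'M[R]_(m, n)) : R :=
  Num.sqrt (\sum_i \sum_j M i j ^+ 2).

(* inf and sup take the value 0 on the empty set, but a real symmetric matrix of
   positive size has a nonempty finite set of eigenvalues. *)
Definition lambda_min p (M : 'M[R]_p) : R := inf [set a : R | eigenvalue M a].
Definition lambda_max p (M : 'M[R]_p) : R := sup [set a : R | eigenvalue M a].

Definition covariance_mx p (S : 'M[R]_p) : Prop :=
  S^T = S /\ forall v : 'cV[R]_p, 0 <= dotv v (S *m v).

Definition BL1 p : set ('cV[R]_p -> R) :=
  [set f | (forall x, `|f x| <= 1) /\
           (forall x y, `|f x - f y| <= frob_norm (x - y))].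

Definition polyhedron q p (A : 'M[R]_(q, p)) (c : 'cV[R]_q) : set 'cV[R]_p :=
  [set b | forall j, (A *m b) j 0 <= c j 0].

End linear_algebra.

Section probability.
Context {d : measure_display} {T : measurableType d} {R : realType}.

(* Borel measurability of a matrix-valued map, entry by entry. *)
Definition random_mx m n (X : T -> 'M[R]_(m, n)) : Prop :=
  forall i j, measurable_fun setT (fun w => X w i j).

(* The coordinates of Z are independent N(0,1) variables: the joint law is the
   product law on measurable boxes, whose sides may be the whole line. *)
Definition std_normal_vector (Q : probability T R) p (Z : T -> 'cV[R]_p)
    : Prop :=
  random_mx Z /\
  forall B : 'I_p -> set R, (forall i, measurable (B i)) ->
    Q [set w | forall i, B i (Z w i 0)] =
    (\prod_(i < p) normal_prob 0 1 (B i))%E.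

(* N(0, S) is the law of A Z with A A' = S and Z standard normal. *)
Definition centered_normal_vector (Q : probability T R) p (xi : T -> 'cV[R]_p)
    (S : 'M[R]_p) : Prop :=
  exists (A : 'M[R]_p) (Z : T -> 'cV[R]_p),
    [/\ std_normal_vector Q Z, A *m A^T = S & forall w, xi w = A *m Z w].

(* Equal to 0 if P F = 0. *)
Definition cond_prob (P : probability T R) (E F : set T) : R :=
  fine (P (E `&` F)) / fine (P F).

End probability.

Section truncation.
Context {R : realType} {p : nat}.
Implicit Types (l b g r : 'cV[R]_p) (S : 'M[R]_p).

Definition sigma2_post S l : R := dotv l (S *m l).

Definition gamma_post S l : 'cV[R]_p := (sigma2_post S l)^-1 *: (S *m l).

Definition resid_post b S l : 'cV[R]_p := b - dotv l b *: gamma_post S l.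

Definition Zminus q (A : 'M[R]_(q, p)) (c : 'cV[R]_q) g r : \bar R :=
  \big[Order.max/-oo%E]_(j < q | (A *m g) j 0 < 0)
    ((c j 0 - (A *m r) j 0) / (A *m g) j 0)%:E.

Definition Zplus q (A : 'M[R]_(q, p)) (c : 'cV[R]_q) g r : \bar R :=
  \big[Order.min/+oo%E]_(j < q | (A *m g) j 0 > 0)
    ((c j 0 - (A *m r) j 0) / (A *m g) j 0)%:E.

Definition Zzero q (A : 'M[R]_(q, p)) (c : 'cV[R]_q) g r : \bar R :=
  \big[Order.min/+oo%E]_(j < q | (A *m g) j 0 == 0)
    (c j 0 - (A *m r) j 0)%:E.

Definition trunc_piece q (A : 'M[R]_(q, p)) (c : 'cV[R]_q) g r : set R :=
  if (0 <= Zzero A c g r)%E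
  then [set z : R | (Zminus A c g r <= z%:E)%E /\ (z%:E <= Zplus A c g r)%E]
  else set0.

Context {K : nat} {q : 'I_K -> nat}.

Definition poly_union (A : forall k, 'M[R]_(q k, p))
    (c : forall k, 'cV[R]_(q k)) : set 'cV[R]_p :=
  [set b | exists k, polyhedron (A k) (c k) b].

Definition trunc_set (A : forall k, 'M[R]_(q k, p))
    (c : forall k, 'cV[R]_(q k)) b S l : set R :=
  [set z | exists k,
     trunc_piece (A k) (c k) (gamma_post S l) (resid_post b S l) z].

(* The third argument is the variance. *)
Definition F_TN (z mu s2 : R) (Z : set R) : R :=
  (\int[lebesgue_measure]_(t in `]-oo, z])
     (normal_pdf 0 1 ((t - mu) / Num.sqrt s2) * \1_Z t)) /
  (\int[lebesgue_measure]_t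
     (normal_pdf 0 1 ((t - mu) / Num.sqrt s2) * \1_Z t)).

(* m is a legitimate value of the estimator at a realization (b, S, c): it is the
   unique solution of the truncated normal equation whenever b satisfies the
   conditioning event and that solution exists, and it is arbitrary otherwise.
   The guard 0 < sigma2_post S l discards realizations where F_TN is only defined
   through the totality of division and square root. *)
Definition mu_star_spec (alpha : R) (A : forall k, 'M[R]_(q k, p))
    (c : forall k, 'cV[R]_(q k)) b S l (m : R) : Prop :=
  poly_union A c b -> 0 < sigma2_post S l ->
  forall mu : R,
    unique (fun u => F_TN (dotv l b) u (sigma2_post S l) (trunc_set A c b S l)
                     = 1 - alpha) mu ->
    m = mu.

End truncation.

(* Main.v *)
(* Put X = sqrt n (bhat - beta), m = l / sd and g = Sigma l / sd, where
   sd^2 = l' Sigma l, so that m'g = 1. The law N(0, Sigma) is unchanged when the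
   coordinate m'x is redrawn from N(0,1) along the line x + R g. On such a line
   let k be the indicator of the selection event, D its normal mass and N(x) its
   normal mass to the left of m'x. As the truncated normal laws form an
   exponential family in their mean, the truncated c.d.f. decreases strictly in
   mu, and on the selection event mu* >= l'beta means N(x) >= (1 - alpha) D. By
   the probability integral transform this has conditional probability alpha on
   each line, hence exactly alpha under N(0, Sigma).
   To pass to the sample, indicators are replaced by Lipschitz functions. The cost
   is controlled by Gaussian probabilities of thin strips around the faces of the
   polyhedra and around the levels where N - a D vanishes for a = 0, 1 - alpha, 1;
   the levels a = 0 and a = 1 account for the realizations in which the equation
   defining mu* has no solution. All the Lipschitz constants depend only on the
   spectral bound, so bounded Lipschitz convergence is uniform in P. *)
From HB Require Import structures.
Require Import Defs.
From mathcomp Require Import all_boot all_order all_algebra.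
From mathcomp Require Import all_classical all_reals all_analysis.
From mathcomp Require Import measurable_realfun ring lra.

Set Implicit Arguments.
Unset Strict Implicit.
Unset Printing Implicit Defensive.

Import Order.TTheory GRing.Theory Num.Theory.
Import numFieldNormedType.Exports.

Local Open Scope classical_set_scope.
Local Open Scope ring_scope.

(** * Rotation invariance of the standard normal law *)

(** The conclusion multiplies by the selection probability, so everything stays unnormalized: N is
    compared with (1 - alpha) D and never divided by D, which may be arbitrarily small. The image of
    k dnu under N is Lebesgue measure on [0, D] whatever k is, so the window |N - a D| <= c has mass
    at most 3 c. This anti-concentration needs nothing about the shape of the truncation set, and N
    - a D is Lipschitz in x with a constant that does not involve D. The truncation set is built
    from the estimated covariance, so sample and population live on two different lines through the
    same point. These lines separate as |v| grows; they are compared for |v| <= M only, and the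
    normal tail beyond M is added to the error. The polyhedra, once centred at beta(P), have
    unbounded offsets. The bound for a strip around a face involves only its width and the variance
    of the face's normal functional, which is bounded below since rows are nonzero and the spectrum
    is bounded. The redrawing identity is obtained without densities on R^p: independence gives it
    for coordinate vectors, and rotations in planes carry it to every unit vector. *)

Section gauss_density.
Context {R : realType}.
Local Notation mu := (@lebesgue_measure R).
Local Notation phi := (@normal_pdf R 0 1).
Local Notation nu := (@normal_prob R 0 1).
Local Open Scope ereal_scope.
Import HBNNSimple.

(** [nu] is defined on sets by integrating the density, so the formula is immediate for indicators;
    simple functions and monotone convergence carry it to f. *)
Lemma ge0_integral_normal_prob (f : R -> \bar R) :
  measurable_fun [set: R] f -> (forall x, 0 <= f x) ->
  \int[nu]_x f x = \int[mu]_x (f x * (phi x)%:E).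
Proof.
move=> mf f0; pose f_ := nnsfun_approx measurableT (mf : measurable_fun [set: measurableTypeR R] f).
have mphi : measurable_fun setT (EFin \o phi).
  by apply/measurable_EFinP; exact: measurable_normal_pdf.
have phi0 x : 0 <= (phi x)%:E by rewrite lee_fin normal_pdf_ge0.
have fphiE : \int[mu]_x (f x * (phi x)%:E) =
    limn (fun n => \int[mu]_x ((f_ n x)%:E * (phi x)%:E)).
  rewrite -monotone_convergence//.
  - apply: eq_integral => x _; apply/esym/cvg_lim => //.
    apply: cvgeZr => //; exact: cvg_nnsfun_approx.
  - by move=> n; apply: emeasurable_funM => //; apply/measurable_EFinP; exact: measurable_funP.
  - by move=> n x _; rewrite mule_ge0 ?lee_fin ?normal_pdf_ge0.
  - move=> x _ a b ab; rewrite lee_pmul// ?lee_fin//.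
    exact/lefP/nd_nnsfun_approx.
rewrite fphiE.
transitivity (limn (fun n => \int[nu]_x (f_ n x)%:E)).
  rewrite -monotone_convergence//.
  - by apply: eq_integral => x _; apply/esym/cvg_lim => //; exact: cvg_nnsfun_approx.
  - by move=> n; exact/measurable_EFinP.
  - by move=> n x _; rewrite lee_fin.
  - by move=> x _ a b ab; rewrite lee_fin; exact/lefP/nd_nnsfun_approx.
apply: congr_lim; apply/funext => n.
under eq_integral do rewrite fimfunE -fsumEFin//.
have fE x : (f_ n x)%:E * (phi x)%:E = \sum_(r \in range (f_ n))
    ((r * \1_(f_ n @^-1` [set r]) x)%:E * (phi x)%:E).
  rewrite {1}fimfunE -fsumEFin// ge0_mule_fsuml// => r.
  exact: nnfun_muleindic_ge0.
under [RHS]eq_integral do rewrite fE.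
rewrite !ge0_integral_fsum//.
- apply: eq_fsbigr => r /[!inE] -[y _ fry].
  have r0 : 0 <= r%:E by rewrite lee_fin -fry.
  under eq_integral do rewrite EFinM.
  under [RHS]eq_integral do rewrite EFinM -muleA.
  rewrite !ge0_integralZl//.
  + congr (_ * _); rewrite integral_indic// setIT.
    transitivity (\int[mu]_(x in f_ n @^-1` [set r]) (phi x)%:E) => //.
    rewrite [LHS]integral_mkcond; apply: eq_integral => x _.
    by rewrite patchE indicE; case: ifPn => _; rewrite ?mul1e ?mul0e.
  + apply: emeasurable_funM => //; apply/measurable_EFinP.
    exact: measurable_indic.
  + by move=> x _; rewrite mule_ge0 ?lee_fin ?normal_pdf_ge0.
  + by apply/measurable_EFinP; exact: measurable_indic.
- move=> r; apply: emeasurable_funM => //; apply/measurable_EFinP.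
  exact: measurable_funM.
- by move=> r x _; rewrite mule_ge0 ?nnfun_muleindic_ge0 ?phi0.
- by move=> r; exact/measurable_EFinP/measurable_funM.
- by move=> r x _; rewrite nnfun_muleindic_ge0.
Qed.


(** Lebesgue measure is the only measure giving half-open intervals their length. For b < 0 the
    preimage is half-open on the other side, which does not change its length. *)
Lemma lebesgue_measure_affine (a b : R) (A : set (measurableTypeR R)) :
  b != 0%R -> measurable A ->
  mu A = `|b|%:E * pushforward mu (fun v : measurableTypeR R => a + b * v)%R A.
Proof.
move=> b0 mA.
have mF : measurable_fun [set: measurableTypeR R]
    (fun v : measurableTypeR R => (a + b * v)%R : measurableTypeR R).
  by apply: measurable_funD => //; exact: measurable_funM.
pose F : measurableTypeR R -> measurableTypeR R := (fun v => (a + b * v)%R).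
pose m := mscale (NngNum (normr_ge0 b)) (pushforward mu F).
rewrite -[RHS]/(m mF A); apply: lebesgue_measure_unique => //= _ [[x y]] _ <-.
rewrite /m /mscale/= /pushforward lebesgue_measure_itv/=.
have [bneg|bpos|beq] := ltgtP b 0%R; last by rewrite beq eqxx in b0.
- have -> : (fun v => a + b * v)%R @^-1` `]x, y]%classic =
      `[((y - a) / b)%R, ((x - a) / b)%R[%classic.
    apply/seteqP; split => v /=; rewrite !in_itv/= => /andP[h1 h2]; apply/andP; split.
    + by rewrite ler_ndivrMr// lerBrDl mulrC.
    + by rewrite ltr_ndivlMr// ltrBlDl mulrC.
    + by move: h2; rewrite ltr_ndivlMr// ltrBlDl mulrC.
    + by move: h1; rewrite ler_ndivrMr// lerBrDl mulrC.
  rewrite lebesgue_measure_itv/= !lte_fin ltr_nM2r ?invr_lt0// ltrD2r.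
  case: ifP => xy; last by rewrite mule0.
  rewrite ltr0_norm// -!EFinB -EFinM; congr EFin.
  by field; rewrite ?b0.
- have -> : (fun v => a + b * v)%R @^-1` `]x, y]%classic =
      `]((x - a) / b)%R, ((y - a) / b)%R]%classic.
    apply/seteqP; split => v /=; rewrite !in_itv/= => /andP[h1 h2]; apply/andP; split.
    + by rewrite ltr_pdivrMr// ltrBlDl mulrC.
    + by rewrite ler_pdivlMr// lerBrDl mulrC.
    + by move: h1; rewrite ltr_pdivrMr// ltrBlDl mulrC.
    + by move: h2; rewrite ler_pdivlMr// lerBrDl mulrC.
  rewrite lebesgue_measure_itv/= !lte_fin ltr_pM2r ?invr_gt0// ltrD2r.
  case: ifP => xy; last by rewrite mule0.
  rewrite gtr0_norm// -!EFinB -EFinM; congr EFin.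
  by field; rewrite ?b0.
Qed.

Lemma ge0_integral_affine (f : R -> \bar R) (a b : R) : b != 0%R ->
  measurable_fun [set: R] f -> (forall x, 0 <= f x) ->
  \int[mu]_x f x = `|b|%:E * \int[mu]_x f (a + b * x)%R.
Proof.
move=> b0 mf f0.
have mF : measurable_fun [set: measurableTypeR R]
    (fun v : measurableTypeR R => (a + b * v)%R : measurableTypeR R).
  by apply: measurable_funD => //; exact: measurable_funM.
pose F : measurableTypeR R -> measurableTypeR R := (fun v => (a + b * v)%R).
pose m := mscale (NngNum (normr_ge0 b)) (pushforward mu F).
transitivity (\int[m mF]_x f x).
  by apply: eq_measure_integral => A mA _; exact: lebesgue_measure_affine.
rewrite ge0_integral_mscale// ge0_integral_pushforward//.
Qed.

End gauss_density.

Section rotation.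
Context {R : realType}.
Local Notation mu := (@lebesgue_measure R).
Local Notation phi := (@normal_pdf R 0 1).
Local Notation nu := (@normal_prob R 0 1).
Local Notation mR := (measurableTypeR R).
Local Open Scope ereal_scope.

Lemma measurable_fun2_comp d (T : measurableType d) (F : mR * mR -> \bar R)
    (f g : T -> mR) :
  measurable_fun setT F -> measurable_fun setT f -> measurable_fun setT g ->
  measurable_fun setT (fun x => F (f x, g x)).
Proof.
move=> mF mf mg; apply: (measurableT_comp mF).
exact: measurable_fun_pair.
Qed.

(** A change of variables in the plane made of one-dimensional ones: for b != 0 substitute r = a u +
    b v in the inner integral, exchange the integrals, and substitute u = a r + b v in the new inner
    one. The factors 1/|b| and |b| cancel. For b = 0 the map only changes signs of coordinates. *)
Lemma lebesgue_rotation (H : mR * mR -> \bar R) (a b : R) :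
  (a ^+ 2 + b ^+ 2 = 1)%R ->
  measurable_fun setT H -> (forall z, 0 <= H z) ->
  \int[mu]_u \int[mu]_v H (a * u + b * v, b * u - a * v)%R =
  \int[mu]_u \int[mu]_v H (u, v).
Proof.
move=> ab1 mH H0; have [b0|b0] := eqVneq b 0%R.
  have a0 : a != 0%R.
    apply/eqP => a0; move: ab1; rewrite a0 b0 expr0n addr0 => /eqP.
    by rewrite eq_sym oner_eq0.
  have na : `|a|%R = 1%R.
    apply/eqP; rewrite -(@eqrXn2 _ 2)// expr1n real_normK ?num_real//.
    by rewrite -ab1 b0 expr0n addr0.
  rewrite [RHS](ge0_integral_affine 0%R a0); last 2 first.
    exact: (@measurable_fun_fubini_tonelli_F _ _ _ _ _ mu).
    by move=> x; exact: integral_ge0.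
  rewrite na mul1e; apply: eq_integral => u _.
  have Na0 : (- a != 0)%R by rewrite oppr_eq0.
  rewrite [RHS](ge0_integral_affine 0%R Na0)//; last first.
    by apply: measurable_fun2_comp.
  rewrite normrN na mul1e; apply: eq_integral => v _.
  by rewrite b0 !mul0r mulNr !add0r addr0.
pose K (z : mR * mR) := H (z.2, (z.1 - a * z.2) / b)%R.
have K0 z : 0 <= K z by exact: H0.
have mK : measurable_fun setT K.
  apply: measurable_fun2_comp => //; apply: measurable_funM => //.
  by apply: measurable_funB => //; exact: measurable_funM.
have nb0 : `|b|%:E != 0%E by rewrite eqe normr_eq0.
transitivity (\int[mu]_u ((`|b|^-1)%:E * \int[mu]_r H (r, (u - a * r) / b)%R)).
  apply: eq_integral => u _.
  rewrite [X in _ = _ * X](ge0_integral_affine (a * u)%R b0)//; last first.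
    by apply: (measurable_fun2_comp (F := K)).
  rewrite muleA -EFinM mulVf ?normr_eq0// mul1e; apply: eq_integral => v _.
  congr (H (_, _)); apply: (mulfI b0); rewrite [RHS]mulrC divfK//.
  have -> : (b * (b * u - a * v) = b ^+ 2 * u - a * b * v)%R by ring.
  by rewrite -(addrK (a ^+ 2) (b ^+ 2))%R (addrC (b ^+ 2)%R) ab1; ring.
rewrite ge0_integralZl//; last 2 first.
- exact: (@measurable_fun_fubini_tonelli_F _ _ _ _ _ mu _ mK (fun=> H0 _)).
- by move=> x _; exact: integral_ge0.
rewrite (fubini_tonelli K)//=.
rewrite -ge0_integralZl//; last 2 first.
- exact: (@measurable_fun_fubini_tonelli_G _ _ _ _ _ mu _ mK (fun=> H0 _)).
- by move=> x _; apply: integral_ge0 => y _; exact: H0.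
apply: eq_integral => r _.
rewrite (ge0_integral_affine (a * r)%R b0); last 2 first.
  by apply: (measurable_fun2_comp (F := K)).
  by move=> x; exact: H0.
rewrite muleA -EFinM mulVf ?normr_eq0// mul1e; apply: eq_integral => v _.
by congr (H (_, _)); rewrite addrC addKr mulrC mulKf.
Qed.

Lemma normal_prob2E (F : mR * mR -> \bar R) :
  measurable_fun setT F -> (forall z, 0 <= F z) ->
  \int[nu]_u \int[nu]_v F (u, v) =
  \int[mu]_u \int[mu]_v (F (u, v) * (phi u * phi v)%:E).
Proof.
move=> mF F0.
have mphi : measurable_fun setT (EFin \o phi).
  by apply/measurable_EFinP; exact: measurable_normal_pdf.
rewrite ge0_integral_normal_prob.
- apply: eq_integral => u _.
  rewrite ge0_integral_normal_prob; last 2 first.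
  + exact: measurable_fun2_comp.
  + by move=> v.
  rewrite muleC -ge0_integralZl//; last 3 first.
  + by apply: emeasurable_funM => //; exact: measurable_fun2_comp.
  + by move=> x _; rewrite mule_ge0 ?lee_fin ?normal_pdf_ge0.
  + by rewrite lee_fin normal_pdf_ge0.
  apply: eq_integral => v _.
  by rewrite EFinM muleC -muleA (muleC (phi v)%:E).
- exact: (@measurable_fun_fubini_tonelli_F _ _ _ _ _ nu).
- by move=> x; exact: integral_ge0.
Qed.

(** The product density depends only on the sum of the squares of u and v, so the invariance is
    inherited from Lebesgue measure. *)
Lemma normal_rotation (F : mR * mR -> \bar R) (a b : R) :
  (a ^+ 2 + b ^+ 2 = 1)%R ->
  measurable_fun setT F -> (forall z, 0 <= F z) ->
  \int[nu]_u \int[nu]_v F (a * u + b * v, b * u - a * v)%R =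
  \int[nu]_u \int[nu]_v F (u, v).
Proof.
move=> ab1 mF F0.
have mphi : measurable_fun [set: mR] phi by exact: measurable_normal_pdf.
pose G (z : mR * mR) := F (a * z.1 + b * z.2, b * z.1 - a * z.2)%R.
pose H (z : mR * mR) := F z * (phi z.1 * phi z.2)%:E.
have mG : measurable_fun setT G.
  apply: measurable_fun2_comp => //.
    by apply: measurable_funD; exact: measurable_funM.
  by apply: measurable_funB; exact: measurable_funM.
have mH : measurable_fun setT H.
  apply: emeasurable_funM => //; apply/measurable_EFinP/measurable_funM.
    exact: measurableT_comp.
  exact: measurableT_comp.
have H0 z : 0 <= H z by rewrite mule_ge0 ?lee_fin ?mulr_ge0 ?normal_pdf_ge0.
have n1 : (1 != 0 :> R)%R by [].
have phi2E u v : (phi u * phi v = phi (a * u + b * v) * phi (b * u - a * v))%R.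
  rewrite !normal_pdfE// mulrACA [RHS]mulrACA; congr (_ * _)%R.
  rewrite /normal_fun -!expRD; congr expR.
  rewrite -!mulrDl !subr0; congr (_ / _)%R.
  by rewrite -!opprD; congr (- _)%R; rewrite -[LHS]mul1r -ab1; ring.
transitivity (\int[mu]_u \int[mu]_v (G (u, v) * (phi u * phi v)%:E)).
  exact: (normal_prob2E mG (fun=> F0 _)).
transitivity (\int[mu]_u \int[mu]_v H (u, v)); last first.
  by apply/esym; exact: (normal_prob2E mF F0).
transitivity (\int[mu]_u \int[mu]_v H (a * u + b * v, b * u - a * v)%R).
  by apply: eq_integral => u _; apply: eq_integral => v _; rewrite phi2E.
exact: (lebesgue_rotation ab1 mH H0).
Qed.

Lemma normal_sym (f : mR -> \bar R) :
  measurable_fun setT f -> (forall z, 0 <= f z) ->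
  \int[nu]_u f (- u)%R = \int[nu]_u f u.
Proof.
move=> mf f0; have N0 : (- 1 != 0 :> R)%R by rewrite oppr_eq0.
have n1 : (1 != 0 :> R)%R by [].
rewrite !ge0_integral_normal_prob//.
  rewrite [RHS](ge0_integral_affine 0%R N0).
  - rewrite normrN1 mul1e; apply: eq_integral => u _.
    rewrite add0r mulN1r; congr (_ * _%:E).
    by rewrite !normal_pdfE// /normal_fun !subr0 sqrrN.
  - apply: emeasurable_funM => //; apply/measurable_EFinP.
    exact: measurable_normal_pdf.
  - by move=> z; rewrite mule_ge0 ?lee_fin ?normal_pdf_ge0.
exact: measurableT_comp.
Qed.

End rotation.

(** * Random vectors and the resampling identity *)

Section borel_functions.
Context {R : realType}.

(* Matrices carry no measurable structure, so Borel functions are those whose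
   composition with every random vector is measurable. *)
Definition borel_fun p (f : 'cV[R]_p -> \bar R) : Prop :=
  forall d (T : measurableType d) (X : T -> 'cV[R]_p),
    random_mx X -> measurable_fun setT (f \o X).

Definition box_law d (T : measurableType d) (P : probability T R) p
    (X : T -> 'cV[R]_p) (m : ('I_p -> set (measurableTypeR R)) -> \bar R) :=
  random_mx X /\
  forall B, (forall i, measurable (B i)) ->
    P [set w | forall i, B i (X w i 0)] = m B.

Lemma measurable_box d (T : measurableType d) p (X : T -> 'cV[R]_p)
    (B : 'I_p -> set (measurableTypeR R)) :
  random_mx X -> (forall i, measurable (B i)) ->
  measurable [set w | forall i, B i (X w i 0)].
Proof.
move=> mX mB; have -> : [set w | forall i, B i (X w i 0)] =
    \bigcap_(i in [set: 'I_p]) [set w | B i (X w i 0)].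
  by apply/seteqP; split => w /= h i *; exact: h.
apply: fin_bigcap_measurable => [|i _]; first exact: finite_finset.
rewrite -[X in measurable X]setTI; exact: (mX i 0 measurableT _ (mB i)).
Qed.

(** Column vectors receive the sigma-algebra generated by boxes, for which the identity is a random
    vector; [borel_fun] applied to it makes f measurable there. Boxes form a pi-system, so the two
    push-forward measures coincide. *)
Lemma eq_integral_box_law p (m : ('I_p -> set (measurableTypeR R)) -> \bar R)
    d1 (T1 : measurableType d1) (P1 : probability T1 R) (X1 : T1 -> 'cV[R]_p)
    d2 (T2 : measurableType d2) (P2 : probability T2 R) (X2 : T2 -> 'cV[R]_p)
    (f : 'cV[R]_p -> \bar R) :
  box_law P1 X1 m -> box_law P2 X2 m ->
  borel_fun f -> (forall x, (0 <= f x)%E) ->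
  (\int[P1]_w f (X1 w) = \int[P2]_w f (X2 w))%E.
Proof.
move=> [mX1 hX1] [mX2 hX2] bf f0.
pose G : set (set 'cV[R]_p) := [set C |
  exists B : 'I_p -> set (measurableTypeR R), (forall i, measurable (B i)) /\
  C = [set x : 'cV[R]_p | forall i : 'I_p, B i (x i 0)]].
pose T0 := g_sigma_algebraType G.
have mid : random_mx (id : T0 -> 'cV[R]_p).
  move=> i j _ Y mY; rewrite setTI; apply: sub_sigma_algebra.
  exists (fun k => if k == i then Y else setT); split.
    by move=> k; case: ifP.
  apply/seteqP; split => x /=.
    by move=> Yx k; case: eqP => // ->; rewrite -(ord1 j).
  by move=> /(_ i); rewrite eqxx (ord1 j).
have mf : measurable_fun [set: T0] f := bf _ _ _ mid.
have mX d (T : measurableType d) (X : T -> 'cV[R]_p) : random_mx X ->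
    @measurable_fun _ _ T T0 setT X.
  move=> mX; apply: (@measurability _ _ T T0 _ _ G) => //.
  move=> _ [_ [B [mB ->]] <-]; rewrite setTI.
  exact: measurable_box.
have Xf d (T : measurableType d) (P : probability T R) (X : T -> T0)
    (rX : @measurable_fun _ _ T T0 setT X) :
    (\int[P]_w f (X w) = \int[pushforward P X]_x f x)%E.
  by rewrite ge0_integral_pushforward.
rewrite (Xf _ _ P1 _ (mX _ _ _ mX1)) (Xf _ _ P2 _ (mX _ _ _ mX2)).
have mX1' := mX _ _ _ mX1.
have mX2' := mX _ _ _ mX2.
apply: eq_measure_integral.
move=> C mC _.
apply: (@measure_unique _ _ T0 G (fun=> setT)) => //.
- move=> _ _ [B [mB ->]] [B' [mB' ->]]; exists (fun i => B i `&` B' i).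
  split; first by move=> i; exact: measurableI.
  apply/seteqP; split => x /=; first by case=> h1 h2 i; split.
  by move=> h; split => i; case: (h i).
- move=> _; exists (fun=> setT); split => //; apply/seteqP; split => //.
- by apply/seteqP; split => // x _; exists 0%N.
- move=> _ [B [mB ->]].
  exact: (etrans (hX1 _ mB) (esym (hX2 _ mB))).
- by move=> _; rewrite /= /pushforward/= preimage_setT probability_setT ltry.
Qed.

End borel_functions.

Section dotv_theory.
Context {R : realType} {p : nat}.
Implicit Types u v w : 'cV[R]_p.

Lemma dotvE u v : dotv u v = \sum_i u i 0 * v i 0.
Proof. by rewrite /dotv !mxE; apply: eq_bigr => i _; rewrite mxE. Qed.

Lemma dotvC u v : dotv u v = dotv v u.
Proof. by rewrite !dotvE; apply: eq_bigr => i _; rewrite mulrC. Qed.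

Lemma dotvDr u v w : dotv u (v + w) = dotv u v + dotv u w.
Proof. by rewrite /dotv mulmxDr mxE. Qed.

Lemma dotvDl u v w : dotv (u + v) w = dotv u w + dotv v w.
Proof. by rewrite dotvC dotvDr !(dotvC w). Qed.

Lemma dotvZr a u v : dotv u (a *: v) = a * dotv u v.
Proof. by rewrite /dotv -scalemxAr mxE. Qed.

Lemma dotvZl a u v : dotv (a *: u) v = a * dotv u v.
Proof. by rewrite dotvC dotvZr dotvC. Qed.

Lemma dotvNr u v : dotv u (- v) = - dotv u v.
Proof. by rewrite -scaleN1r dotvZr mulN1r. Qed.

Lemma dotvNl u v : dotv (- u) v = - dotv u v.
Proof. by rewrite dotvC dotvNr dotvC. Qed.

Lemma dotvBr u v w : dotv u (v - w) = dotv u v - dotv u w.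
Proof. by rewrite dotvDr dotvNr. Qed.

Lemma dotv0l v : dotv 0 v = 0.
Proof. by rewrite -(scale0r 0) dotvZl mul0r. Qed.

Lemma dotv_delta i v : dotv (delta_mx i 0) v = v i 0.
Proof.
rewrite dotvE (bigD1 i)//= big1 ?addr0.
  by rewrite mxE !eqxx mul1r.
by move=> j /negbTE ji; rewrite mxE ji mul0r.
Qed.

Lemma dotv_trmx n (B : 'M[R]_(n, p)) (u : 'cV[R]_n) v :
  dotv u (B *m v) = dotv (B^T *m u) v.
Proof. by rewrite /dotv trmx_mul trmxK mulmxA. Qed.

Lemma dotv_ge0 v : 0 <= dotv v v.
Proof. by rewrite dotvE sumr_ge0// => i _; rewrite -expr2 sqr_ge0. Qed.

Lemma dotv_eq0 v : (dotv v v == 0) = (v == 0).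
Proof.
apply/eqP/eqP => [|->]; last by rewrite dotv0l.
rewrite dotvE => /eqP; rewrite psumr_eq0; last first.
  by move=> i _; rewrite -expr2 sqr_ge0.
move=> /allP v0; apply/matrixP => i j; rewrite mxE (ord1 j).
by have := v0 i (mem_index_enum _); rewrite /= -expr2 sqrf_eq0 => /eqP.
Qed.

End dotv_theory.

Section random_matrices.
Context {R : realType} d (T : measurableType d).
Implicit Types m n p : nat.

Lemma random_mx_cst m n (M : 'M[R]_(m, n)) : random_mx (fun _ : T => M).
Proof. by move=> i j; exact: measurable_cst. Qed.

Lemma random_mxD m n (X Y : T -> 'M[R]_(m, n)) :
  random_mx X -> random_mx Y -> random_mx (fun w => X w + Y w).
Proof.
move=> mX mY i j; under eq_fun do rewrite mxE.
exact: measurable_funD.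
Qed.

Lemma random_mxZ m n (a : T -> R) (X : T -> 'M[R]_(m, n)) :
  measurable_fun setT a -> random_mx X -> random_mx (fun w => a w *: X w).
Proof.
move=> ma mX i j; under eq_fun do rewrite mxE.
exact: measurable_funM.
Qed.

Lemma random_mxM m n p (X : T -> 'M[R]_(m, n)) (Y : T -> 'M[R]_(n, p)) :
  random_mx X -> random_mx Y -> random_mx (fun w => X w *m Y w).
Proof.
move=> mX mY i j; under eq_fun do rewrite mxE.
by apply: measurable_sum => k; exact: measurable_funM.
Qed.

Lemma random_mx_tr m n (X : T -> 'M[R]_(m, n)) :
  random_mx X -> random_mx (fun w => (X w)^T).
Proof. by move=> mX i j; under eq_fun do rewrite mxE; exact: mX. Qed.

Lemma measurable_dotv p (X Y : T -> 'cV[R]_p) :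
  random_mx X -> random_mx Y -> measurable_fun setT (fun w => dotv (X w) (Y w)).
Proof.
by move=> mX mY; apply: (random_mxM _ _ 0 0) => //; exact: random_mx_tr.
Qed.

Lemma random_mx_comp d' (T' : measurableType d') m n (X : T -> 'M[R]_(m, n))
    (h : T' -> T) :
  random_mx X -> measurable_fun setT h -> random_mx (X \o h).
Proof. by move=> mX mh i j; exact: (measurableT_comp (mX i j) mh). Qed.

End random_matrices.

Section resampling.
Context {R : realType}.
Local Notation nu := (@normal_prob R 0 1).
Local Notation mR := (measurableTypeR R).

(* If [dotv m g = 1], the point of the line x + R g at which [dotv m] equals v. *)
Definition relevel p (m g x : 'cV[R]_p) (v : R) : 'cV[R]_p :=
  x + (v - dotv m x) *: g.

(* The law of X does not change when [dotv m X] is redrawn from N(0,1) along g. *)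
Definition resamples d (T : measurableType d) (Q : probability T R) p
    (X : T -> 'cV[R]_p) (m g : 'cV[R]_p) : Prop :=
  forall f : 'cV[R]_p -> \bar R, borel_fun f -> (forall x, 0 <= f x)%E ->
  (\int[Q]_w f (X w) =
   \int[Q]_w \int[nu]_v f (relevel m g (X w) v))%E.

Lemma random_mx_line d (T : measurableType d) p (X : T -> 'cV[R]_p)
    (a : T -> R) (m g : 'cV[R]_p) :
  random_mx X -> measurable_fun setT a ->
  random_mx (fun w => relevel m g (X w) (a w)).
Proof.
move=> mX ma; apply: random_mxD => //; apply: random_mxZ.
  apply: measurable_funB => //; apply: measurable_dotv => //.
  exact: random_mx_cst.
Qed.

Lemma borel_avg p (f : 'cV[R]_p -> \bar R) (m g : 'cV[R]_p) :
  borel_fun f -> (forall x, 0 <= f x)%E ->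
  borel_fun (fun x => \int[nu]_v f (relevel m g x v))%E.
Proof.
move=> bf f0 d T X mX.
pose h (z : T * mR) := f (relevel m g (X z.1) z.2).
apply: (@measurable_fun_fubini_tonelli_F _ _ _ _ _ nu h); last first.
  by move=> z; exact: f0.
apply: (bf _ _ (fun z : T * mR => relevel m g (X z.1) z.2)).
apply: (random_mx_line (X := fun z : T * mR => X z.1)) => //.
exact: random_mx_comp.
Qed.

(** Independence: replacing coordinate i by a fresh N(0,1) variable on the product space [Q \x nu]
    leaves the mass of every box unchanged. *)
Lemma resamples_delta d (T : measurableType d) (Q : probability T R) p
    (Z : T -> 'cV[R]_p) (i : 'I_p) :
  std_normal_vector Q Z -> resamples Q Z (delta_mx i 0) (delta_mx i 0).
Proof.
move=> [mZ boxZ] f bf f0.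
pose X (z : T * mR) := relevel (delta_mx i 0) (delta_mx i 0) (Z z.1) z.2.
have XE z k : X z k 0 = if k == i then z.2 else Z z.1 k 0.
  rewrite !mxE dotv_delta eqxx andbT; case: eqP => [->|_].
    by rewrite mulr1 addrC subrK.
  by rewrite mulr0 addr0.
have mX : random_mx X.
  apply: (random_mx_line (X := fun z : T * mR => Z z.1)) => //.
  exact: random_mx_comp.
rewrite -[RHS](fubini_tonelli1 (f \o X)); [|exact: bf|by move=> z; exact: f0].
apply: (eq_integral_box_law (m := fun B => (\prod_(i < p) nu (B i))%E) (P2 := (Q \x nu)%E)) => //.
split=> // B mB.
pose B' k := if k == i then setT else B k.
have mB' k : measurable (B' k) by rewrite /B'; case: ifP.
have -> : [set z | forall k, B k (X z k 0)] =
    [set w | forall k, B' k (Z w k 0)] `*` B i.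
  apply/seteqP; split => z /=.
    move=> h; split => [k|]; last by have := h i; rewrite XE eqxx.
    by rewrite /B'; case: ifPn => // ki; have := h k; rewrite XE (negbTE ki).
  move=> [h1 h2] k; rewrite XE; case: eqP => [->//|/eqP/negbTE ki].
  by have := h1 k; rewrite /B' ki.
rewrite [LHS]product_measure1E; [|exact: measurable_box|exact: mB].
transitivity ((\prod_(k < p) nu (B' k)) * nu (B i))%E.
  by congr (_ * _)%E; exact: boxZ.
rewrite [RHS](bigD1 i)//= (bigD1 i)//= /B' eqxx probability_setT mul1e muleC.
by congr (_ * _)%E; apply: eq_bigr => k /negbTE ->.
Qed.

(** By orthogonality, moving along e does not disturb the level [dotv e'], so the two redrawings act
    independently. *)
Lemma resamples_twice d (T : measurableType d) (Q : probability T R) p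
    (Z : T -> 'cV[R]_p) (e e' : 'cV[R]_p) (f : 'cV[R]_p -> \bar R) :
  resamples Q Z e e -> resamples Q Z e' e' -> dotv e' e = 0 ->
  borel_fun f -> (forall x, 0 <= f x)%E ->
  (\int[Q]_w f (Z w) = \int[Q]_w \int[nu]_u \int[nu]_v
    f (Z w + (u - dotv e (Z w)) *: e + (v - dotv e' (Z w)) *: e')%R)%E.
Proof.
move=> re re' e'e bf f0; rewrite (re' _ bf f0).
rewrite (re (fun x => \int[nu]_v f (relevel e' e' x v))%E); last 2 first.
- exact: borel_avg.
- by move=> x; exact: integral_ge0.
apply: eq_integral => w _; apply: eq_integral => u _; apply: eq_integral => v _.
by rewrite /relevel dotvDr dotvZr e'e mulr0 addr0.
Qed.

(** The left side keeps only the coordinate s = b u - a v of the pair (u, v) and draws the other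
    one, t, afresh. After a rotation s is standard normal and independent of t; rotating (t, s) back
    gives the right side. *)
Lemma normal_rotation3 (k : mR * mR -> \bar R) (a b : R) :
  a ^+ 2 + b ^+ 2 = 1 -> measurable_fun setT k -> (forall z, 0 <= k z)%E ->
  (\int[nu]_u \int[nu]_v \int[nu]_t
     k (a * t + b * (b * u - a * v), b * t - a * (b * u - a * v))%R =
   \int[nu]_u \int[nu]_v k (u, v))%E.
Proof.
move=> ab mk k0.
pose K (z : mR * mR) := k (a * z.1 + b * z.2, b * z.1 - a * z.2)%R.
have K0 z : (0 <= K z)%E by exact: k0.
have mK : measurable_fun setT K.
  apply: measurable_fun2_comp => //.
    by apply: measurable_funD; exact: measurable_funM.
  by apply: measurable_funB; exact: measurable_funM.
pose G (s : mR) := (\int[nu]_t K (t, s))%E.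
have mG : measurable_fun setT G.
  exact: (@measurable_fun_fubini_tonelli_G _ _ _ _ _ nu K).
pose F (z : mR * mR) := G z.2.
have mF : measurable_fun setT F by exact: measurableT_comp.
have F0 z : (0 <= F z)%E by apply: integral_ge0 => t _; exact: K0.
transitivity (\int[nu]_u \int[nu]_v F (a * u + b * v, b * u - a * v)%R)%E.
  by [].
rewrite (normal_rotation ab mF F0) /F/=.
transitivity ((\int[nu]_v G v) * nu setT)%E; first exact: integral_cst.
rewrite probability_setT mule1.
rewrite /G -(fubini_tonelli K mK K0).
exact: (normal_rotation ab mk k0).
Qed.

(** Once the e and e' coordinates are drawn as (u, v), redrawing along c = a e + b e' turns them
    into (a t + b s, b t - a s) with s = b u - a v, which is the situation of [normal_rotation3]. *)
Lemma resamples_rotation d (T : measurableType d) (Q : probability T R) p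
    (Z : T -> 'cV[R]_p) (e e' : 'cV[R]_p) (a b : R) :
  resamples Q Z e e -> resamples Q Z e' e' ->
  dotv e e = 1 -> dotv e' e' = 1 -> dotv e' e = 0 -> a ^+ 2 + b ^+ 2 = 1 ->
  resamples Q Z (a *: e + b *: e') (a *: e + b *: e').
Proof.
move=> re re' ee e'e' e'e ab f bf f0; set c := a *: e + b *: e'.
have ee' : dotv e e' = 0 by rewrite dotvC.
rewrite (resamples_twice re re' e'e bf f0).
rewrite [RHS](resamples_twice re re' e'e
  (f := fun x => (\int[nu]_t f (relevel c c x t))%E)); last 2 first.
- exact: borel_avg.
- by move=> x; exact: integral_ge0.
apply: eq_integral => w _; set z := Z w.
pose k (s : mR * mR) := f (z + (s.1 - dotv e z) *: e + (s.2 - dotv e' z) *: e').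
have k0 s : (0 <= k s)%E by exact: f0.
have mk : measurable_fun setT k.
  apply: (bf _ _ (fun s : mR * mR =>
    z + (s.1 - dotv e z) *: e + (s.2 - dotv e' z) *: e')).
  apply: random_mxD; first apply: random_mxD.
  - exact: random_mx_cst.
  - by apply: random_mxZ; [apply: measurable_funB|exact: random_mx_cst].
  - by apply: random_mxZ; [apply: measurable_funB|exact: random_mx_cst].
rewrite -[LHS]/(\int[nu]_u \int[nu]_v k (u, v))%E -(normal_rotation3 ab mk k0).
apply: eq_integral => u _; apply: eq_integral => v _; apply: eq_integral => t _.
rewrite /k/= /relevel; congr f.
set y := z + (u - dotv e z) *: e + (v - dotv e' z) *: e'.
have ye : dotv e y = u.
  by rewrite /y !dotvDr !dotvZr ee ee'; ring.
have ye' : dotv e' y = v.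
  by rewrite /y !dotvDr !dotvZr e'e' e'e; ring.
have -> : dotv c y = a * u + b * v by rewrite /c dotvDl !dotvZl ye ye'.
apply/matrixP => i j; rewrite (ord1 j) /y /c !mxE.
apply/eqP; rewrite -subr_eq0; apply/eqP.
(* The two points differ by a multiple of a^2 + b^2 - 1. *)
transitivity ((a ^+ 2 + b ^+ 2 - 1) * (u * e i 0 + v * e' i 0)); first by ring.
by rewrite ab subrr mul0r.
Qed.

Lemma resamples_opp d (T : measurableType d) (Q : probability T R) p
    (Z : T -> 'cV[R]_p) (e : 'cV[R]_p) :
  resamples Q Z e e -> resamples Q Z (- e) (- e).
Proof.
move=> re f bf f0; rewrite (re _ bf f0); apply: eq_integral => w _.
rewrite -(normal_sym (f := fun v => f (relevel e e (Z w) v)))//.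
  apply: eq_integral => v _; congr f; rewrite /relevel.
  by rewrite dotvNl opprK scalerN -scaleNr opprD.
apply: (bf _ _ (fun v : mR => relevel e e (Z w) v)).
by apply: (random_mx_line (X := fun=> Z w)) => //; exact: random_mx_cst.
Qed.

(** Induction on the number n of leading coordinates allowed to be nonzero: a unit vector supported
    on n + 1 of them is a e' + b dl, with e' a unit vector supported on n of them and dl a
    coordinate vector orthogonal to it. *)
Lemma resamples_std_normal d (T : measurableType d) (Q : probability T R) p
    (Z : T -> 'cV[R]_p) (e : 'cV[R]_p) :
  std_normal_vector Q Z -> dotv e e = 1 -> resamples Q Z e e.
Proof.
move=> stdZ.
suff H n : forall e : 'cV[R]_p, (forall i : 'I_p, (n <= i)%N -> e i 0 = 0) ->
    dotv e e = 1 -> resamples Q Z e e.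
  by apply: (H p) => i; rewrite leqNgt ltn_ord.
elim: n => [{}e e0 e1|n IHn {}e en e1].
  have : dotv e e != 0 by rewrite e1 oner_eq0.
  rewrite dotv_eq0; have -> : e = 0 by apply/matrixP => i j; rewrite (ord1 j) mxE e0.
  by rewrite eqxx.
have [np|pn] := ltnP n p; last first.
  by apply: IHn => // i; rewrite leqNgt (leq_trans (ltn_ord i)).
pose i0 := Ordinal np; pose dl : 'cV[R]_p := delta_mx i0 0.
have rdl : resamples Q Z dl dl by exact: resamples_delta.
have dl1 : dotv dl dl = 1 by rewrite dotv_delta mxE !eqxx.
pose b := e i0 0; pose r := e - b *: dl.
have rdl0 : dotv dl r = 0.
  by rewrite /r dotvBr dotvZr dl1 mulr1 dotv_delta subrr.
have er : e = r + b *: dl by rewrite /r subrK.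
have ri (i : 'I_p) : (n <= i)%N -> r i 0 = 0.
  rewrite /r !mxE eqxx andbT => ni; case: eqP => [->|/eqP ii0].
    by rewrite mulr1 subrr.
  rewrite en ?mulr0 ?subr0// ltn_neqAle ni andbT.
  by apply: contra ii0 => /eqP ni'; apply/eqP/val_inj.
clearbody r.
have rr : dotv r r + b ^+ 2 = 1.
  rewrite -e1 er !(dotvDr, dotvDl, dotvZr, dotvZl) dl1 rdl0 (dotvC r) rdl0.
  by rewrite !mulr0 !addr0 add0r mulr1 expr2.
have [r0|r0] := eqVneq r 0.
  move: rr; rewrite r0 dotv0l add0r => /eqP; rewrite sqrf_eq1 er r0 add0r.
  case/orP => /eqP ->; first by rewrite scale1r; exact: rdl.
  by rewrite scaleN1r; exact: (resamples_opp rdl).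
have a0 : 0 < dotv r r by rewrite lt_neqAle dotv_ge0 eq_sym dotv_eq0 r0.
pose a := Num.sqrt (dotv r r).
have a_gt0 : 0 < a by rewrite sqrtr_gt0.
have a2 : a ^+ 2 = dotv r r by rewrite sqr_sqrtr// ltW.
pose e' := a^-1 *: r.
have -> : e = a *: e' + b *: dl.
  by rewrite /e' scalerA mulfV ?gt_eqF// scale1r.
have e'1 : dotv e' e' = 1.
  by rewrite /e' dotvZl dotvZr -a2 expr2; field; rewrite gt_eqF.
have re' : resamples Q Z e' e'.
  by apply: IHn => [i ni|]; [rewrite /e' mxE ri ?mulr0|exact: e'1].
have dle' : dotv dl e' = 0 by rewrite /e' dotvZr rdl0 mulr0.
have ab1 : a ^+ 2 + b ^+ 2 = 1 by rewrite a2.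
exact: (resamples_rotation re' rdl e'1 dl1 dle' ab1).
Qed.

(** With xi = A Z one has m'xi = (A'm)'Z, the vector A'm has norm 1 because m'Sm = 1, and A sends
    the direction A'm to S m. *)
Lemma resamples_normal d (T : measurableType d) (Q : probability T R) p
    (xi : T -> 'cV[R]_p) (S : 'M[R]_p) (m : 'cV[R]_p) :
  centered_normal_vector Q xi S -> dotv m (S *m m) = 1 ->
  resamples Q xi m (S *m m).
Proof.
move=> [A [Z [stdZ AA xiE]]] m1 f bf f0; pose e := A^T *m m.
have e1 : dotv e e = 1.
  by rewrite /e -{1}(trmxK A) -dotv_trmx trmxK mulmxA AA.
have bfA : borel_fun (f \o mulmx A).
  move=> d' T' X mX; apply: (bf _ _ (fun w => A *m X w)).
  by apply: random_mxM => //; exact: random_mx_cst.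
under eq_integral do rewrite xiE.
rewrite (resamples_std_normal stdZ e1 bfA (fun=> f0 _)).
apply: eq_integral => w _; apply: eq_integral => v _ /=; congr f.
rewrite /relevel mulmxDr -scalemxAr xiE; congr (_ + _ *: _).
  by rewrite /e dotv_trmx.
by rewrite /e mulmxA AA.
Qed.

Lemma random_normal d (T : measurableType d) (Q : probability T R) p
    (xi : T -> 'cV[R]_p) (S : 'M[R]_p) :
  centered_normal_vector Q xi S -> random_mx xi.
Proof.
move=> [A [Z [[mZ _] _ xiE]]]; rewrite (_ : xi = fun w => A *m Z w).
  by apply: random_mxM => //; exact: random_mx_cst.
by apply/funext.
Qed.

End resampling.

(** * Expectations along a normal line *)

Section bounded_expectation.
Context {R : realType} d (T : measurableType d) (P : probability T R).
Implicit Types f g : T -> R.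

(** Bounded measurable functions are integrable under every probability and closed under the
    operations used below, so real integrals can be manipulated without separate integrability
    arguments. *)
Definition bmf f := measurable_fun setT f /\ exists C, forall x, `|f x| <= C.

Lemma bmf_cst c : bmf (fun=> c).
Proof. by split => //; exists `|c|. Qed.

Lemma bmf01 f : measurable_fun setT f -> (forall x, 0 <= f x <= 1) -> bmf f.
Proof.
move=> mf f01; split => //; exists 1 => x.
by have /andP[f0 f1] := f01 x; rewrite ger0_norm.
Qed.

Lemma bmfD f g : bmf f -> bmf g -> bmf (fun x => f x + g x).
Proof.
move=> [mf [C fC]] [mg [C' gC]]; split; first exact: measurable_funD.
by exists (C + C') => x; rewrite (le_trans (ler_normD _ _))// lerD.
Qed.

Lemma bmfM f g : bmf f -> bmf g -> bmf (fun x => f x * g x).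
Proof.
move=> [mf [C fC]] [mg [C' gC]]; split; first exact: measurable_funM.
by exists (C * C') => x; rewrite normrM ler_pM.
Qed.

Lemma bmfN f : bmf f -> bmf (fun x => - f x).
Proof.
move=> [mf [C fC]]; split; first exact: measurable_funN.
by exists C => x; rewrite normrN.
Qed.

Lemma bmfB f g : bmf f -> bmf g -> bmf (fun x => f x - g x).
Proof. by move=> bf bg; apply: bmfD => //; exact: bmfN. Qed.

Lemma bmf_norm f : bmf f -> bmf (fun x => `|f x|).
Proof.
move=> [mf [C fC]]; split; first exact: measurableT_comp.
by exists C => x; rewrite normr_id.
Qed.

Lemma bmf_sum (I : Type) (s : seq I) (h : I -> T -> R) :
  (forall i, bmf (h i)) -> bmf (fun x => \sum_(i <- s) h i x).
Proof.
move=> bh; elim: s => [|i s IHs].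
  by under eq_fun do rewrite big_nil; exact: bmf_cst.
by under eq_fun do rewrite big_cons; exact: bmfD.
Qed.

Lemma bmf_integrable f : bmf f -> P.-integrable setT (EFin \o f).
Proof.
move=> [mf [C fC]]; apply: measurable_bounded_integrable => //.
  by apply: le_lt_trans (probability_le1 P measurableT) _; rewrite ltry.
exists C; split; first exact: num_real.
by move=> y Cy x _; apply: (le_trans (fC x)); exact: ltW.
Qed.

Lemma bmf_EFin f : bmf f -> (\int[P]_x (f x)%:E = (\int[P]_x f x)%:E)%E.
Proof.
by move=> bf; rewrite /Rintegral fineK//; apply: integrable_fin_num => //;
  exact: bmf_integrable.
Qed.

Lemma bintD f g : bmf f -> bmf g ->
  \int[P]_x (f x + g x) = \int[P]_x f x + \int[P]_x g x.
Proof. by move=> bf bg; rewrite RintegralD//; exact: bmf_integrable. Qed.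

Lemma bintB f g : bmf f -> bmf g ->
  \int[P]_x (f x - g x) = \int[P]_x f x - \int[P]_x g x.
Proof. by move=> bf bg; rewrite RintegralB//; exact: bmf_integrable. Qed.

Lemma bintZ c f : bmf f -> \int[P]_x (c * f x) = c * \int[P]_x f x.
Proof. by move=> bf; rewrite RintegralZl//; exact: bmf_integrable. Qed.

Lemma bint_cst c : \int[P]_x c = c.
Proof.
rewrite Rintegral_cst//; transitivity (c * fine (P setT)) => //.
by rewrite probability_setT mulr1.
Qed.

Lemma bint_sum (I : Type) (s : seq I) (h : I -> T -> R) :
  (forall i, bmf (h i)) ->
  \int[P]_x (\sum_(i <- s) h i x) = \sum_(i <- s) \int[P]_x h i x.
Proof.
move=> bh; elim: s => [|i s IHs].
  by rewrite big_nil; under eq_Rintegral do rewrite big_nil; rewrite bint_cst.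
rewrite big_cons; under eq_Rintegral do rewrite big_cons.
by rewrite bintD ?IHs//; exact: bmf_sum.
Qed.

Lemma ler_bint f g : bmf f -> bmf g -> (forall x, f x <= g x) ->
  \int[P]_x f x <= \int[P]_x g x.
Proof. by move=> bf bg fg; apply: le_Rintegral => //; exact: bmf_integrable. Qed.

Lemma bint_ge0 f : (forall x, 0 <= f x) -> 0 <= \int[P]_x f x.
Proof. by move=> f0; exact: Rintegral_ge0. Qed.

Lemma bint_le1 f : bmf f -> (forall x, f x <= 1) -> \int[P]_x f x <= 1.
Proof.
move=> bf f1; rewrite -[leRHS](bint_cst 1); apply: ler_bint => //.
exact: bmf_cst.
Qed.

Lemma ler_norm_bint f : bmf f -> `|\int[P]_x f x| <= \int[P]_x `|f x|.
Proof. by move=> bf; apply: le_normr_Rintegral => //; exact: bmf_integrable. Qed.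

Lemma bint_indic (A : set T) : measurable A -> \int[P]_x (\1_A x) = fine (P A).
Proof. by move=> mA; rewrite /Rintegral integral_indic// setIT. Qed.

Lemma measurable_nat_of_bool (b : T -> bool) :
  measurable_fun setT b -> measurable_fun setT (fun x => (b x)%:R : R).
Proof.
move=> mb; have -> : (fun x => (b x)%:R) = (fun x => if b x then 1 else 0 : R).
  by apply/funext => x; case: (b x).
by apply: measurable_fun_if => //; exact: measurable_cst.
Qed.

Lemma bmf_bool (b : T -> bool) :
  measurable_fun setT b -> bmf (fun x => (b x)%:R : R).
Proof.
move=> mb; apply: bmf01; first exact: measurable_nat_of_bool.
by move=> x; case: (b x); rewrite ?lexx ler01.
Qed.

Lemma measurable_bool_set (b : T -> bool) :
  measurable_fun setT b -> measurable [set t | b t].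
Proof. by move=> mb; have := mb measurableT [set true] I; rewrite setTI. Qed.

Lemma bint_bool (b : T -> bool) : measurable_fun setT b ->
  \int[P]_t ((b t)%:R : R) = fine (P [set t | b t]).
Proof.
move=> mb; rewrite -bint_indic; last exact: measurable_bool_set.
by apply: eq_Rintegral => t _; rewrite indicE mem_setE.
Qed.

End bounded_expectation.

Section standard_normal_line.
Context {R : realType}.
Local Notation nu := (@normal_prob R 0 1).
Local Notation mR := (measurableTypeR R).

Lemma normal_pdf_le1 (x : R) : normal_pdf 0 1 x <= 1.
Proof.
have n1 : (1 != 0 :> R) by [].
apply: (le_trans (normal_pdf_ub 0 x n1)).
rewrite /normal_peak invf_le1 ?sqrtr_gt0 ?mulrn_wgt0 ?mulr_gt0 ?pi_gt0//.
rewrite -[leLHS]sqrtr1 ler_wsqrtr// expr1n mul1r.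
by have := @pi_ge2 R; lra.
Qed.

Lemma measurable_normr : measurable_fun setT (fun v : mR => `|v| : R).
Proof. by move=> mT Y mY; exact: normr_measurable. Qed.

Lemma bmf_leq_cst (a : R) : bmf (fun v : mR => (v <= a)%R%:R : R).
Proof. by apply: bmf_bool; exact: measurable_fun_ler. Qed.

(** The density is at most 1, so an interval has normal mass at most its length. Every Lipschitz
    bound in a threshold comes from this. *)
Lemma normal_step (a b : R) : a <= b ->
  \int[nu]_v (((v <= b)%R%:R : R) - (v <= a)%R%:R) <= b - a.
Proof.
move=> ab; rewrite -lee_fin -bmf_EFin; last by apply: bmfB; exact: bmf_leq_cst.
rewrite (eq_integral (fun v : mR => (\1_(`]a, b]%classic : set mR) v)%:E)); last first.
  move=> v _; congr EFin; rewrite indicE.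
  have -> : (v \in (`]a, b]%classic : set mR)) = (a < v <= b).
    by apply/idP/idP; rewrite inE/= in_itv.
  case: (leP v a) => va /=; first by rewrite (le_trans va ab) subrr.
  by rewrite subr0.
rewrite integral_indic// setIT /normal_prob.
apply: (@le_trans _ _ (\int[lebesgue_measure]_(x in `]a, b]) (cst 1%E x))%E).
  apply: ge0_le_integral => //.
  - by move=> x _; rewrite lee_fin normal_pdf_ge0.
  - by apply/measurable_EFinP/measurable_funTS; exact: measurable_normal_pdf.
  - by move=> x _; rewrite lee_fin normal_pdf_le1.
rewrite integral_cst//= mul1e lebesgue_measure_itv/= lte_fin.
by case: ifP => // _; rewrite lee_fin subr_ge0.
Qed.

Lemma normal_step_norm (a b : R) :
  \int[nu]_v `|((v <= b)%R%:R : R) - (v <= a)%R%:R| <= `|b - a|.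
Proof.
wlog ab : a b / a <= b.
  move=> H; have [/H//|/ltW/H ba] := leP a b.
  by rewrite distrC; under eq_Rintegral do rewrite distrC.
rewrite (ger0_norm (_ : 0 <= b - a)) ?subr_ge0//.
apply: le_trans (normal_step ab).
apply: ler_bint => [||v]; first by apply/bmf_norm/bmfB; exact: bmf_leq_cst.
  by apply: bmfB; exact: bmf_leq_cst.
rewrite ger0_norm// subr_ge0.
by case: (leP v a) => va //=; rewrite (le_trans va ab).
Qed.

Lemma normal_tail (eta : R) : 0 < eta ->
  exists2 M : R, 0 < M & \int[nu]_v ((M < `|v|)%R%:R : R) <= eta.
Proof.
move=> eta0; pose F (n : nat) : set mR := [set v | n%:R < `|v|].
have mF n : measurable (F n).
  rewrite -[F n]setTI.
  have mlt : measurable_fun setT (fun v : mR => n%:R < `|v|).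
    by apply: measurable_fun_ltr => //; exact: measurable_normr.
  by have := mlt measurableT [set true] I.
have F0 : \bigcap_n F n = set0.
  apply/seteqP; split => // v /(_ (Num.bound `|v|) I) /=.
  by rewrite /F/= ltNge => /negP; apply; rewrite ltW// archi_boundP.
have /fine_cvgP[_] : (nu \o F) n @[n --> \oo] --> 0%E.
  rewrite -(measure0 nu) -F0; apply: nonincreasing_cvg_mu => //.
  - by apply: le_lt_trans (probability_le1 nu (mF _)) _; rewrite ltry.
  - by rewrite F0.
  - move=> m n mn; apply/subsetPset => v /=; apply: le_lt_trans.
    by rewrite ler_nat.
move=> /cvgrPdist_lt /(_ _ eta0) [n _ /(_ n.+1)] /= h.
(* [n.+1] rather than n makes the cut-off positive. *)
exists n.+1%:R => //.
have := h (leqnSn n); rewrite sub0r normrN => hn.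
have -> : \int[nu]_v ((n.+1%:R < `|v|)%R%:R : R) = \int[nu]_v \1_(F n.+1) v.
  apply: eq_Rintegral => v _; rewrite indicE; congr (nat_of_bool _)%:R.
  by apply/idP/idP; rewrite inE.
rewrite bint_indic//; apply: le_trans (ltW hn).
exact: ler_norm.
Qed.

End standard_normal_line.

(** * The probability integral transform for a weighted normal law *)

Section level_mass.
Context {R : realType}.
Local Notation nu := (@normal_prob R 0 1).
Local Notation mR := (measurableTypeR R).
Variable k : mR -> R.
Hypotheses (mk : measurable_fun setT k) (k01 : forall v, 0 <= k v <= 1).

Definition cumul (t : R) := \int[nu]_v ((v <= t)%R%:R * k v).
Let N := cumul.
Let D := \int[nu]_v k v.

Let bk : bmf k. Proof. exact: bmf01. Qed.
Let k0 v : 0 <= k v. Proof. by case/andP: (k01 v). Qed.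
Let k1 v : k v <= 1. Proof. by case/andP: (k01 v). Qed.

Let bNk t : bmf (fun v : mR => (v <= t)%R%:R * k v).
Proof. by apply: bmfM => //; exact: bmf_leq_cst. Qed.

Lemma cumul_ge0 t : 0 <= N t.
Proof. by apply: bint_ge0 => v; rewrite mulr_ge0. Qed.

Lemma cumul_le t : N t <= D.
Proof.
apply: ler_bint => // v; case: (v <= t); rewrite ?mul1r// mul0r; exact: k0.
Qed.

Lemma cumul_nondecreasing s t : s <= t -> N s <= N t.
Proof.
move=> st; apply: ler_bint => // v; rewrite ler_wpM2r// ler_nat.
by case: (leP v s) => // vs; rewrite (le_trans vs st).
Qed.

Lemma cumul_lip s t : `|N t - N s| <= `|t - s|.
Proof.
rewrite /N /cumul -bintB//; apply: le_trans (ler_norm_bint _ _) _.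
  exact: bmfB.
apply: le_trans (normal_step_norm s t); apply: ler_bint.
- by apply: bmf_norm; exact: bmfB.
- by apply/bmf_norm/bmfB; exact: bmf_leq_cst.
- move=> v; rewrite -mulrBl normrM ler_piMr// ger0_norm//.
Qed.

Lemma cumul_small eta : 0 < eta -> exists t, N t <= eta.
Proof.
(* The tail event is the strict inequality M < |v|, hence the extra 1. *)
move=> /normal_tail[M M0 hM]; exists (- M - 1); apply: le_trans hM.
apply: ler_bint => //.
  by apply: bmf_bool; apply: measurable_fun_ltr => //; exact: measurable_normr.
move=> v; case: (leP v (- M - 1)) => vM; last by rewrite mul0r.
rewrite mul1r; have -> // : M < `|v|.
by rewrite ltr_normr; apply/orP; right; lra.
Qed.

Lemma cumul_large eta : 0 < eta -> exists t, D - N t <= eta.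
Proof.
move=> /normal_tail[M M0 hM]; exists M; apply: le_trans hM.
rewrite /D /N /cumul -bintB//; apply: ler_bint => //.
- exact: bmfB.
- by apply: bmf_bool; apply: measurable_fun_ltr => //; exact: measurable_normr.
move=> v; case: (leP v M) => vM; first by rewrite mul1r subrr.
by rewrite mul0r subr0 ltr_normr vM.
Qed.

(** N is Lipschitz, close to 0 far to the left and to D far to the right. It may be flat where k
    vanishes, so t need not be unique. *)
Lemma cumul_ivt y : 0 < y < D -> exists t, N t = y.
Proof.
move=> /andP[y0 yD].
have [a Na] := cumul_small y0.
have [b Nb] : exists t, D - N t <= D - y by apply: cumul_large; rewrite subr_gt0.
have {}Nb : y <= N b by lra.
have cN : continuous N.
  move=> x; apply/cvgrPdist_le => e e0; near=> t.
  rewrite distrC; apply: le_trans (cumul_lip _ _) _; rewrite distrC.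
  by near: t; exact: cvgr_dist_le.
have [ab|ba] := leP a b; last first.
  exists a; apply/eqP; rewrite eq_le Na (le_trans Nb)//.
  by apply: cumul_nondecreasing; exact: ltW.
have [||c _ Nc] := @IVT R N a b y ab; last by exists c.
  exact: continuous_subspaceT.
by rewrite ge_min Na/= le_max Nb orbT.
Unshelve. all: by end_near. Qed.

Let mN : measurable_fun setT (N : mR -> R).
Proof.
apply: nondecreasing_measurable => //.
by move=> s t; exact: cumul_nondecreasing.
Qed.

Definition mass_above (y : R) := \int[nu]_v (k v * (y <= N v)%R%:R).
Let M := mass_above.

Let bMk y : bmf (fun v : mR => k v * (y <= N v)%R%:R).
Proof. by apply: bmfM => //; apply: bmf_bool; exact: measurable_fun_ler. Qed.

(** Cut at t with N t = y: every v > t satisfies N v >= y, and the k-mass beyond t is D - y. *)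
Lemma mass_above_lower y : 0 <= y -> D - y <= M y.
Proof.
rewrite le_eqVlt => /predU1P[<-|y0].
  rewrite subr0; apply: ler_bint => // v.
  by rewrite cumul_ge0 mulr1.
have [Dy|yD] := leP D y.
  by rewrite (@le_trans _ _ 0)// ?subr_le0// bint_ge0// => v; rewrite mulr_ge0.
have [|t Nt] := @cumul_ivt y; first by rewrite y0.
have -> : D - y = D - N t by rewrite Nt.
rewrite /D /N /cumul -bintB//; apply: ler_bint => //; first exact: bmfB.
move=> v; case: (leP v t) => vt; first by rewrite mul1r subrr mulr_ge0.
have -> : y <= N v by rewrite -Nt; apply: cumul_nondecreasing; exact: ltW.
by rewrite mul0r subr0 mulr1.
Qed.

(** Points left of a cut at level y can still have N v = y when N is flat there. The cut is
    therefore made at level y - eta, and eta is sent to 0. *)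
Lemma mass_above_upper y : y <= D -> M y <= D - y.
Proof.
move=> yD; apply/ler_addgt0Pr => eta eta0.
have [y0|y0] := leP (y - eta) 0.
  apply: (@le_trans _ _ D); last by lra.
  apply: ler_bint => // v; rewrite -[leRHS]mulr1 ler_wpM2l// lern1 leq_b1 //.
have [|t Nt] := @cumul_ivt (y - eta); first by rewrite y0; lra.
have -> : D - y + eta = D - N t by rewrite Nt; lra.
rewrite /D /N /cumul -bintB//; apply: ler_bint => //; first exact: bmfB.
move=> v; case: (leP v t) => vt.
  rewrite mul1r subrr; have -> : (y <= N v) = false; last by rewrite mulr0.
  by apply/negbTE; rewrite -ltNge (le_lt_trans (cumul_nondecreasing vt))// Nt; lra.
by rewrite mul0r subr0 -[leRHS]mulr1 ler_wpM2l// lern1 leq_b1.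
Qed.

(* N is D times a c.d.f.: by the probability integral transform the set
   N >= a D has mass (1 - a) D under k dnu. *)
Lemma level_mass_step (a eps : R) (h : R -> R) :
  0 <= a <= 1 -> 0 < eps -> measurable_fun setT (h : mR -> R) ->
  (forall y, (0 <= y)%R%:R <= h y <= (- eps <= y)%R%:R) ->
  (1 - a) * D <= \int[nu]_v (k v * h (N v - a * D)) <= (1 - a) * D + eps.
Proof.
move=> /andP[a0 a1] eps0 mh hP.
have D0 : 0 <= D by exact: bint_ge0.
have bh : bmf (fun v : mR => k v * h (N v - a * D)).
  apply: bmfM => //; apply: bmf01.
    by apply: (measurableT_comp mh); exact: measurable_funB.
  move=> v; have /andP[h1 h2] := hP (N v - a * D).
  by rewrite (le_trans _ h1)//= (le_trans h2)// lern1 leq_b1.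
apply/andP; split.
  have -> : (1 - a) * D = D - a * D by ring.
  apply: le_trans (mass_above_lower _) _; first exact: mulr_ge0.
  apply: ler_bint => // v; rewrite ler_wpM2l//.
  by have /andP[h1 _] := hP (N v - a * D); rewrite subr_ge0 in h1.
have -> : (1 - a) * D + eps = D - (a * D - eps) by ring.
apply: le_trans (mass_above_upper _); last first.
  have : a * D <= 1 * D by rewrite ler_wpM2r.
  lra.
apply: ler_bint => // v; rewrite ler_wpM2l//.
have /andP[_ h1] := hP (N v - a * D); apply: le_trans h1 _.
by rewrite lerBrDl addrC.
Qed.

(** The window lies in the set where N >= a D - c but not N >= a D + 2 c, whose mass is at most 3 c.
    The upper level is 2 c rather than c because [mass_above] counts N = y, and N = a D + c belongs
    to the window. *)
Lemma level_mass_window (a c : R) (h : R -> R) :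
  0 <= a <= 1 -> 0 < c -> measurable_fun setT (h : mR -> R) ->
  (forall y, 0 <= h y <= (`|y| <= c)%R%:R) ->
  \int[nu]_v (k v * h (N v - a * D)) <= 3 * c.
Proof.
move=> /andP[a0 a1] c0 mh hP.
have D0 : 0 <= D by exact: bint_ge0.
have aD : a * D <= 1 * D by rewrite ler_wpM2r.
have aD0 : 0 <= a * D by rewrite mulr_ge0.
have bh : bmf (fun v : mR => k v * h (N v - a * D)).
  apply: bmfM => //; apply: bmf01.
    by apply: (measurableT_comp mh); exact: measurable_funB.
  move=> v; have /andP[h1 h2] := hP (N v - a * D).
  by rewrite h1 (le_trans h2)// lern1 leq_b1.
have U : M (a * D - c) <= D - (a * D - c) by apply: mass_above_upper; lra.
have L : D - (a * D + 2 * c) <= M (a * D + 2 * c) by apply: mass_above_lower; lra.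
apply: (@le_trans _ _ (M (a * D - c) - M (a * D + 2 * c))); last by lra.
rewrite /M /mass_above -bintB//; apply: ler_bint => //; first exact: bmfB.
move=> v; rewrite -mulrBr ler_wpM2l//.
have /andP[_ h1] := hP (N v - a * D); apply: le_trans h1 _.
rewrite ler_norml.
case: (leP (a * D - c) (N v)) => h2; case: (leP (a * D + 2 * c) (N v)) => h3;
  case: (boolP (- c <= _ <= c)) => //=; rewrite ?subr0 ?subrr ?sub0r ?lexx ?ler01//; lra.
Qed.

End level_mass.

(** * Rayleigh quotients *)

Section rayleigh.
Context {R : realType}.

Definition quad p (S : 'M[R]_p) (v : 'cV[R]_p) : R := dotv v (S *m v).

Lemma quadE p (S : 'M[R]_p) v :
  quad S v = \sum_i \sum_j v i 0 * (S i j * v j 0).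
Proof.
by rewrite /quad dotvE; apply: eq_bigr => i _; rewrite mxE mulr_sumr.
Qed.

Lemma quadZ p (S : 'M[R]_p) a v : quad S (a *: v) = a ^+ 2 * quad S v.
Proof. by rewrite /quad -scalemxAr dotvZl dotvZr mulrA. Qed.

Lemma continuous_quad_tr p (S : 'M[R]_p) :
  continuous (fun u : 'rV[R]_p => quad S u^T).
Proof.
rewrite (_ : (fun _ => _) = fun u : 'rV[R]_p =>
    \sum_i \sum_j u 0 i * (S i j * u 0 j)); last first.
  apply/funext => u; rewrite quadE; apply: eq_bigr => i _.
  by apply: eq_bigr => j _; rewrite !mxE.
have cs (I : Type) (r : seq I) (F : I -> 'rV[R]_p -> R) :
    (forall i, continuous (F i)) -> continuous (fun u => \sum_(i <- r) F i u).
  move=> cF; elim: r => [|i r IHr].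
    rewrite (_ : (fun _ => _) = fun=> 0); first exact: cst_continuous.
    by apply/funext => u; rewrite big_nil.
  rewrite (_ : (fun _ => _) = fun u => F i u + \sum_(j <- r) F j u).
    by move=> u; exact: (@cvgD R R^o _ _ _ (F i) _ _ _ (cF i u) (IHr u)).
  by apply/funext => u; rewrite big_cons.
apply: (cs) => i; apply: cs => j u.
have ci k : (fun u : 'rV[R]_p => u 0 k : R) x @[x --> u] --> (u 0 k : R).
  exact: coord_continuous.
exact: (cvgM (ci i) (cvgM (cvg_cst _) (ci j))).
Qed.

(** Compactness of the Euclidean unit sphere gives a minimizer, and homogeneity extends the bound to
    all w. Row vectors appear because [EVT_min_rV] is stated for them. *)
Lemma rayleigh_min p (S : 'M[R]_p) : (0 < p)%N ->
  exists v : 'cV[R]_p, dotv v v = 1 /\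
    forall w, quad S v * dotv w w <= quad S w.
Proof.
move=> p0; pose A := [set u : 'rV[R]_p | quad 1%:M u^T = 1].
have dotq (w : 'cV[R]_p) : dotv w w = quad 1%:M w by rewrite /quad mul1mx.
have A0 : A !=set0.
  exists (delta_mx 0 (Ordinal p0)).
  by rewrite /A/= trmx_delta -dotq dotv_delta mxE !eqxx.
have cA : compact A.
  apply: bounded_closed_compact.
    exists 1; split; first exact: num_real.
    move=> M M1 u /= Au; rewrite [leLHS]mx_normrE; apply/bigmax_leP; split; first by lra.
    move=> [i j] _ /=; rewrite (ord1 i); apply: le_trans (ltW M1).
    rewrite -(@ler_pXn2r _ 2)// ?nnegrE// expr1n real_normK ?num_real//.
    rewrite -Au -dotq dotvE (bigD1 j)//= mxE -expr2 lerDl sumr_ge0// => k _.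
    by rewrite -expr2 sqr_ge0.
  have -> : A = (fun u : 'rV[R]_p => quad 1%:M u^T) @^-1` [set 1] by [].
  apply: closed_comp; first by move=> u _; exact: continuous_quad_tr.
  exact: closed_eq.
have [|u uA umin] := @EVT_min_rV R p (fun u => quad S u^T) A A0 cA.
  exact/continuous_subspaceT/continuous_quad_tr.
exists u^T; split; first by rewrite inE in uA; rewrite dotq.
move=> w; have [->|w0] := eqVneq w 0.
  by rewrite dotv0l mulr0 /quad dotv0l.
have ww : 0 < dotv w w by rewrite lt_neqAle dotv_ge0 eq_sym dotv_eq0 w0.
pose s := (Num.sqrt (dotv w w))^-1.
have s2 : s ^+ 2 = (dotv w w)^-1 by rewrite /s exprVn sqr_sqrtr// ltW.
have := umin (s *: w)^T; rewrite trmxK quadZ s2 ler_pdivlMl// mulrC.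
by apply; rewrite inE /A/= trmxK -dotq dotvZl dotvZr mulrA -expr2 s2 mulVf// gt_eqF.
Qed.

(** First variation at the minimizer in the direction of the residual y = S v - mu v: the excess at
    v + t y is 2 t b + t^2 c with b = |y|^2, which is negative for some t unless y = 0. *)
Lemma rayleigh_eigen p (S : 'M[R]_p) v : S^T = S -> dotv v v = 1 ->
  (forall w, quad S v * dotv w w <= quad S w) ->
  S *m v = quad S v *: v.
Proof.
move=> symS v1 vmin; set mu := quad S v.
have [y yE] : exists y, y = S *m v - mu *: v by eexists.
suff : dotv y y = 0.
  by move=> /eqP; rewrite dotv_eq0 yE subr_eq0 => /eqP.
apply/eqP; rewrite eq_le dotv_ge0 andbT leNgt; apply/negP => b0.
set b := dotv y y in b0.
pose c := quad S y - mu * dotv y y.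
have c0 : 0 <= c by rewrite subr_ge0 vmin.
have vSy : dotv v (S *m y) = dotv y (S *m v) by rewrite dotv_trmx symS dotvC.
have bE : dotv y (S *m v) - mu * dotv v y = b.
  by rewrite (dotvC v) -dotvZr -dotvBr -yE.
have Q (t : R) : 0 <= 2 * t * b + t ^+ 2 * c.
  have := vmin (v + t *: y); rewrite -/mu -subr_ge0.
  rewrite {1}/quad mulmxDr -scalemxAr !(dotvDr, dotvDl, dotvZl, dotvZr).
  rewrite vSy -/(quad S v) -/mu -/(quad S y) v1 (dotvC y v).
  congr (0 <= _); rewrite -bE /c; ring.
(* The vertex of the parabola would be at - b / c, but c may vanish; c + 1 still gives a negative
   value. *)
have := Q (- (b / (c + 1))).
have c1 : 0 < c + 1 by lra.
have -> : 2 * (- (b / (c + 1))) * b + (- (b / (c + 1))) ^+ 2 * c =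
  (b / (c + 1)) ^+ 2 * (- c - 2) by field; rewrite gt_eqF.
rewrite pmulr_rge0; first by lra.
by rewrite exprn_gt0// divr_gt0.
Qed.

Lemma eigenvalueE p (S : 'M[R]_p) (a : R) : S^T = S ->
  eigenvalue S a <-> exists2 w : 'cV[R]_p, S *m w = a *: w & w != 0.
Proof.
move=> symS; split => [/eigenvalueP[v vS v0]|[w Sw w0]].
  exists v^T; last by rewrite trmx_eq0.
  by rewrite -{1}symS -trmx_mul vS linearZ.
apply/eigenvalueP; exists w^T; last by rewrite trmx_eq0.
by rewrite -{1}symS -trmx_mul Sw linearZ.
Qed.

(** The minimum of the quadratic form on the sphere is an eigenvalue, hence at least [lambda_min].
    For p = 0 there is no unit vector and both sides are 0. *)
Lemma quad_ge_lambda_min p (S : 'M[R]_p) w : S^T = S ->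
  lambda_min S * dotv w w <= quad S w.
Proof.
case: p S w => [|p] S w symS.
  by rewrite quadE dotvE !big_ord0 mulr0.
have [v [v1 vmin]] := rayleigh_min S (ltn0Sn p).
apply: le_trans (vmin w); rewrite ler_wpM2r ?dotv_ge0//.
apply: ge_inf.
  exists (quad S v) => a /= /(eigenvalueE _ symS)[u Su u0].
  have uu : 0 < dotv u u by rewrite lt_neqAle dotv_ge0 eq_sym dotv_eq0 u0.
  by have := vmin u; rewrite /quad Su dotvZr ler_pM2r.
apply/(eigenvalueE _ symS); exists v; first exact: rayleigh_eigen.
by rewrite -dotv_eq0 v1 oner_eq0.
Qed.

Lemma quad_le_lambda_max p (S : 'M[R]_p) w : S^T = S ->
  quad S w <= lambda_max S * dotv w w.
Proof.
case: p S w => [|p] S w symS.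
  by rewrite quadE dotvE !big_ord0 mulr0.
have quadN u : quad (- S) u = - quad S u by rewrite /quad mulNmx dotvNr.
have symN : (- S)^T = - S by rewrite linearN /= symS.
have [v [v1 vmin]] := rayleigh_min (- S) (ltn0Sn p).
have vmax u : quad S u <= quad S v * dotv u u.
  by have := vmin u; rewrite !quadN mulNr lerN2.
apply: le_trans (vmax w) _; rewrite ler_wpM2r ?dotv_ge0//.
apply: ub_le_sup.
  exists (quad S v) => a /= /(eigenvalueE _ symS)[u Su u0].
  have uu : 0 < dotv u u by rewrite lt_neqAle dotv_ge0 eq_sym dotv_eq0 u0.
  by have := vmax u; rewrite {1}/quad Su dotvZr ler_pM2r.
apply/(eigenvalueE _ symS); exists v; last by rewrite -dotv_eq0 v1 oner_eq0.
have := rayleigh_eigen symN v1 vmin.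
by rewrite quadN mulNmx scaleNr => /oppr_inj.
Qed.

End rayleigh.

(** * The truncated normal family *)

Section tilting.
Context {R : realType}.
Local Notation nu := (@normal_prob R 0 1).
Local Notation mR := (measurableTypeR R).

(** If g had integral 0 it would vanish almost everywhere, and so would f. This is the source of the
    strict inequalities for tilted masses. *)
Lemma Rintegral_gt0 d (T : measurableType d) (m : {measure set T -> \bar R})
    (f g : T -> R) :
  m.-integrable setT (EFin \o f) -> m.-integrable setT (EFin \o g) ->
  (forall x, 0 <= f x) -> (forall x, 0 <= g x) ->
  (forall x, 0 < f x -> 0 < g x) ->
  0 < \int[m]_x f x -> 0 < \int[m]_x g x.
Proof.
move=> intf intg f0 g0 fg If0.
rewrite lt_neqAle Rintegral_ge0// andbT; apply/negP => /eqP Ig0.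
have mf := measurable_int _ intf; have mg := measurable_int _ intg.
have : (\int[m]_x `|(EFin \o g) x| = 0)%E.
  transitivity (\int[m]_x (g x)%:E)%E.
    by apply: eq_integral => x _ /=; rewrite ger0_norm.
  rewrite -[LHS]fineK; first by rewrite -[fine _]/(\int[m]_x g x) -Ig0.
  exact: integrable_fin_num.
move=> /(ae_eq_integral_abs m measurableT mg) aeg.
have aef : ae_eq m setT (EFin \o f) (cst 0%E).
  apply: filterS aeg => x /= gx _; have := gx I; move=> [gx0].
  congr EFin; apply/eqP; rewrite eq_le f0 andbT leNgt; apply/negP => /fg.
  by rewrite gx0 ltxx.
move: If0; rewrite /Rintegral (ge0_ae_eq_integral _ _ _ _ _ aef)//.
  by rewrite integral_cst// mul0e ltxx.
by move=> x _; rewrite lee_fin.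
Qed.

Lemma normal_pdf_shift (h v : R) :
  normal_pdf 0 1 (v - h) = normal_pdf 0 1 v * expR (h * v - h ^+ 2 / 2).
Proof.
have n1 : (1 != 0 :> R) by [].
rewrite !normal_pdfE// /normal_fun -mulrA; congr (_ * _).
by rewrite -expRD; congr expR; field.
Qed.

(** Completing the square, the density times exp(h (v - c)) is a constant times the density of N(h,
    1). *)
Lemma integrable_expR (h c : R) :
  nu.-integrable setT (fun v : mR => (expR (h * (v - c)))%:E).
Proof.
have mexp : measurable_fun [set: mR] (fun v : mR => expR (h * (v - c))).
  apply: measurableT_comp => //; apply: measurable_funM => //.
  exact: measurable_funB.
apply/integrableP; split; first exact/measurable_EFinP.
rewrite (eq_integral (fun v : mR => (expR (h * (v - c)))%:E)); last first.
  by move=> v _; rewrite /= ger0_norm// expR_ge0.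
rewrite ge0_integral_normal_prob; last 2 first.
- exact/measurable_EFinP.
- by move=> v; rewrite lee_fin expR_ge0.
rewrite (eq_integral (fun v : mR =>
  (expR (h ^+ 2 / 2 - h * c))%:E * (normal_pdf 0 1 (v - h))%:E)%E); last first.
  move=> v _; rewrite normal_pdf_shift -!EFinM; congr EFin.
  by rewrite mulrCA -expRD mulrC; congr (_ * expR _); ring.
have mpdf : measurable_fun [set: mR] (fun v : mR => (normal_pdf 0 1 v)%:E).
  by apply/measurable_EFinP; exact: measurable_normal_pdf.
have mpdfh : measurable_fun [set: mR] (fun v : mR => (normal_pdf 0 1 (v - h))%:E).
  by apply: (measurableT_comp mpdf); exact: measurable_funB.
rewrite ge0_integralZl//; last first.
  by move=> v _; rewrite lee_fin normal_pdf_ge0.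
have := ge0_integral_affine (f := fun v => (normal_pdf 0 1 v)%:E) (- h) (b := 1).
rewrite integral_normal_pdf normr1 mul1e => E.
rewrite (eq_integral (fun v : mR => (normal_pdf 0 1 (- h + 1 * (v : R)))%:E)); last first.
  by move=> v _; rewrite mul1r addrC.
by rewrite -E// ?mule1 ?ltry// => v; rewrite lee_fin normal_pdf_ge0.
Qed.

Lemma integrable_tilt (tau : R) (f : mR -> R) (h : R) : bmf f ->
  nu.-integrable setT (EFin \o (fun v => f v * expR (h * (v - tau)))).
Proof.
move=> [mf [C fC]].
have ie := integrable_expR h tau.
have iC : nu.-integrable setT (EFin \o (fun v : mR => C * expR (h * (v - tau)))).
  by have := integrableZl measurableT C ie; apply: eq_integrable.
apply: le_integrable iC => //.
  apply/measurable_EFinP/measurable_funM => //.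
  by have /measurable_EFinP := measurable_int _ ie.
move=> v _ /=; rewrite lee_fin !normrM ler_wpM2r//.
by apply: le_trans (fC v) _; exact: ler_norm.
Qed.

Variables (k : mR -> R) (tau alpha : R).
Hypotheses (mk : measurable_fun setT k) (k01 : forall v, 0 <= k v <= 1).
Hypothesis alpha01 : 0 < alpha < 1.
Hypotheses (left_pos : 0 < cumul k tau) (right_pos : cumul k tau < \int[nu]_v k v).

Let bk : bmf k. Proof. exact: bmf01. Qed.
Let k0 v : 0 <= k v. Proof. by case/andP: (k01 v). Qed.
Let k1 v : k v <= 1. Proof. by case/andP: (k01 v). Qed.

(* Moving the mean of the truncated normal law by h multiplies its density by
   exp(h (v - tau)), up to normalization. *)
Definition tilt_left (h : R) :=
  \int[nu]_v ((v <= tau)%R%:R * k v * expR (h * (v - tau))).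
Definition tilt_total (h : R) := \int[nu]_v (k v * expR (h * (v - tau))).
Definition tilt_diff (h : R) := \int[nu]_v
  (((v <= tau)%R%:R - (1 - alpha)) * k v * expR (h * (v - tau))).

Let bl : bmf (fun v : mR => (v <= tau)%R%:R * k v).
Proof. by apply: bmfM => //; exact: bmf_leq_cst. Qed.

Let bw : bmf (fun v : mR => ((v <= tau)%R%:R - (1 - alpha)) * k v).
Proof.
by apply: bmfM => //; apply: bmfB; [exact: bmf_leq_cst|exact: bmf_cst].
Qed.

Let br : bmf (fun v : mR => (1 - (v <= tau)%R%:R) * k v).
Proof.
by apply: bmfM => //; apply: bmfB; [exact: bmf_cst|exact: bmf_leq_cst].
Qed.

Lemma tilt_diffE h : tilt_diff h = tilt_left h - (1 - alpha) * tilt_total h.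
Proof.
rewrite /tilt_total -RintegralZl//; last exact: integrable_tilt.
rewrite -RintegralB//; last 2 first.
- exact: integrable_tilt.
- by have := integrableZl measurableT (1 - alpha) (integrable_tilt tau h bk); apply: eq_integrable.
by apply: eq_Rintegral => v _; ring.
Qed.

Lemma right_mass : 0 < \int[nu]_v ((1 - (v <= tau)%R%:R) * k v).
Proof.
rewrite (_ : \int[nu]_v _ = \int[nu]_v (k v - (v <= tau)%R%:R * k v)).
  by rewrite bintB// subr_gt0.
by apply: eq_Rintegral => v _; ring.
Qed.

Lemma tilt_total_gt0 h : 0 < tilt_total h.
Proof.
apply: (Rintegral_gt0 (f := k)).
- exact: bmf_integrable.
- exact: integrable_tilt.
- exact: k0.
- by move=> v; rewrite mulr_ge0// expR_ge0.
- by move=> v kv; rewrite mulr_gt0// expR_gt0.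
- exact: lt_trans right_pos.
Qed.

(** The exponential is pivoted at tau. Left of tau it decreases in h and carries the weight alpha k;
    right of tau it increases in h and carries the weight -(1 - alpha) k. So the integrand decreases
    pointwise, strictly where k > 0 on the right of tau. *)
Lemma tilt_diff_decreasing h1 h2 : h1 < h2 -> tilt_diff h2 < tilt_diff h1.
Proof.
move=> h12; have /andP[al0 al1] := alpha01.
rewrite -subr_gt0 -RintegralB//; [|exact: integrable_tilt..].
apply: (Rintegral_gt0 (f := fun v : mR => (1 - (v <= tau)%R%:R) * k v)).
- exact: bmf_integrable.
- by have := integrableB measurableT (integrable_tilt tau h1 bw) (integrable_tilt tau h2 bw);
    apply: eq_integrable.
- by move=> v; rewrite mulr_ge0// subr_ge0 lern1 leq_b1.
- move=> v; rewrite -mulrBr; case: (leP v tau) => vt.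
    have -> : 1%:R - (1 - alpha) = alpha by ring.
    apply: mulr_ge0; first by rewrite mulr_ge0 ?(ltW al0).
    by rewrite subr_ge0 ler_expR ler_wnM2r ?subr_le0// ltW.
  rewrite sub0r mulNr mulNr -mulrN opprB; apply: mulr_ge0.
    by rewrite mulr_ge0 ?subr_ge0 ?(ltW al1).
  by rewrite subr_ge0 ler_expR ler_wpM2r ?subr_ge0// ltW.
- move=> v; rewrite -mulrBr; case: (leP v tau) => vt; first by rewrite subrr mul0r ltxx.
  rewrite subr0 mul1r => kv; rewrite sub0r mulNr mulNr -mulrN opprB.
  rewrite mulr_gt0 ?mulr_gt0 ?subr_gt0//.
  by rewrite ltr_expR ltr_pM2r ?subr_gt0.
- exact: right_mass.
Qed.

Lemma expR_le_inv (x : R) : 0 < x -> expR (- x^-1) <= x.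
Proof.
move=> x0; rewrite expRN invf_ple ?posrE ?expR_gt0//.
by apply: le_trans (expR_ge1Dx _); rewrite lerDr.
Qed.

Lemma tilt_diff_neg : exists h, tilt_diff h < 0.
Proof.
have /andP[al0 al1] := alpha01.
pose B0 := \int[nu]_v ((1 - (v <= tau)%R%:R) * k v).
have B00 : 0 < B0 := right_mass.
(* With this choice the part right of tau contributes at most - 2 eta, while the part left of tau
   contributes at most alpha * 2 eta: eta for the strip ]tau - eta, tau] and eta for what lies
   further left. *)
pose eta := (1 - alpha) * B0 / 2.
have eta0 : 0 < eta by rewrite divr_gt0// mulr_gt0// subr_gt0.
(* Then h eta = 1 / eta, and exp(- 1 / eta) <= eta. *)
pose h := eta^-1 ^+ 2; exists h.
have h0 : 0 < h by rewrite exprn_gt0// invr_gt0.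
have heta : expR (- (h * eta)) <= eta.
  apply: le_trans (expR_le_inv eta0); rewrite ler_expR lerN2.
  by rewrite /h expr2 mulfVK ?gt_eqF.
pose u (v : mR) : R := ((v <= tau)%R%:R - (v <= tau - eta)%R%:R).
have bu : bmf u by apply: bmfB; exact: bmf_leq_cst.
have bb : bmf (fun v : mR => alpha * (u v + eta) - (1 - alpha) * ((1 - (v <= tau)%R%:R) * k v)).
  apply: bmfB; first by apply: bmfM; [exact: bmf_cst|apply: bmfD => //; exact: bmf_cst].
  by apply: bmfM => //; exact: bmf_cst.
apply: (@le_lt_trans _ _ (\int[nu]_v
  (alpha * (u v + eta) - (1 - alpha) * ((1 - (v <= tau)%R%:R) * k v)))).
  apply: le_Rintegral => //.
  - exact: integrable_tilt.
  - exact: bmf_integrable.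
  move=> v _; rewrite /u; have kv0 := k0 v; have kv1 := k1 v.
  case: (leP v tau) => vt.
    rewrite subrr mul0r mulr0 subr0 -mulrA.
    have -> : 1%:R - (1 - alpha) = alpha by ring.
    rewrite ler_wpM2l ?(ltW al0)//.
    apply: (@le_trans _ _ (1 * expR (h * (v - tau)))).
      by rewrite ler_wpM2r// expR_ge0.
    rewrite mul1r; case: (leP v (tau - eta)) => ve.
      rewrite subrr add0r; apply: le_trans heta; rewrite ler_expR -mulrN.
      by rewrite ler_wpM2l ?(ltW h0)//; lra.
    rewrite subr0; apply: (@le_trans _ _ 1); last by rewrite lerDl ltW.
    by rewrite -expR0 ler_expR pmulr_rle0// subr_le0.
  have -> : (v <= tau - eta) = false by apply/negbTE; rewrite -ltNge; lra.
  rewrite subrr subr0 !add0r mul1r mulNr mulNr.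
  apply: (@le_trans _ _ (- ((1 - alpha) * k v))); last by rewrite lerDr mulr_ge0 ?ltW.
  rewrite lerN2; apply: ler_peMr; first by rewrite mulr_ge0 ?subr_ge0 ?(ltW al1).
  by rewrite -expR0 ler_expR mulr_ge0 ?(ltW h0)// subr_ge0 ltW.
rewrite bintB; last 2 first.
- by apply: bmfM; [exact: bmf_cst|apply: bmfD => //; exact: bmf_cst].
- by apply: bmfM => //; exact: bmf_cst.
rewrite !bintZ//; last by apply: bmfD => //; exact: bmf_cst.
rewrite bintD//; last exact: bmf_cst.
rewrite bint_cst -/B0.
have : \int[nu]_v u v <= eta.
  have te : tau - eta <= tau by lra.
  by have := normal_step te; rewrite opprB addrCA subrr addr0.
move=> ue.
have : alpha * (\int[nu]_v u v + eta) <= alpha * (2 * eta).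
  by rewrite ler_wpM2l ?(ltW al0)//; lra.
have : alpha * (2 * eta) < 1 * (2 * eta) by rewrite ltr_pM2r//; lra.
have : 2 * eta = (1 - alpha) * B0 by rewrite /eta; field.
lra.
Qed.

(** Mirror image of [tilt_diff_neg]: a strongly negative tilt suppresses the mass right of tau, up
    to a strip of width eta. *)
Lemma tilt_diff_pos : exists h, 0 < tilt_diff h.
Proof.
have /andP[al0 al1] := alpha01.
pose A0 := cumul k tau.
pose eta := alpha * A0 / 2.
have eta0 : 0 < eta by rewrite divr_gt0// mulr_gt0.
pose h := eta^-1 ^+ 2; exists (- h).
have h0 : 0 < h by rewrite exprn_gt0// invr_gt0.
have heta : expR (- (h * eta)) <= eta.
  apply: le_trans (expR_le_inv eta0); rewrite ler_expR lerN2.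
  by rewrite /h expr2 mulfVK ?gt_eqF.
pose u (v : mR) : R := ((v <= tau + eta)%R%:R - (v <= tau)%R%:R).
have bu : bmf u by apply: bmfB; exact: bmf_leq_cst.
have bb : bmf (fun v : mR => alpha * ((v <= tau)%R%:R * k v) - (1 - alpha) * (u v + eta)).
  apply: bmfB; first by apply: bmfM => //; exact: bmf_cst.
  by apply: bmfM; [exact: bmf_cst|apply: bmfD => //; exact: bmf_cst].
apply: (@lt_le_trans _ _ (\int[nu]_v
  (alpha * ((v <= tau)%R%:R * k v) - (1 - alpha) * (u v + eta)))); last first.
  apply: le_Rintegral => //.
  - exact: bmf_integrable.
  - exact: integrable_tilt.
  move=> v _; rewrite /u; have kv0 := k0 v; have kv1 := k1 v.
  case: (leP v tau) => vt.
    have -> : v <= tau + eta by lra.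
    have -> : 1%:R - (1 - alpha) = alpha by ring.
    rewrite subrr add0r mul1r.
    apply: (@le_trans _ _ (alpha * k v)).
      by rewrite lerBlDr lerDl mulr_ge0// ?ltW// subr_gt0.
    apply: ler_peMr; first by rewrite mulr_ge0 ?(ltW al0).
    by rewrite -expR0 ler_expR mulNr -mulrN opprB mulr_ge0 ?(ltW h0)// subr_ge0.
  rewrite subr0 mul0r mulr0 !sub0r !mulNr lerN2 -mulrA.
  rewrite ler_wpM2l ?subr_ge0 ?(ltW al1)//.
  apply: (@le_trans _ _ (1 * expR (- (h * (v - tau))))).
    by rewrite ler_wpM2r// expR_ge0.
  rewrite mul1r; case: (leP v (tau + eta)) => ve.
    apply: (@le_trans _ _ 1); last by rewrite lerDl ltW.
    by rewrite -expR0 ler_expR oppr_le0 mulr_ge0 ?(ltW h0)// subr_ge0 ltW.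
  rewrite add0r; apply: le_trans heta; rewrite ler_expR lerN2.
  by rewrite ler_wpM2l ?(ltW h0)//; lra.
rewrite bintB; last 2 first.
- by apply: bmfM => //; exact: bmf_cst.
- by apply: bmfM; [exact: bmf_cst|apply: bmfD => //; exact: bmf_cst].
rewrite !bintZ//; last by apply: bmfD => //; exact: bmf_cst.
rewrite bintD//; last exact: bmf_cst.
rewrite bint_cst -/(cumul k tau) -/A0.
have : \int[nu]_v u v <= eta.
  have te : tau <= tau + eta by lra.
  by have := normal_step te; rewrite addrAC subrr add0r.
move=> ue.
have : (1 - alpha) * (\int[nu]_v u v + eta) <= (1 - alpha) * (2 * eta).
  by rewrite ler_wpM2l ?subr_ge0 ?(ltW al1)//; lra.
have : (1 - alpha) * (2 * eta) < 1 * (2 * eta) by rewrite ltr_pM2r//; lra.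
have : 2 * eta = alpha * A0 by rewrite /eta; field.
lra.
Qed.

(** Dominated convergence: for |h| < M the integrand is at most exp(M (v - tau)) + exp(- M (v -
    tau)). *)
Lemma tilt_diff_continuous : continuous tilt_diff.
Proof.
move=> h0; pose M := `|h0| + 1.
have hM : h0 \in (`](- M), M[%classic : set R).
  by rewrite inE/= in_itv/= -ltr_norml /M ltrDl.
pose f (h : R) (v : mR) := ((v <= tau)%R%:R - (1 - alpha)) * k v * expR (h * (v - tau)).
pose g (v : mR) := expR (M * (v - tau)) + expR ((- M) * (v - tau)).
apply: (@continuity_under_integral R _ mR nu f setT measurableT (- M) M _ _ g) => //.
- by move=> h _; exact: integrable_tilt.
- apply: aeW => v _ h _.
  apply: cvgM; first exact: cvg_cst.
  apply: (cvg_comp (fun h => h * (v - tau)) expR); last exact: continuous_expR.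
  by apply: cvgM; [exact: cvg_id|exact: cvg_cst].
- by have := integrableD measurableT (integrable_expR M tau) (integrable_expR (- M) tau);
    apply: eq_integrable.
- move=> h /=; rewrite in_itv/= -ltr_norml => hM'; apply: aeW => v _.
  rewrite normrM (ger0_norm (expR_ge0 _)).
  have /andP[al0 al1] := alpha01.
  have wk : `|((v <= tau)%R%:R - (1 - alpha)) * k v| <= 1.
    rewrite normrM -[leRHS]mulr1 ler_pM// ?(ger0_norm (k0 v))//.
    by rewrite ler_norml; case: (v <= tau) => /=; lra.
  apply: (@le_trans _ _ (1 * expR (h * (v - tau)))); first by rewrite ler_wpM2r// expR_ge0.
  rewrite mul1r; move: hM'; rewrite ltr_norml => /andP[h1 h2].
  case: (leP v tau) => vt.
    apply: (@le_trans _ _ (expR (- M * (v - tau)))); last by rewrite lerDr expR_ge0.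
    by rewrite ler_expR ler_wnM2r ?subr_le0// ltW.
  apply: (@le_trans _ _ (expR (M * (v - tau)))); last by rewrite lerDl expR_ge0.
  by rewrite ler_expR ler_wpM2r ?subr_ge0// ltW.
Qed.

Lemma tilt_root : exists h, tilt_diff h = 0.
Proof.
have [a Ja] := tilt_diff_pos; have [b Jb] := tilt_diff_neg.
have ab : a <= b.
  rewrite leNgt; apply/negP => /tilt_diff_decreasing ba.
  by have := lt_trans (lt_trans Ja ba) Jb; rewrite ltxx.
have [||c _ Jc] := @IVT R tilt_diff a b 0 ab; last by exists c.
  exact/continuous_subspaceT/tilt_diff_continuous.
move: (tilt_diff a) (tilt_diff b) Ja Jb => x y x0 y0.
by rewrite ge_min le_max (ltW x0) (ltW y0) orbT.
Qed.

Lemma tilt_left0 : tilt_left 0 = cumul k tau.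
Proof. by apply: eq_Rintegral => v _; rewrite mul0r expR0 mulr1. Qed.

Lemma tilt_total0 : tilt_total 0 = \int[nu]_v k v.
Proof. by apply: eq_Rintegral => v _; rewrite mul0r expR0 mulr1. Qed.

(** h = 0 is the untilted law, so by strict monotonicity the root is nonnegative exactly when
    [tilt_diff] is nonnegative at 0. *)
Lemma tilt_unique_root : exists2 h0 : R,
  unique (fun h => tilt_left h / tilt_total h = 1 - alpha) h0 &
  (0 <= h0) = ((1 - alpha) * (\int[nu]_v k v) <= cumul k tau).
Proof.
have ratioE h : tilt_left h / tilt_total h = 1 - alpha <-> tilt_diff h = 0.
  rewrite tilt_diffE; have D0 := tilt_total_gt0 h; split => [<-|/eqP].
    by rewrite divfK ?subrr// gt_eqF.
  by rewrite subr_eq0 => /eqP ->; rewrite mulfK// gt_eqF.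
have [h0 Jh0] := tilt_root; exists h0.
  split; first exact/ratioE.
  move=> h /ratioE Jh; apply/eqP; rewrite eq_le !leNgt; apply/andP; split.
    by apply/negP => /tilt_diff_decreasing; rewrite Jh Jh0 ltxx.
  by apply/negP => /tilt_diff_decreasing; rewrite Jh Jh0 ltxx.
rewrite -tilt_left0 -tilt_total0 -[RHS]subr_ge0 -tilt_diffE.
have [h0p|h0n|h00] := ltgtP 0 h0.
- by have := tilt_diff_decreasing h0p; rewrite Jh0 => /ltW ->.
- by have := tilt_diff_decreasing h0n; rewrite Jh0 ltNge => /negbTE ->.
- by move: Jh0; rewrite -h00 => ->; rewrite lexx.
Qed.

End tilting.

Section truncated_normal.
Context {R : realType}.
Local Notation mu := (@lebesgue_measure R).
Local Notation nu := (@normal_prob R 0 1).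
Local Notation mR := (measurableTypeR R).

(** Substitute t = mu0 + s v and expand the shifted density. The factor in front does not depend on
    chi, so it cancels in the ratio that defines [F_TN]. *)
Lemma Rintegral_normal_pdf_tilt (chi : mR -> R) (mu0 s h tau : R) :
  0 < s -> measurable_fun setT chi -> (forall t, 0 <= chi t <= 1) ->
  \int[mu]_t (normal_pdf 0 1 ((t - (mu0 + s * h)) / s) * chi t) =
  s * expR (h * tau - h ^+ 2 / 2) *
    \int[nu]_v (chi (mu0 + s * v) * expR (h * (v - tau))).
Proof.
move=> s0 mchi chi01.
have chi0 t : 0 <= chi t by case/andP: (chi01 t).
have maff : measurable_fun [set: mR] (fun v : mR => (mu0 + s * v : mR)).
  by apply: measurable_funD => //; exact: measurable_funM.
have mchi' : measurable_fun [set: mR] (fun v : mR => chi (mu0 + s * v)).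
  exact: (measurableT_comp mchi maff).
have mpdf : measurable_fun [set: mR] (normal_pdf 0 1 : mR -> R).
  exact: measurable_normal_pdf.
have mexp : measurable_fun [set: mR] (fun v : mR => expR (h * (v - tau))).
  by have /measurable_EFinP := measurable_int _ (integrable_expR h tau).
have it : nu.-integrable setT
    (EFin \o (fun v : mR => chi (mu0 + s * v) * expR (h * (v - tau)))).
  apply: integrable_tilt; exact: bmf01.
rewrite /Rintegral.
have -> : (\int[mu]_t (normal_pdf 0 1 ((t - (mu0 + s * h)) / s) * chi t)%:E =
    (s * expR (h * tau - h ^+ 2 / 2))%:E *
    \int[nu]_v (chi (mu0 + s * v) * expR (h * (v - tau)))%:E)%E; last first.
  by rewrite -[in LHS](fineK (integrable_fin_num _ it)).
have mf : measurable_fun [set: mR]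
    (fun t : mR => (normal_pdf 0 1 ((t - (mu0 + s * h)) / s) * chi t)%:E).
  apply/measurable_EFinP/measurable_funM => //; apply: (measurableT_comp mpdf).
  by apply: measurable_funM => //; exact: measurable_funB.
rewrite (ge0_integral_affine mu0 (lt0r_neq0 s0) mf); last first.
  by move=> t; rewrite lee_fin mulr_ge0 ?normal_pdf_ge0.
rewrite ge0_integral_normal_prob; last 2 first.
- by apply/measurable_EFinP/measurable_funM.
- by move=> v; rewrite lee_fin mulr_ge0 ?expR_ge0.
rewrite gtr0_norm// EFinM -muleA; congr (_ * _)%E.
rewrite -ge0_integralZl//; last 2 first.
- apply: emeasurable_funM; apply/measurable_EFinP => //.
  exact: measurable_funM.
- by move=> v _; rewrite mule_ge0 ?lee_fin ?mulr_ge0 ?expR_ge0 ?normal_pdf_ge0.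
apply: eq_integral => v _; rewrite -!EFinM; congr EFin.
have -> : (mu0 + s * v - (mu0 + s * h)) / s = v - h by field; rewrite gt_eqF.
rewrite normal_pdf_shift.
have -> : expR (h * v - h ^+ 2 / 2) =
    expR (h * tau - h ^+ 2 / 2) * expR (h * (v - tau)).
  by rewrite -expRD; congr expR; ring.
ring.
Qed.

(** Writing a candidate mean as mu0 + s h turns the equation for the mean into the one for the tilt
    h; the reference value mu0 corresponds to h = 0. *)
Lemma F_TN_root (z mu0 s2 alpha : R) (Z : set R) :
  0 < s2 -> 0 < alpha < 1 -> measurable (Z : set mR) ->
  let s := Num.sqrt s2 in
  let k := fun v : mR => \1_Z (mu0 + s * v) : R in
  let tau := (z - mu0) / s in
  0 < cumul k tau -> cumul k tau < \int[nu]_v k v ->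
  exists2 m : R, unique (fun u => F_TN z u s2 Z = 1 - alpha) m &
    (mu0 <= m) = ((1 - alpha) * (\int[nu]_v k v) <= cumul k tau).
Proof.
move=> s20 alpha01 mZ s k tau kl kr.
have s0 : 0 < s by rewrite sqrtr_gt0.
have mI : measurable_fun setT (\1_Z : mR -> R) by exact: measurable_indic.
have I01 t : 0 <= (\1_Z t : R) <= 1 by rewrite indicE lern1 leq_b1 ler0n.
have mk : measurable_fun setT k.
  apply: (measurableT_comp mI).
  by apply: measurable_funD => //; exact: measurable_funM.
have k01 v : 0 <= k v <= 1 by exact: I01.
have FE h : F_TN z (mu0 + s * h) s2 Z = tilt_left k tau h / tilt_total k tau h.
  rewrite /F_TN Rintegral_mkcond.
  pose chi (t : mR) := (t <= z)%R%:R * \1_Z t : R.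
  rewrite (_ : \int[mu]_x _ = \int[mu]_t
    (normal_pdf 0 1 ((t - (mu0 + s * h)) / s) * chi t)); last first.
    apply: eq_Rintegral => t _; rewrite patchE /chi.
    have -> : (t \in (`]-oo, z]%classic : set R)) = (t <= z).
      by apply/idP/idP; rewrite inE/= in_itv.
    by case: (t <= z); rewrite ?mul1r// mul0r mulr0.
  have mchi : measurable_fun setT chi.
    by apply: measurable_funM => //; case: (bmf_leq_cst z).
  have chi01 t : 0 <= chi t <= 1.
    rewrite /chi; case: (t <= z); rewrite ?mul1r ?I01// mul0r lexx ler01 //.
  rewrite (Rintegral_normal_pdf_tilt mu0 h tau s0 mchi chi01).
  rewrite (Rintegral_normal_pdf_tilt mu0 h tau s0 mI I01).
  rewrite -mulf_div divff ?mul1r; last first.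
    by rewrite mulf_neq0 ?gt_eqF ?expR_gt0.
  congr (_ / _); apply: eq_Rintegral => v _; rewrite /chi /k; congr (_%:R * _ * _).
  congr nat_of_bool.
  by rewrite /tau ler_pdivlMr// lerBrDl mulrC.
have [h0 [root0 uniq0] h0E] := tilt_unique_root mk k01 alpha01 kl kr.
exists (mu0 + s * h0); last by rewrite lerDl pmulr_rge0.
split; first by rewrite FE.
move=> u; have -> : u = mu0 + s * ((u - mu0) / s).
  by field; rewrite gt_eqF.
by rewrite FE => /uniq0 ->.
Qed.

End truncated_normal.

(** * Lipschitz approximation of the selection event *)

Section clamp.
Context {R : realType}.
Implicit Types (t d : R).

(* [ramp d] is Lipschitz and [tent d] dominates its distance to [ind0] and to
   the shifts of [ind0] by at most d. *)
Definition clamp01 t : R := Num.min 1 (Num.max 0 t).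
Definition ind0 t : R := (0 <= t)%R%:R.
Definition ramp d t : R := clamp01 (t / d).
Definition tent d t : R := clamp01 (2 - `|t| / d).

Lemma clamp01_itv t : 0 <= clamp01 t <= 1.
Proof.
rewrite /clamp01; case: (leP 0 t) => t0; case: (leP 1 _) => t1;
  rewrite ?lexx ?ler01//=; lra.
Qed.

Lemma clamp01_ge0 t : 0 <= clamp01 t. Proof. by case/andP: (clamp01_itv t). Qed.
Lemma clamp01_le1 t : clamp01 t <= 1. Proof. by case/andP: (clamp01_itv t). Qed.

Lemma clamp01_0 t : t <= 0 -> clamp01 t = 0.
Proof. by move=> t0; rewrite /clamp01 (max_idPl t0) (min_idPr ler01). Qed.

Lemma clamp01_1 t : 1 <= t -> clamp01 t = 1.
Proof.
move=> t1; rewrite /clamp01 (max_idPr _) ?(min_idPl t1)//.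
exact: le_trans t1.
Qed.

Lemma clamp01_id t : 0 <= t <= 1 -> clamp01 t = t.
Proof. by move=> /andP[t0 t1]; rewrite /clamp01 (max_idPr t0) (min_idPr t1). Qed.

Lemma clamp01P t :
  [\/ t <= 0 /\ clamp01 t = 0, 0 <= t <= 1 /\ clamp01 t = t |
      1 <= t /\ clamp01 t = 1].
Proof.
case/orP: (le_total t 0) => t0; first by apply: Or31; rewrite clamp01_0.
case/orP: (le_total t 1) => t1; last by apply: Or33; rewrite clamp01_1.
have t01 : 0 <= t <= 1 by rewrite t0 t1.
exact: (Or32 _ _ (conj t01 (clamp01_id t01))).
Qed.

Lemma clamp01_lip s t : `|clamp01 s - clamp01 t| <= `|s - t|.
Proof.
have [[s0 ->]|[/andP[s0 s1] ->]|[s1 ->]] := clamp01P s;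
  have [[t0 ->]|[/andP[t0 t1] ->]|[t1 ->]] := clamp01P t;
  rewrite ler_norml; case: (ler0P (s - t)) => st; apply/andP; split; lra.
Qed.

Lemma measurable_clamp01 : measurable_fun setT (clamp01 : measurableTypeR R -> R).
Proof.
apply: measurable_minr; first exact: measurable_cst.
by apply: measurable_maxr; first exact: measurable_cst.
Qed.

Lemma ind0_itv t : 0 <= ind0 t <= 1.
Proof. by rewrite /ind0 ler0n lern1 leq_b1. Qed.

Lemma ramp_lip d s t : 0 < d -> `|ramp d s - ramp d t| <= `|s - t| / d.
Proof.
move=> d0; apply: le_trans (clamp01_lip _ _) _.
by rewrite -mulrBl normrM (gtr0_norm (_ : 0 < d^-1)) ?invr_gt0.
Qed.

Lemma tent_lip d s t : 0 < d -> `|tent d s - tent d t| <= `|s - t| / d.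
Proof.
move=> d0; apply: le_trans (clamp01_lip _ _) _.
rewrite opprD addrACA subrr add0r opprK -mulNr -mulrDl normrM.
rewrite (gtr0_norm (_ : 0 < d^-1)) ?invr_gt0// ler_wpM2r ?invr_ge0 ?(ltW d0)//.
by rewrite addrC distrC; apply: le_trans (ler_dist_dist _ _) _; rewrite distrC.
Qed.

Lemma tent1 d t : 0 < d -> `|t| <= d -> tent d t = 1.
Proof.
move=> d0 td; apply: clamp01_1.
have : `|t| / d <= 1 by rewrite ler_pdivrMr// mul1r.
lra.
Qed.

Lemma tent_supp d t : 0 < d -> 0 <= tent d t <= (`|t| <= 2 * d)%R%:R.
Proof.
move=> d0; rewrite clamp01_ge0; case: (leP `|t| (2 * d)) => td /=; first exact: clamp01_le1.
rewrite /tent clamp01_0//; have : 2 <= `|t| / d by rewrite ler_pdivlMr// ltW.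
lra.
Qed.

(** Where |t| <= d the tent is 1 and pays for everything. Elsewhere the ramp is saturated and s lies
    on the same side of 0 as t. *)
Lemma ind0_ramp d s t : 0 < d -> `|s - t| <= d -> `|ind0 s - ramp d t| <= tent d t.
Proof.
move=> d0 st; have [td|td] := leP `|t| d.
  rewrite tent1// ler_norml.
  have /andP[s0 s1] := ind0_itv s; have /andP[t0 t1] := clamp01_itv (t / d).
  by rewrite /ramp; apply/andP; split; lra.
apply: (@le_trans _ _ 0); last exact: clamp01_ge0.
rewrite normr_le0 subr_eq0; move: td; rewrite ltr_normr => /orP[td|td].
  rewrite /ramp clamp01_1; last by rewrite ler_pdivlMr// mul1r ltW.
  by rewrite /ind0; have -> : 0 <= s by move: st; rewrite ler_norml => /andP[? ?]; lra.
rewrite /ramp clamp01_0; last by rewrite ler_pdivrMr// mul0r; lra.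
rewrite /ind0; have -> // : (0 <= s) = false.
by apply/negbTE; rewrite -ltNge; move: st; rewrite ler_norml => /andP[? ?]; lra.
Qed.

(** Unlike [ramp], it rises on [-d, 0] and so dominates the indicator of 0 <= t, as
    [level_mass_step] requires. *)
Definition soft_step d t : R := clamp01 (1 + t / d).

Lemma soft_stepP d t : 0 < d -> (0 <= t)%R%:R <= soft_step d t <= (- d <= t)%R%:R.
Proof.
move=> d0; apply/andP; split.
  case: (leP 0 t) => t0 /=; last exact: clamp01_ge0.
  by rewrite /soft_step clamp01_1// lerDl divr_ge0// ltW.
case: (leP (- d) t) => td /=; first exact: clamp01_le1.
rewrite /soft_step clamp01_0//.
have : t / d <= -1 by rewrite ler_pdivrMr// mulN1r ltW.
lra.
Qed.

Lemma soft_step_lip d s t : 0 < d -> `|soft_step d s - soft_step d t| <= `|s - t| / d.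
Proof.
move=> d0; apply: le_trans (clamp01_lip _ _) _.
rewrite opprD addrACA subrr add0r -mulrBl normrM.
by rewrite (gtr0_norm (_ : 0 < d^-1)) ?invr_gt0.
Qed.

Lemma prod01 (I : Type) (r : seq I) (a : I -> R) :
  (forall i, 0 <= a i <= 1) -> 0 <= \prod_(i <- r) a i <= 1.
Proof.
move=> a01; apply: (big_ind (fun x : R => 0 <= x <= 1)); first by rewrite ler01 lexx.
  by move=> x y /andP[? ?] /andP[? ?]; rewrite mulr_ge0//= mulr_ile1.
by [].
Qed.

Lemma prod01_diff (I : Type) (r : seq I) (a b : I -> R) :
  (forall i, 0 <= a i <= 1) -> (forall i, 0 <= b i <= 1) ->
  `|\prod_(i <- r) a i - \prod_(i <- r) b i| <= \sum_(i <- r) `|a i - b i|.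
Proof.
move=> a01 b01; elim: r => [|i r IHr]; first by rewrite !big_nil subrr normr0.
rewrite !big_cons.
set x := \prod_(j <- r) a j in IHr *; set y := \prod_(j <- r) b j in IHr *.
have /andP[y0 y1] : 0 <= y <= 1 by exact: prod01.
have /andP[a0 a1] := a01 i.
have -> : a i * x - b i * y = a i * (x - y) + (a i - b i) * y by ring.
apply: le_trans (ler_normD _ _) _; rewrite addrC; apply: lerD.
  by rewrite normrM (ger0_norm y0) ler_piMr.
by apply: le_trans IHr; rewrite normrM (ger0_norm a0) ler_piMl.
Qed.

End clamp.

Section l1_norm.
Context {R : realType}.

(** For this norm the triangle inequality and the product bounds are immediate; returning to
    [frob_norm], used in [BL1], costs a factor p. *)
Definition l1 m n (M : 'M[R]_(m, n)) : R := \sum_i \sum_j `|M i j|.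

Lemma l1_ge0 m n (M : 'M[R]_(m, n)) : 0 <= l1 M.
Proof. by apply: sumr_ge0 => i _; apply: sumr_ge0 => j _. Qed.

Lemma l1_entry m n (M : 'M[R]_(m, n)) i j : `|M i j| <= l1 M.
Proof.
rewrite /l1 (bigD1 i)//= (bigD1 j)//= -addrA lerDl addr_ge0//.
  exact: sumr_ge0.
by apply: sumr_ge0 => k _; apply: sumr_ge0.
Qed.

Lemma l1D m n (M N : 'M[R]_(m, n)) : l1 (M + N) <= l1 M + l1 N.
Proof.
rewrite /l1 -big_split; apply: ler_sum => i _; rewrite -big_split.
by apply: ler_sum => j _; rewrite mxE ler_normD.
Qed.

Lemma l1Z m n a (M : 'M[R]_(m, n)) : l1 (a *: M) = `|a| * l1 M.
Proof.
rewrite /l1 mulr_sumr; apply: eq_bigr => i _; rewrite mulr_sumr.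
by apply: eq_bigr => j _; rewrite mxE normrM.
Qed.

Lemma l1_mulmx m n (M : 'M[R]_(m, n)) (x : 'cV[R]_n) j :
  `|(M *m x) j 0| <= l1 M * l1 x.
Proof.
rewrite mxE; apply: le_trans (ler_norm_sum _ _ _) _.
apply: (@le_trans _ _ (\sum_i `|M j i| * l1 x)).
  by apply: ler_sum => i _; rewrite normrM ler_wpM2l// l1_entry.
rewrite -mulr_suml ler_wpM2r ?l1_ge0// /l1 (bigD1 j)//= lerDl.
by apply: sumr_ge0 => k _; apply: sumr_ge0.
Qed.

Lemma l1_dotv p (u x : 'cV[R]_p) : `|dotv u x| <= l1 u * l1 x.
Proof.
rewrite /dotv; apply: le_trans (l1_mulmx _ _ _) _.
rewrite ler_wpM2r ?l1_ge0// le_eqVlt; apply/orP; left; apply/eqP.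
rewrite /l1 exchange_big; apply: eq_bigr => i _; apply: eq_bigr => j _.
by rewrite mxE.
Qed.

Lemma frob_norm_ge0 m n (M : 'M[R]_(m, n)) : 0 <= frob_norm M.
Proof. exact: sqrtr_ge0. Qed.

Lemma frob_norm_entry m n (M : 'M[R]_(m, n)) i j : `|M i j| <= frob_norm M.
Proof.
rewrite -sqrtr_sqr /frob_norm ler_wsqrtr// (bigD1 i)//= (bigD1 j)//= -addrA lerDl.
rewrite addr_ge0//; first by apply: sumr_ge0 => k _; exact: sqr_ge0.
by apply: sumr_ge0 => k _; apply: sumr_ge0 => h _; exact: sqr_ge0.
Qed.

Lemma l1_frob_norm p (x : 'cV[R]_p) : l1 x <= p%:R * frob_norm x.
Proof.
apply: (@le_trans _ _ (\sum_(i < p) frob_norm x)).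
  by apply: ler_sum => i _; rewrite big_ord1 frob_norm_entry.
by rewrite sumr_const card_ord mulr_natl.
Qed.

Definition Lip p (L : R) (f : 'cV[R]_p -> R) : Prop :=
  forall x y, `|f x - f y| <= L * l1 (x - y).

Lemma LipW p L L' (f : 'cV[R]_p -> R) : L <= L' -> Lip L f -> Lip L' f.
Proof.
by move=> LL' fL x y; apply: le_trans (fL x y) _; rewrite ler_wpM2r// l1_ge0.
Qed.

Lemma LipZ p L a (f : 'cV[R]_p -> R) : Lip L f -> Lip (`|a| * L) (fun x => a * f x).
Proof. by move=> fL x y; rewrite -mulrBr normrM -mulrA ler_wpM2l. Qed.

Lemma LipB p L L' (f f' : 'cV[R]_p -> R) :
  Lip L f -> Lip L' f' -> Lip (L + L') (fun x => f x - f' x).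
Proof.
move=> fL fL' x y; rewrite mulrDl.
have -> : f x - f' x - (f y - f' y) = (f x - f y) - (f' x - f' y) by ring.
by apply: le_trans (ler_normB _ _) _; rewrite lerD.
Qed.

Lemma LipM p L L' (f f' : 'cV[R]_p -> R) :
  (forall x, `|f x| <= 1) -> (forall x, `|f' x| <= 1) ->
  Lip L f -> Lip L' f' -> Lip (L + L') (fun x => f x * f' x).
Proof.
move=> f1 f'1 fL fL' x y.
have -> : f x * f' x - f y * f' y = (f x - f y) * f' x + f y * (f' x - f' y) by ring.
apply: le_trans (ler_normD _ _) _; rewrite [leRHS]mulrDl !normrM; apply: lerD.
  by apply: le_trans (fL x y); rewrite ler_piMr.
by apply: le_trans (fL' x y); rewrite ler_piMl.
Qed.

Lemma Lip_comp p L C (h : R -> R) (f : 'cV[R]_p -> R) : 0 <= C ->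
  (forall s t, `|h s - h t| <= C * `|s - t|) -> Lip L f -> Lip (C * L) (h \o f).
Proof.
move=> C0 hC fL x y; apply: le_trans (hC _ _) _.
by rewrite -mulrA ler_wpM2l.
Qed.

End l1_norm.

Section real_borel_functions.
Context {R : realType}.
Local Notation nu := (@normal_prob R 0 1).
Local Notation mR := (measurableTypeR R).

Definition borelR p (f : 'cV[R]_p -> R) : Prop :=
  forall d (T : measurableType d) (X : T -> 'cV[R]_p),
    random_mx X -> measurable_fun setT (fun w => f (X w)).

Lemma borelR_EFin p (f : 'cV[R]_p -> R) : borelR f -> borel_fun (EFin \o f).
Proof. by move=> bf d T X mX; apply/measurable_EFinP; exact: bf. Qed.

Lemma borelR_cst p (a : R) : borelR (fun _ : 'cV[R]_p => a).
Proof. by move=> d T X mX; exact: measurable_cst. Qed.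

Lemma borelRB p (f g : 'cV[R]_p -> R) :
  borelR f -> borelR g -> borelR (fun x => f x - g x).
Proof. by move=> bf bg d T X mX; apply: measurable_funB; [exact: bf|exact: bg]. Qed.

Lemma borelRM p (f g : 'cV[R]_p -> R) :
  borelR f -> borelR g -> borelR (fun x => f x * g x).
Proof. by move=> bf bg d T X mX; apply: measurable_funM; [exact: bf|exact: bg]. Qed.

Lemma borelR_comp p (f : 'cV[R]_p -> R) (h : mR -> R) :
  measurable_fun setT h -> borelR f -> borelR (fun x => h (f x)).
Proof. by move=> mh bf d T X mX; apply: (measurableT_comp mh); exact: bf. Qed.

Lemma borelR_sum p (I : Type) (r : seq I) (f : I -> 'cV[R]_p -> R) :
  (forall i, borelR (f i)) -> borelR (fun x => \sum_(i <- r) f i x).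
Proof.
by move=> bf d T X mX; apply: measurable_sum => i; exact: bf.
Qed.

Lemma borelR_prod p (I : eqType) (r : seq I) (f : I -> 'cV[R]_p -> R) :
  (forall i, borelR (f i)) -> borelR (fun x => \prod_(i <- r) f i x).
Proof.
by move=> bf d T X mX; apply: measurable_prod => i _; exact: bf.
Qed.

Lemma borelR_dotv p (m : 'cV[R]_p) : borelR (dotv m).
Proof. by move=> d T X mX; apply: measurable_dotv => //; exact: random_mx_cst. Qed.

Lemma borelR_mulmx n p (M : 'M[R]_(n, p)) j : borelR (fun x => (M *m x) j 0).
Proof.
move=> d T X mX; apply: (random_mxM (X := fun=> M) (Y := X)) => //.
Qed.

Lemma borelR_integral p (F : 'cV[R]_p -> mR -> R) :
  (forall d (T : measurableType d) (X : T -> 'cV[R]_p), random_mx X ->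
    measurable_fun setT (fun z : T * mR => F (X z.1) z.2)) ->
  (forall x v, 0 <= F x v) ->
  borelR (fun x => \int[nu]_v F x v).
Proof.
move=> mF F0 d T X mX.
pose h (z : T * mR) := (F (X z.1) z.2)%:E.
have h0 z : (0 <= h z)%E by rewrite lee_fin F0.
have mh : measurable_fun setT h by apply/measurable_EFinP; exact: mF.
have := @measurable_fun_fubini_tonelli_F _ _ _ _ _ nu h mh h0.
by move=> mI; apply: (measurableT_comp (fine_measurable measurableT) mI).
Qed.

End real_borel_functions.

Section lines.
Context {R : realType} {p : nat}.
Local Notation nu := (@normal_prob R 0 1).
Local Notation mR := (measurableTypeR R).
Implicit Types (f : 'cV[R]_p -> R) (m g x y : 'cV[R]_p).

Definition along f m g x : mR -> R := fun v => f (relevel m g x v).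
Definition cum_line f m g x : R := cumul (along f m g x) (dotv m x).
Definition tot_line f m g x : R := \int[nu]_v along f m g x v.

(* Normalized by [tot_line], this is the truncated normal c.d.f. minus [a]. *)
Definition gap_line a f m g x : R := cum_line f m g x - a * tot_line f m g x.

Lemma measurable_along f m g x : borelR f -> measurable_fun setT (along f m g x).
Proof.
move=> bf; apply: (bf _ _ (fun v : mR => relevel m g x v)).
by apply: (random_mx_line (X := fun=> x)) => //; exact: random_mx_cst.
Qed.

Lemma bmf_along f m g x : borelR f -> (forall y, 0 <= f y <= 1) ->
  bmf (along f m g x).
Proof. by move=> bf f01; apply: bmf01 => [|v]; [exact: measurable_along|exact: f01]. Qed.

Lemma measurable_relevel2 f m g d (T : measurableType d) (X : T -> 'cV[R]_p) :
  borelR f -> random_mx X ->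
  measurable_fun setT (fun z : T * mR => along f m g (X z.1) z.2).
Proof.
move=> bf mX; apply: (bf _ _ (fun z : T * mR => relevel m g (X z.1) z.2)).
apply: (random_mx_line (X := fun z : T * mR => X z.1)) => //.
exact: random_mx_comp.
Qed.

Lemma borelR_tot_line f m g : borelR f -> (forall y, 0 <= f y <= 1) ->
  borelR (tot_line f m g).
Proof.
move=> bf f01; apply: borelR_integral => [d T X mX|x v].
  exact: measurable_relevel2.
by case/andP: (f01 (relevel m g x v)).
Qed.

Lemma borelR_cum_line f m g : borelR f -> (forall y, 0 <= f y <= 1) ->
  borelR (cum_line f m g).
Proof.
move=> bf f01; apply: borelR_integral => [d T X mX|x v].
  apply: measurable_funM; last exact: measurable_relevel2.
  apply: measurable_nat_of_bool; apply: measurable_fun_ler => //.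
  apply: (borelR_dotv m (X := fun z : T * mR => X z.1)).
  exact: random_mx_comp.
by rewrite mulr_ge0//; case/andP: (f01 (relevel m g x v)).
Qed.

Lemma borelR_gap_line a f m g : borelR f -> (forall y, 0 <= f y <= 1) ->
  borelR (gap_line a f m g).
Proof.
move=> bf f01; apply: borelRB; first exact: borelR_cum_line.
by apply: borelRM; [exact: borelR_cst|exact: borelR_tot_line].
Qed.

Lemma dotv_relevel m g x v : dotv m g = 1 -> dotv m (relevel m g x v) = v.
Proof. by move=> mg; rewrite /relevel dotvDr dotvZr mg mulr1 addrC subrK. Qed.

Lemma relevelK m g x u v : dotv m g = 1 ->
  relevel m g (relevel m g x u) v = relevel m g x v.
Proof.
move=> mg; rewrite {1}/relevel dotv_relevel// /relevel -addrA -scalerDl.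
by congr (_ + _ *: _); ring.
Qed.

Lemma along_relevel f m g x u : dotv m g = 1 ->
  along f m g (relevel m g x u) = along f m g x.
Proof. by move=> mg; apply/funext => v; rewrite /along relevelK. Qed.

Lemma gap_line_relevel a f m g x u : dotv m g = 1 ->
  gap_line a f m g (relevel m g x u) =
  cumul (along f m g x) u - a * \int[nu]_v along f m g x v.
Proof.
by move=> mg; rewrite /gap_line /cum_line /tot_line along_relevel// dotv_relevel.
Qed.

Lemma cum_line_itv f m g x : borelR f -> (forall y, 0 <= f y <= 1) ->
  0 <= cum_line f m g x <= tot_line f m g x.
Proof.
move=> bf f01; have ml := measurable_along m g x bf.
have l01 v : 0 <= along f m g x v <= 1 by exact: f01.
by rewrite cumul_ge0//= cumul_le.
Qed.

Lemma tot_line_itv f m g x : borelR f -> (forall y, 0 <= f y <= 1) ->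
  0 <= tot_line f m g x <= 1.
Proof.
move=> bf f01; rewrite bint_ge0/=; last by move=> v; case/andP: (f01 (relevel m g x v)).
apply: bint_le1; first exact: bmf_along.
by move=> v; case/andP: (f01 (relevel m g x v)).
Qed.

Lemma l1_relevelB m g x y v :
  l1 (relevel m g x v - relevel m g y v) <= (1 + l1 m * l1 g) * l1 (x - y).
Proof.
have -> : relevel m g x v - relevel m g y v = (x - y) + (- dotv m (x - y)) *: g.
  rewrite /relevel dotvBr; apply/matrixP => i j; rewrite !mxE; ring.
apply: le_trans (l1D _ _) _; rewrite mulrDl mul1r lerD2l l1Z normrN.
rewrite mulrAC ler_wpM2r ?l1_ge0//; exact: l1_dotv.
Qed.

Lemma Lip_along L f m g x y v : Lip L f -> 0 <= L ->
  `|along f m g x v - along f m g y v| <= L * (1 + l1 m * l1 g) * l1 (x - y).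
Proof.
move=> fL L0; apply: le_trans (fL _ _) _; rewrite -mulrA ler_wpM2l//.
exact: l1_relevelB.
Qed.

Lemma Lip_tot_line L f m g : borelR f -> (forall y, 0 <= f y <= 1) ->
  0 <= L -> Lip L f -> Lip (L * (1 + l1 m * l1 g)) (tot_line f m g).
Proof.
move=> bf f01 L0 fL x y; have bx := bmf_along m g x bf f01.
have by_ := bmf_along m g y bf f01.
rewrite /tot_line -bintB//; apply: le_trans (ler_norm_bint _ _) _.
  exact: bmfB.
rewrite -[leRHS](bint_cst nu); apply: ler_bint.
- by apply: bmf_norm; exact: bmfB.
- exact: bmf_cst.
- by move=> v; exact: Lip_along.
Qed.

(** Two effects add up: the threshold [dotv m x] moves, at a cost bounded by [normal_step_norm], and
    the weight along the line changes. *)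
Lemma Lip_cum_line L f m g : borelR f -> (forall y, 0 <= f y <= 1) ->
  0 <= L -> Lip L f -> Lip (l1 m + L * (1 + l1 m * l1 g)) (cum_line f m g).
Proof.
move=> bf f01 L0 fL x y; have bx := bmf_along m g x bf f01.
have by_ := bmf_along m g y bf f01.
have bi a : bmf (fun v : mR => (v <= a)%R%:R : R) by exact: bmf_leq_cst.
rewrite /cum_line /cumul -bintB; [|exact: bmfM..].
apply: le_trans (ler_norm_bint _ _) _; first by apply: bmfB; exact: bmfM.
apply: (@le_trans _ _ (\int[nu]_v (`|((v <= dotv m x)%R%:R : R) - (v <= dotv m y)%R%:R| +
    L * (1 + l1 m * l1 g) * l1 (x - y)))).
  apply: ler_bint.
  - by apply: bmf_norm; apply: bmfB; exact: bmfM.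
  - by apply: bmfD; [apply: bmf_norm; exact: bmfB|exact: bmf_cst].
  move=> v; set a := (v <= dotv m x)%R%:R; set b := (v <= dotv m y)%R%:R.
  have -> : a * along f m g x v - b * along f m g y v =
    (a - b) * along f m g x v + b * (along f m g x v - along f m g y v) by ring.
  apply: le_trans (ler_normD _ _) _; rewrite !normrM; apply: lerD.
    rewrite ler_piMr//; have /andP[h0 h1] := f01 (relevel m g x v).
    by rewrite ger0_norm.
  apply: le_trans (Lip_along m g x y v fL L0); rewrite ler_piMl//.
  by rewrite ger0_norm /b ?lern1 ?leq_b1.
rewrite bintD; last 2 first.
- by apply: bmf_norm; exact: bmfB.
- exact: bmf_cst.
rewrite bint_cst mulrDl lerD2r.
apply: le_trans (normal_step_norm _ _) _.
by rewrite -dotvBr; exact: l1_dotv.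
Qed.

Lemma Lip_gap_line L a f m g : borelR f -> (forall y, 0 <= f y <= 1) ->
  0 <= L -> 0 <= a <= 1 -> Lip L f ->
  Lip (l1 m + 2 * (L * (1 + l1 m * l1 g))) (gap_line a f m g).
Proof.
move=> bf f01 L0 /andP[a0 a1] fL.
have h := LipB (Lip_cum_line m g bf f01 L0 fL) (LipZ a (Lip_tot_line m g bf f01 L0 fL)).
apply: LipW h; rewrite ger0_norm//.
set B := L * _; have B0 : 0 <= B.
  by rewrite mulr_ge0// addr_ge0// mulr_ge0// l1_ge0.
have : a * B <= 1 * B by rewrite ler_wpM2r.
lra.
Qed.

End lines.

Section gaussian_expectations.
Context {R : realType} {p : nat} d (T : measurableType d) (Q : probability T R).
Local Notation nu := (@normal_prob R 0 1).
Local Notation mR := (measurableTypeR R).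
Variable xi : T -> 'cV[R]_p.
Hypothesis mxi : random_mx xi.
Implicit Types (f : 'cV[R]_p -> R) (m g x y : 'cV[R]_p).

Lemma bmf_borelR f (X : T -> 'cV[R]_p) : random_mx X -> borelR f ->
  (forall y, 0 <= f y <= 1) -> bmf (fun w => f (X w)).
Proof. by move=> mX bf f01; apply: bmf01 => [|w]; [exact: bf|exact: f01]. Qed.

Lemma expectation_resample f m g : resamples Q xi m g -> borelR f ->
  (forall y, 0 <= f y <= 1) ->
  \int[Q]_w f (xi w) = \int[Q]_w tot_line f m g (xi w).
Proof.
move=> rs bf f01.
have f0 y : (0 <= (EFin \o f) y)%E by rewrite lee_fin; case/andP: (f01 y).
have := rs _ (borelR_EFin bf) f0.
rewrite /= bmf_EFin; last exact: bmf_borelR.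
rewrite (eq_integral (fun w => (tot_line f m g (xi w))%:E)); last first.
  by move=> w _; rewrite -bmf_EFin//; exact: bmf_along.
rewrite bmf_EFin; first by case.
apply: bmf_borelR => //; first exact: borelR_tot_line.
by move=> y; exact: tot_line_itv.
Qed.

(** [level_mass_step] on each line, then integrated over lines: after [gap_line_relevel] the gap
    depends on the position v alone, the weight along the line being fixed. *)
Lemma expectation_soft_step f m g a eps : resamples Q xi m g -> dotv m g = 1 ->
  borelR f -> (forall y, 0 <= f y <= 1) -> 0 <= a <= 1 -> 0 < eps ->
  `|\int[Q]_w (f (xi w) * soft_step eps (gap_line a f m g (xi w)))
    - (1 - a) * \int[Q]_w f (xi w)| <= eps.
Proof.
move=> rs mg bf f01 a01 eps0.
have mh : measurable_fun setT (soft_step eps : mR -> R).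
  apply: (measurableT_comp measurable_clamp01).
  by apply: measurable_funD => //; exact: measurable_funM.
pose F x := f x * soft_step eps (gap_line a f m g x).
have bF : borelR F.
  by apply: borelRM => //; apply: borelR_comp => //; exact: borelR_gap_line.
have F01 y : 0 <= F y <= 1.
  have /andP[f0 f1] := f01 y.
  have /andP[s0 s1] := clamp01_itv (1 + gap_line a f m g y / eps).
  by rewrite mulr_ge0//= mulr_ile1.
rewrite -/(\int[Q]_w F (xi w)) (expectation_resample rs bF F01).
rewrite (expectation_resample rs bf f01).
have btf : bmf (fun w => tot_line f m g (xi w)).
  apply: bmf_borelR => //; first exact: borelR_tot_line.
  by move=> y; exact: tot_line_itv.
have btF : bmf (fun w => tot_line F m g (xi w)).
  apply: bmf_borelR => //; first exact: borelR_tot_line.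
  by move=> y; exact: tot_line_itv.
have key x : (1 - a) * tot_line f m g x <= tot_line F m g x
    <= (1 - a) * tot_line f m g x + eps.
  have := @level_mass_step R (along f m g x) (measurable_along m g x bf)
    (fun v => f01 (relevel m g x v)) a eps (soft_step eps) a01 eps0 mh (fun t => soft_stepP t eps0).
  have <- : tot_line F m g x = \int[nu]_v (along f m g x v * soft_step eps
      (cumul (along f m g x) v - a * \int[nu]_u along f m g x u)).
    by apply: eq_Rintegral => v _; rewrite /along /F gap_line_relevel.
  exact.
rewrite -bintZ// -bintB//; last by apply: bmfM => //; exact: bmf_cst.
apply: le_trans (ler_norm_bint _ _) _.
  by apply: bmfB => //; apply: bmfM => //; exact: bmf_cst.
rewrite -[leRHS](bint_cst Q); apply: ler_bint.
- by apply: bmf_norm; apply: bmfB => //; apply: bmfM => //; exact: bmf_cst.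
- exact: bmf_cst.
- by move=> w; have /andP[k1 k2] := key (xi w); rewrite ger0_norm; lra.
Qed.

(** [tent eps] is supported on |y| <= 2 eps, so [level_mass_window] applies on each line with c = 2
    eps. *)
Lemma expectation_window f m g a eps : resamples Q xi m g -> dotv m g = 1 ->
  borelR f -> (forall y, 0 <= f y <= 1) -> 0 <= a <= 1 -> 0 < eps ->
  \int[Q]_w (f (xi w) * tent eps (gap_line a f m g (xi w))) <= 6 * eps.
Proof.
move=> rs mg bf f01 a01 eps0.
have mh : measurable_fun setT (tent eps : mR -> R).
  apply: (measurableT_comp measurable_clamp01).
  by apply: measurable_funB => //; apply: measurable_funM.
pose F x := f x * tent eps (gap_line a f m g x).
have bF : borelR F.
  by apply: borelRM => //; apply: borelR_comp => //; exact: borelR_gap_line.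
have F01 y : 0 <= F y <= 1.
  have /andP[f0 f1] := f01 y.
  have /andP[s0 s1] := clamp01_itv (2 - `|gap_line a f m g y| / eps).
  by rewrite mulr_ge0//= mulr_ile1.
rewrite -/(\int[Q]_w F (xi w)) (expectation_resample rs bF F01).
have btF : bmf (fun w => tot_line F m g (xi w)).
  apply: bmf_borelR => //; first exact: borelR_tot_line.
  by move=> y; exact: tot_line_itv.
rewrite -[leRHS](bint_cst Q); apply: ler_bint => //; first exact: bmf_cst.
move=> w; set x := xi w.
have eps2 : 0 < 2 * eps by rewrite mulr_gt0.
have := @level_mass_window R (along f m g x) (measurable_along m g x bf)
  (fun v => f01 (relevel m g x v)) a (2 * eps) (tent eps) a01 eps2 mh (fun t => tent_supp t eps0).
have <- : tot_line F m g x = \int[nu]_v (along f m g x v * tent eps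
    (cumul (along f m g x) v - a * \int[nu]_u along f m g x u)).
  by apply: eq_Rintegral => v _; rewrite /along /F gap_line_relevel.
by move=> h; apply: le_trans h _; lra.
Qed.

Lemma expectation_tail m g M : resamples Q xi m g -> dotv m g = 1 ->
  \int[Q]_w clamp01 (`|dotv m (xi w)| - M) <= \int[nu]_v ((M < `|v|)%R%:R : R).
Proof.
move=> rs mg; pose f x := clamp01 (`|dotv m x| - M).
have bf : borelR f.
  apply: (borelR_comp measurable_clamp01); apply: borelRB; last exact: borelR_cst.
  by apply: (borelR_comp measurable_normr); exact: borelR_dotv.
have f01 y : 0 <= f y <= 1 by exact: clamp01_itv.
rewrite -/(\int[Q]_w f (xi w)) (expectation_resample rs bf f01).
rewrite -[leRHS](bint_cst Q); apply: ler_bint.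
- apply: bmf_borelR => //; first exact: borelR_tot_line.
  by move=> y; exact: tot_line_itv.
- exact: bmf_cst.
move=> w; apply: ler_bint; first exact: bmf_along.
  by apply: bmf_bool; apply: measurable_fun_ltr => //; exact: measurable_normr.
move=> v; rewrite /along /f dotv_relevel//; case: (ltP M `|v|) => Mv.
  exact: clamp01_le1.
by rewrite clamp01_0// subr_le0.
Qed.

(** b'xi has standard deviation s, so after rescaling b to m the strip becomes an interval for an
    N(0,1) variable. *)
Lemma expectation_strip (S : 'M[R]_p) (b : 'cV[R]_p) (c del s : R) :
  centered_normal_vector Q xi S -> 0 < s -> dotv b (S *m b) = s ^+ 2 -> 0 < del ->
  \int[Q]_w tent del (c - dotv b (xi w)) <= 5 * del / s.
Proof.
move=> nxi s0 bS del0; pose m := s^-1 *: b; pose g := S *m m.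
have mg : dotv m g = 1.
  rewrite /g /m -scalemxAr dotvZl dotvZr bS expr2.
  by field; rewrite gt_eqF.
have rs : resamples Q xi m g by exact: resamples_normal.
have mt : measurable_fun setT (tent del : mR -> R).
  apply: (measurableT_comp measurable_clamp01).
  by apply: measurable_funB => //; apply: measurable_funM.
pose f x := tent del (c - dotv b x).
have bf : borelR f.
  by apply: (borelR_comp mt); apply: borelRB; [exact: borelR_cst|exact: borelR_dotv].
have f01 y : 0 <= f y <= 1 by exact: clamp01_itv.
rewrite -/(\int[Q]_w f (xi w)) (expectation_resample rs bf f01).
rewrite -[leRHS](bint_cst Q); apply: ler_bint.
- apply: bmf_borelR => //; first exact: borelR_tot_line.
  by move=> y; exact: tot_line_itv.
- exact: bmf_cst.
move=> w; set x := xi w.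
have bE : b = s *: m by rewrite /m scalerA mulfV ?gt_eqF// scale1r.
have fE v : along f m g x v = tent del (c - s * v).
  by rewrite /along /f {1}bE dotvZl dotv_relevel.
(* The tent lives on |c - s v| <= 2 del. Since [u] excludes its left end, that end is lowered to c -
   3 del, which makes the width 5 del. *)
pose u (v : mR) : R := (v <= (c + 2 * del) / s)%R%:R - (v <= (c - 3 * del) / s)%R%:R.
have ab : (c - 3 * del) / s <= (c + 2 * del) / s by rewrite ler_pM2r ?invr_gt0//; lra.
apply: (@le_trans _ _ (\int[nu]_v u v)); last first.
  apply: le_trans (normal_step ab) _; rewrite -mulrBl ler_pM2r ?invr_gt0//; lra.
apply: ler_bint.
- exact: bmf_along.
- by apply: bmfB; exact: bmf_leq_cst.
move=> v; rewrite fE /u.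
have := tent_supp (c - s * v) del0 => /andP[_]; move=> h; apply: le_trans h _.
case: (leP `|c - s * v| (2 * del)) => h /=; last first.
  rewrite subr_ge0 ler_nat; case: (leP v ((c - 3 * del) / s)) => // h1.
  by rewrite (le_trans h1 ab).
move: h; rewrite ler_norml (mulrC s) => /andP[h1 h2].
have -> : v <= (c + 2 * del) / s by rewrite ler_pdivlMr//; lra.
have -> : (v <= (c - 3 * del) / s) = false.
  by apply/negbTE; rewrite -ltNge ltr_pdivrMr//; lra.
by rewrite subr0.
Qed.

End gaussian_expectations.

Section selection_weight.
Context {R : realType} {p K : nat} {q : 'I_K -> nat}.
Variable A : forall k : 'I_K, 'M[R]_(q k, p).
Local Notation mR := (measurableTypeR R).
Implicit Types (s : R -> R) (c : forall k : 'I_K, 'cV[R]_(q k)) (x y : 'cV[R]_p).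

Definition slack c x k j : R := c k j 0 - (A k *m x) j 0.

(* With [s = ind0] this is the indicator of the union of the polyhedra. *)
Definition sel_weight s c x : R :=
  1 - \prod_k (1 - \prod_(j < q k) s (slack c x j)).

Definition boundary_sum s c x : R := \sum_k \sum_(j < q k) s (slack c x j).

Lemma borelR_slack c k (j : 'I_(q k)) : borelR (fun x => slack c x j).
Proof. by apply: borelRB; [exact: borelR_cst|exact: borelR_mulmx]. Qed.

Lemma borelR_sel_weight s c : measurable_fun setT (s : mR -> R) ->
  borelR (sel_weight s c).
Proof.
move=> ms; apply: borelRB; first exact: borelR_cst.
apply: borelR_prod => k; apply: borelRB; first exact: borelR_cst.
by apply: borelR_prod => j; apply: (borelR_comp ms); exact: borelR_slack.
Qed.

Lemma borelR_boundary_sum s c : measurable_fun setT (s : mR -> R) ->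
  borelR (boundary_sum s c).
Proof.
move=> ms; apply: borelR_sum => k; apply: borelR_sum => j.
by apply: (borelR_comp ms); exact: borelR_slack.
Qed.

Lemma compl01 (a : R) : 0 <= a <= 1 -> 0 <= 1 - a <= 1.
Proof. by move=> /andP[? ?]; apply/andP; split; lra. Qed.

Lemma sel_weight_itv s c x : (forall t, 0 <= s t <= 1) -> 0 <= sel_weight s c x <= 1.
Proof.
move=> s01; apply/compl01/prod01 => k; apply/compl01/prod01 => j; exact: s01.
Qed.

Lemma sel_weight_diff s s' c c' x x' :
  (forall t, 0 <= s t <= 1) -> (forall t, 0 <= s' t <= 1) ->
  `|sel_weight s c x - sel_weight s' c' x'| <=
  \sum_k \sum_(j < q k) `|s (slack c x j) - s' (slack c' x' j)|.
Proof.
have complB (a b : R) : 1 - a - (1 - b) = b - a by ring.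
move=> s01 s'01; rewrite /sel_weight complB distrC.
apply: le_trans (prod01_diff _ _ _) _.
- by move=> k; apply/compl01/prod01 => j; exact: s01.
- by move=> k; apply/compl01/prod01 => j; exact: s'01.
apply: ler_sum => k _; rewrite complB distrC.
exact: prod01_diff.
Qed.

Lemma sel_weight_ind0 c x :
  sel_weight (@ind0 R) c x = (`[< poly_union A c x >])%:R.
Proof.
rewrite /sel_weight.
have prodE k : \prod_(j < q k) ind0 (slack c x j) = (`[< polyhedron (A k) (c k) x >])%:R.
  case: asboolP => [h|/existsNP[j /negP]].
    by apply: big1 => j _; rewrite /ind0 /slack subr_ge0 h.
  move=> hj; rewrite (bigD1 j)//= /ind0 /slack subr_ge0 (negbTE hj) mul0r //.
case: asboolP => [[k hk]|hn].
  by rewrite (bigD1 k)//= prodE; case: asboolP => // _; rewrite subrr mul0r subr0.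
rewrite big1 ?subrr// => k _; rewrite prodE; case: asboolP => [hk|]; last by rewrite subr0.
by case: hn; exists k.
Qed.

(** Lipschitz constant of a sum over all constraints, hence one copy of [l1 (A k)] per row. *)
Definition A_size : R := \sum_k \sum_(j < q k) l1 (A k).

Lemma Lip_slack c k (j : 'I_(q k)) : Lip (l1 (A k)) (fun x => slack c x j).
Proof.
move=> x y; have -> : slack c x j - slack c y j = - (A k *m (x - y)) j 0.
  by rewrite /slack mulmxBr !mxE; ring.
by rewrite normrN; exact: l1_mulmx.
Qed.

Lemma A_size_ge0 : 0 <= A_size.
Proof. by apply: sumr_ge0 => k _; apply: sumr_ge0 => j _; exact: l1_ge0. Qed.

Lemma l1_le_A_size k (j : 'I_(q k)) : l1 (A k) <= A_size.
Proof.
rewrite /A_size (bigD1 k)//= (bigD1 j)//= -addrA lerDl addr_ge0//.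
  by apply: sumr_ge0 => i _; exact: l1_ge0.
by apply: sumr_ge0 => i _; apply: sumr_ge0 => ? _; exact: l1_ge0.
Qed.

Lemma Lip_sel_weight s c C : (forall t, 0 <= s t <= 1) -> 0 <= C ->
  (forall t u, `|s t - s u| <= C * `|t - u|) ->
  Lip (C * A_size) (sel_weight s c).
Proof.
move=> s01 C0 sC x y; apply: le_trans (sel_weight_diff _ _ _ _ s01 s01) _.
rewrite /A_size [C * _]mulr_sumr [leRHS]mulr_suml; apply: ler_sum => k _.
rewrite [C * _]mulr_sumr [leRHS]mulr_suml; apply: ler_sum => j _.
apply: le_trans (sC _ _) _; rewrite -mulrA ler_wpM2l//.
exact: Lip_slack.
Qed.

Lemma sel_weight_compare del c c' x x' : 0 < del ->
  (forall k (j : 'I_(q k)), `|slack c' x' j - slack c x j| <= del) ->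
  `|sel_weight (@ind0 R) c' x' - sel_weight (ramp del) c x| <=
  boundary_sum (tent del) c x.
Proof.
move=> del0 h; apply: le_trans (sel_weight_diff _ _ _ _ _ _) _.
- exact: ind0_itv.
- by move=> t; exact: clamp01_itv.
by apply: ler_sum => k _; apply: ler_sum => j _; exact: ind0_ramp.
Qed.

End selection_weight.

(** * Comparison of sample and population quantities *)

Section comparison.
Context {R : realType} {p K : nat} {q : 'I_K -> nat}.
Variable A : forall k : 'I_K, 'M[R]_(q k, p).
Local Notation nu := (@normal_prob R 0 1).
Local Notation mR := (measurableTypeR R).

Definition tail (M : R) : R := \int[nu]_v ((M < `|v|)%R%:R : R).

Lemma bmf_tail M : bmf (fun v : mR => (M < `|v|)%R%:R : R).
Proof.
by apply: bmf_bool; apply: measurable_fun_ltr => //; exact: measurable_normr.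
Qed.

Lemma tail_ge0 M : 0 <= tail M.
Proof. by apply: bint_ge0 => v. Qed.

Lemma measurable_ind0 : measurable_fun setT (@ind0 R : mR -> R).
Proof. by apply: measurable_nat_of_bool; exact: measurable_fun_ler. Qed.

Lemma measurable_ramp d : measurable_fun setT (@ramp R d : mR -> R).
Proof. by apply: (measurableT_comp measurable_clamp01); exact: measurable_funM. Qed.

Lemma measurable_tent d : measurable_fun setT (@tent R d : mR -> R).
Proof.
apply: (measurableT_comp measurable_clamp01).
by apply: measurable_funB => //; apply: measurable_funM.
Qed.

Variables (M del rho : R) (m g m' g' x : 'cV[R]_p).
Variables (c c' : forall k : 'I_K, 'cV[R]_(q k)).
Hypothesis del0 : 0 < del.
Hypothesis c_close : forall k (j : 'I_(q k)), `|c' k j 0 - c k j 0| <= del / 2.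
Hypothesis line_close : forall v, `|v| <= M -> forall k (j : 'I_(q k)),
  `|(A k *m (relevel m' g' x v - relevel m g x v)) j 0| <= del / 2.
Hypothesis level_close : `|dotv m' x - dotv m x| <= rho.

Let w' := sel_weight A (@ind0 R) c'.
Let w := sel_weight A (ramp del) c.
Let B := boundary_sum A (tent del) c.

Let bw' : borelR w'.
Proof. apply: borelR_sel_weight; exact: measurable_ind0. Qed.
Let bw : borelR w.
Proof. apply: borelR_sel_weight; exact: measurable_ramp. Qed.
Let bB : borelR B.
Proof. apply: borelR_boundary_sum; exact: measurable_tent. Qed.
Let w'01 y : 0 <= w' y <= 1.
Proof. apply: sel_weight_itv; exact: ind0_itv. Qed.
Let w01 y : 0 <= w y <= 1.
Proof. by apply: sel_weight_itv => t; exact: clamp01_itv. Qed.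

Lemma boundary_sum_ge0 y : 0 <= B y.
Proof.
by apply: sumr_ge0 => k _; apply: sumr_ge0 => j _; exact: clamp01_ge0.
Qed.

Lemma bmf_along_boundary : bmf (along B m g x).
Proof.
apply: bmf_sum => k; apply: bmf_sum => j; apply: bmf01; last first.
  by move=> v; exact: clamp01_itv.
apply: (measurable_along m g x (f := fun y => tent del (slack A c y j))).
by apply: (borelR_comp (measurable_tent del)); exact: borelR_slack.
Qed.

Let sum_closeE (a b u t : R) : `|a - b| <= del / 2 -> `|u| <= del / 2 ->
  u = t -> `|a - b - t| <= del.
Proof.
move=> h1 h2 <-; apply: le_trans (ler_normB _ _) _.
by apply: le_trans (lerD h1 h2) _; lra.
Qed.

(** Primed objects come from the sample, unprimed ones from the population. For |v| <= M every slack
    moves by at most del, half from the cut-off and half from the line; for larger v the trivial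
    bound 1 is charged to the tail. *)
Lemma along_compare v :
  `|along w' m' g' x v - along w m g x v| <= (M < `|v|)%R%:R + along B m g x v.
Proof.
case: (ltP M `|v|) => Mv /=.
  apply: (@le_trans _ _ 1); last by rewrite lerDl; exact: boundary_sum_ge0.
  have /andP[h1 h2] := w'01 (relevel m' g' x v).
  have /andP[h3 h4] := w01 (relevel m g x v).
  by rewrite /along ler_norml; apply/andP; split; lra.
rewrite add0r; apply: sel_weight_compare => // k j.
have := sum_closeE (c_close j) (line_close Mv j) erefl.
by rewrite /slack mulmxBr !mxE; congr (`| _ | <= _); ring.
Qed.

Let bw'l : bmf (along w' m' g' x). Proof. exact: bmf_along. Qed.
Let bwl : bmf (along w m g x). Proof. exact: bmf_along. Qed.
Let bTB : bmf (fun v : mR => (M < `|v|)%R%:R + along B m g x v).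
Proof. by apply: bmfD; [exact: bmf_tail|exact: bmf_along_boundary]. Qed.

Let err_tot := tail M + tot_line B m g x.

Lemma tot_line_compare : `|tot_line w' m' g' x - tot_line w m g x| <= err_tot.
Proof.
rewrite /tot_line -bintB//; apply: le_trans (ler_norm_bint _ _) _.
  exact: bmfB.
rewrite /err_tot /tail /tot_line -bintD; last 2 first.
- exact: bmf_tail.
- exact: bmf_along_boundary.
apply: ler_bint => //; first by apply: bmf_norm; exact: bmfB.
by move=> v; exact: along_compare.
Qed.

Lemma cum_line_compare :
  `|cum_line w' m' g' x - cum_line w m g x| <= rho + err_tot.
Proof.
have bi a : bmf (fun v : mR => (v <= a)%R%:R : R) by exact: bmf_leq_cst.
rewrite /cum_line /cumul -bintB; [|exact: bmfM..].
apply: le_trans (ler_norm_bint _ _) _; first by apply: bmfB; exact: bmfM.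
apply: (@le_trans _ _ (\int[nu]_v
    (`|((v <= dotv m' x)%R%:R : R) - (v <= dotv m x)%R%:R| +
     ((M < `|v|)%R%:R + along B m g x v)))).
  apply: ler_bint.
  - by apply: bmf_norm; apply: bmfB; exact: bmfM.
  - by apply: bmfD => //; apply: bmf_norm; exact: bmfB.
  move=> v; set a := (v <= dotv m' x)%R%:R; set b := (v <= dotv m x)%R%:R.
  have -> : a * along w' m' g' x v - b * along w m g x v =
    (a - b) * along w' m' g' x v + b * (along w' m' g' x v - along w m g x v) by ring.
  apply: le_trans (ler_normD _ _) _; rewrite !normrM; apply: lerD.
    rewrite ler_piMr//; have /andP[h0 h1] := w'01 (relevel m' g' x v).
    by rewrite ger0_norm.
  apply: le_trans (along_compare v); rewrite ler_piMl//.
  by rewrite ger0_norm /b ?lern1 ?leq_b1.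
rewrite bintD//; last by apply: bmf_norm; exact: bmfB.
rewrite bintD; last 2 first.
- exact: bmf_tail.
- exact: bmf_along_boundary.
rewrite lerD2r; apply: le_trans (normal_step_norm _ _) _ => //.
Qed.

Lemma gap_line_compare a : 0 <= a <= 1 ->
  `|gap_line a w' m' g' x - gap_line a w m g x| <= rho + 2 * err_tot.
Proof.
move=> /andP[a0 a1]; rewrite /gap_line.
have -> (u v s t : R) : u - a * v - (s - a * t) = (u - s) - a * (v - t) by ring.
apply: le_trans (ler_normB _ _) _.
have h1 := cum_line_compare; have h2 := tot_line_compare.
have h3 : `|a * (tot_line w' m' g' x - tot_line w m g x)| <= err_tot.
  by apply: le_trans h2; rewrite normrM (ger0_norm a0) ler_piMl.
by apply: le_trans (lerD h1 h3) _; lra.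
Qed.

End comparison.

(** * Perturbation of the covariance matrix *)

Section scaling.
Context {R : realType} {p : nat}.
Implicit Types (S : 'M[R]_p) (l x : 'cV[R]_p).

Lemma l1_mulmx_col n (M : 'M[R]_(n, p)) x : l1 (M *m x) <= l1 M * l1 x.
Proof.
rewrite /l1 mulr_suml; apply: ler_sum => i _; rewrite big_ord1 mxE.
apply: le_trans (ler_norm_sum _ _ _) _; rewrite mulr_suml; apply: ler_sum => j _.
rewrite normrM ler_wpM2l// (bigD1 j)//= big_ord1 lerDl.
by apply: sumr_ge0 => k _; apply: sumr_ge0.
Qed.

Lemma l1_le_entries m n (M : 'M[R]_(m, n)) (C : R) :
  (forall i j, `|M i j| <= C) -> l1 M <= m%:R * (n%:R * C).
Proof.
move=> h; apply: (@le_trans _ _ (\sum_(i < m) (\sum_(j < n) C))).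
  by apply: ler_sum => i _; apply: ler_sum => j _; exact: h.
by rewrite !sumr_const !card_ord !mulr_natl.
Qed.

(** Polarization: 4 S_ij is the difference of the quadratic form at the sum and at the difference of
    two coordinate vectors. *)
Lemma entry_bound S (lam : R) i j : S^T = S ->
  (forall v, 0 <= quad S v <= lam * dotv v v) -> 0 <= lam -> `|S i j| <= lam.
Proof.
move=> symS hS lam0; pose u : 'cV[R]_p := delta_mx i 0; pose v : 'cV[R]_p := delta_mx j 0.
have Sij : S i j = dotv u (S *m v).
  rewrite dotv_delta mxE (bigD1 j)//= big1 ?addr0 ?mxE ?eqxx ?mulr1//.
  by move=> k /negbTE kj; rewrite mxE kj mulr0.
have uSv : dotv v (S *m u) = dotv u (S *m v) by rewrite dotv_trmx symS dotvC.
have E4 : quad S (u + v) - quad S (u - v) = 4 * S i j.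
  rewrite Sij /quad !mulmxDr mulmxN !(dotvDl, dotvDr, dotvNl, dotvNr) uSv; ring.
have uu : dotv u u = 1 by rewrite dotv_delta mxE !eqxx.
have vv : dotv v v = 1 by rewrite dotv_delta mxE !eqxx.
have /andP[uv0 uv1] : 0 <= dotv u v <= 1.
  by rewrite dotv_delta mxE eqxx andbT ler0n lern1 leq_b1.
have /andP[a0 a1] := hS (u + v); have /andP[b0 b1] := hS (u - v).
have da : dotv (u + v) (u + v) = 2 + 2 * dotv u v.
  by rewrite !(dotvDl, dotvDr) (dotvC v u) uu vv; ring.
have db : dotv (u - v) (u - v) = 2 - 2 * dotv u v.
  by rewrite !(dotvDl, dotvDr, dotvNl, dotvNr) (dotvC v u) uu vv; ring.
have la : lam * dotv (u + v) (u + v) <= lam * 4 by rewrite ler_wpM2l// da; lra.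
have lb : lam * dotv (u - v) (u - v) <= lam * 4 by rewrite ler_wpM2l// db; lra.
rewrite ler_norml; apply/andP; split; lra.
Qed.

Definition inv_sd S l : R := (Num.sqrt (quad S l))^-1.
Definition level_vec S l : 'cV[R]_p := inv_sd S l *: l.
Definition line_vec S l : 'cV[R]_p := inv_sd S l *: (S *m l).

Lemma level_line S l : 0 < quad S l -> dotv (level_vec S l) (line_vec S l) = 1.
Proof.
move=> s0; rewrite /level_vec /line_vec dotvZl dotvZr -/(quad S l) mulrA -expr2 exprVn.
by rewrite sqr_sqrtr ?(ltW s0)// mulVf// gt_eqF.
Qed.

Lemma line_vecE S l : line_vec S l = S *m level_vec S l.
Proof. by rewrite /line_vec /level_vec -scalemxAr. Qed.

Lemma quadB S (S' : 'M[R]_p) l : quad (S' - S) l = quad S' l - quad S l.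
Proof. by rewrite /quad mulmxBl dotvBr. Qed.

Lemma quad_le_l1 S l : `|quad S l| <= l1 S * (l1 l) ^+ 2.
Proof.
rewrite /quad; apply: le_trans (l1_dotv _ _) _.
rewrite expr2 mulrA (mulrC (l1 S)) -mulrA ler_wpM2l ?l1_ge0//.
exact: l1_mulmx_col.
Qed.

(** Uniform continuity of the normalization over the spectral band. [lo] bounds l'Sl below, [W]
    keeps l'S'l above lo / 2, and C and D are Lipschitz constants in S' of the inverse standard
    deviation and of the line direction. *)
Lemma scale_perturbation l (lam kap : R) : l != 0 -> 0 < lam -> 0 < kap ->
  exists2 eta : R, 0 < eta & forall S (S' : 'M[R]_p), S^T = S ->
    (forall v, dotv v v / lam <= quad S v <= lam * dotv v v) ->
    frob_norm (S' - S) <= eta ->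
    [/\ 0 < quad S' l, `|inv_sd S' l - inv_sd S l| <= kap &
        l1 (line_vec S' l - line_vec S l) <= kap].
Proof.
move=> l0 lam0 kap0.
have ll0 : 0 < dotv l l by rewrite lt_neqAle dotv_ge0 eq_sym dotv_eq0 l0.
pose lo := dotv l l / lam; have lo0 : 0 < lo by rewrite divr_gt0.
pose P : R := p%:R * (p%:R * 1).
have P0 : 0 <= P by rewrite mulr_ge0// mulr_ge0.
pose b := l1 l; have b0 : 0 <= b by exact: l1_ge0.
pose r := Num.sqrt (lo / 2).
have r0 : 0 < r by rewrite sqrtr_gt0 divr_gt0.
pose C := P * b ^+ 2 / r ^+ 3; have C0 : 0 <= C.
  by rewrite divr_ge0 ?mulr_ge0 ?sqr_ge0 ?exprn_ge0 ?(ltW r0).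
pose D := C * (P * (lam + 1) * b) + r^-1 * (P * b).
have D0 : 0 <= D.
  have lam10 : 0 <= lam + 1 by rewrite addr_ge0// ltW.
  have Pb0 : 0 <= P * b by exact: mulr_ge0.
  have r10 : 0 <= r^-1 by rewrite invr_ge0 ltW.
  apply: addr_ge0; last exact: mulr_ge0.
  by apply: mulr_ge0 => //; apply: mulr_ge0 => //; exact: mulr_ge0.
pose W := P * b ^+ 2 + 1; have W0 : 0 < W.
  by apply: ltr_wpDl => //; apply: mulr_ge0 => //; exact: sqr_ge0.
pose eta := Num.min 1 (Num.min (lo / 2 / W) (kap / (C + D + 1))).
have CD0 : 0 < C + D + 1 by apply: ltr_wpDl => //; exact: addr_ge0.
have eta0 : 0 < eta.
  rewrite !lt_min ltr01/=; apply/andP; split; last exact: divr_gt0.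
  by apply: divr_gt0 => //; exact: divr_gt0.
have eta1 : eta <= 1 by rewrite /eta ge_min lexx.
have etaW : eta * W <= lo / 2.
  by rewrite -ler_pdivlMr// /eta !ge_min lexx !orbT.
have etaCD : eta * (C + D + 1) <= kap.
  by rewrite -ler_pdivlMr// /eta !ge_min lexx !orbT.
exists eta => // S S' symS hS SS'.
have entries i j : `|(S' - S) i j| <= eta.
  by apply: le_trans SS'; exact: frob_norm_entry.
have dS : l1 (S' - S) <= eta * P.
  by apply: le_trans (l1_le_entries entries) _; rewrite /P; lra.
have hS' v : 0 <= quad S v <= lam * dotv v v.
  have /andP[h1 h2] := hS v; rewrite h2 andbT; apply: le_trans h1.
  by rewrite divr_ge0 ?dotv_ge0// ltW.
have l1S : l1 S <= P * lam.
  apply: le_trans (l1_le_entries (fun i j => entry_bound i j symS hS' (ltW lam0))) _.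
  by rewrite /P; lra.
have dq : `|quad S' l - quad S l| <= eta * (P * b ^+ 2).
  rewrite -quadB; apply: le_trans (quad_le_l1 _ _) _.
  have -> : eta * (P * b ^+ 2) = eta * P * b ^+ 2 by ring.
  by apply: ler_wpM2r => //; exact: sqr_ge0.
have qS : lo <= quad S l by have /andP[] := hS l.
have etaWE : eta * W = eta * (P * b ^+ 2) + eta by rewrite /W; ring.
have qS' : lo / 2 <= quad S' l.
  by move: dq; rewrite ler_norml => /andP[h1 h2]; lra.
have qS'0 : 0 < quad S' l by apply: lt_le_trans qS'; rewrite divr_gt0.
set s := Num.sqrt (quad S l); set s' := Num.sqrt (quad S' l).
have rs : r <= s by rewrite ler_wsqrtr//; apply: le_trans qS; lra.
have rs' : r <= s' by rewrite ler_wsqrtr.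
have s0 : 0 < s by apply: lt_le_trans rs.
have s'0 : 0 < s' by apply: lt_le_trans rs'.
have s2 : s ^+ 2 = quad S l by rewrite sqr_sqrtr//; apply: le_trans qS; rewrite ltW.
have s'2 : s' ^+ 2 = quad S' l by rewrite sqr_sqrtr// ltW.
have dinv : `|inv_sd S' l - inv_sd S l| <= C * eta.
  rewrite /inv_sd -/s -/s'.
  (* Rationalizing reduces the difference of inverse roots to that of the variances, over a
     denominator of at least r^3. *)
  have -> : s'^-1 - s^-1 = - (quad S' l - quad S l) / (s * s' * (s + s')).
    rewrite -s2 -s'2; field.
    by rewrite !gt_eqF//= addr_gt0.
  have den : r ^+ 3 <= s * s' * (s + s').
    have -> : r ^+ 3 = r * r * r by ring.
    rewrite ler_pM ?mulr_ge0 ?(ltW r0)//; first by rewrite ler_pM ?(ltW r0).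
    by apply: le_trans rs _; rewrite lerDl ltW.
  have den0 : 0 < s * s' * (s + s') by rewrite !mulr_gt0// addr_gt0.
  rewrite normrM normrN normfV (gtr0_norm den0) ler_pdivrMr//.
  apply: le_trans dq _; rewrite /C.
  have r30 : 0 < r ^+ 3 by rewrite exprn_gt0.
  have -> : eta * (P * b ^+ 2) = P * b ^+ 2 / r ^+ 3 * eta * r ^+ 3.
    by field; rewrite gt_eqF.
  by rewrite ler_wpM2l// mulr_ge0 ?(ltW eta0).
have eC : C * eta <= kap.
  by apply: le_trans etaCD; rewrite mulrC ler_wpM2l ?(ltW eta0)//; lra.
have eD : D * eta <= kap.
  by apply: le_trans etaCD; rewrite mulrC ler_wpM2l ?(ltW eta0)//; lra.
split => //; first exact: le_trans eC.
apply: le_trans eD; rewrite /line_vec.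
have -> : inv_sd S' l *: (S' *m l) - inv_sd S l *: (S *m l) =
  (inv_sd S' l - inv_sd S l) *: (S' *m l) + inv_sd S l *: ((S' - S) *m l).
  by rewrite mulmxBl scalerBl scalerBr addrA subrK.
apply: le_trans (l1D _ _) _; rewrite !l1Z.
have l1S' : l1 S' <= P * (lam + 1).
  have -> : S' = S + (S' - S) by rewrite addrC subrK.
  apply: le_trans (l1D _ _) _.
  have : eta * P <= 1 * P by rewrite ler_wpM2r.
  lra.
have -> : D * eta = (C * eta) * (P * (lam + 1) * b) + r^-1 * (eta * P * b).
  by rewrite /D; ring.
apply: lerD.
  apply: ler_pM => //; first exact: l1_ge0.
  by apply: le_trans (l1_mulmx_col _ _) _; rewrite ler_wpM2r.
apply: ler_pM => //; first exact: l1_ge0.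
  rewrite ger0_norm ?invr_ge0 ?(ltW s0)//.
  by rewrite lef_pV2 ?posrE.
by apply: le_trans (l1_mulmx_col _ _) _; rewrite ler_wpM2r.
Qed.

End scaling.

Section decision.
Context {R : realType}.

Lemma soft_step_far (e eta y y' : R) : 0 < e -> eta <= e -> `|y' - y| <= eta ->
  2 * e < `|y| -> (0 <= y')%R%:R = soft_step (2 * e) y.
Proof.
move=> e0 etae; rewrite ler_norml => /andP[h1 h2].
have ee : 0 < 2 * e by rewrite mulr_gt0.
have /andP[s1 s2] := soft_stepP y ee.
have /andP[t1 t2] : 0 <= soft_step (2 * e) y <= 1 by exact: clamp01_itv.
rewrite ltr_normr => /orP[hy|hy].
  have y0 : 0 <= y by lra.
  have -> : 0 <= y' by lra.
  by apply/eqP; rewrite eq_le t2 andbT; rewrite y0 in s1.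
have -> : (0 <= y') = false by apply/negbTE; rewrite -ltNge; lra.
apply/eqP; rewrite eq_le t1 /=; apply: le_trans s2 _.
by have -> : (- (2 * e) <= y) = false by apply/negbTE; rewrite -ltNge; lra.
Qed.

(* G' is computed from the sample and G from the population. The tents at 0 and 1
   pay for the realizations where G' 0 or G' 1 has the wrong sign, in which the
   estimator may be arbitrary. *)
Lemma decision_compare (alpha e w B eta : R) (S E : bool) (G G' : R -> R) :
  0 < alpha < 1 -> 0 < e -> 0 <= w <= 1 -> 0 <= B -> 0 <= eta ->
  `|S%:R - w| <= B ->
  (forall a, 0 <= a <= 1 -> `|G' a - G a| <= eta) ->
  (S -> 0 < G' 0 -> G' 1 < 0 -> E = (0 <= G' (1 - alpha))) ->
  0 <= G 0 -> G 1 <= 0 ->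
  `|S%:R * E%:R - alpha * S%:R -
    (w * soft_step (2 * e) (G (1 - alpha)) - alpha * w)| <=
  2 * B + w * (tent (2 * e) (G 0) + tent (2 * e) (G (1 - alpha)) + tent (2 * e) (G 1))
    + eta / e.
Proof.
move=> /andP[al0 al1] e0 /andP[w0 w1] B0 eta0 SB GG SE G0 G1.
set h := soft_step _ _; have /andP[h0 h1] : 0 <= h <= 1 by exact: clamp01_itv.
set t0 := tent _ (G 0); have /andP[t00 t01] : 0 <= t0 <= 1 by exact: clamp01_itv.
set t1 := tent _ (G 1); have /andP[t10 t11] : 0 <= t1 <= 1 by exact: clamp01_itv.
set ta := tent _ (G (1 - alpha)).
have /andP[ta0 ta1] : 0 <= ta <= 1 by exact: clamp01_itv.
have ee : 0 < 2 * e by rewrite mulr_gt0.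
have etae : 0 <= eta / e by rewrite divr_ge0// ltW.
(* The first term is the error in the selection, at most B; the second is the error in the decision,
   which matters only with weight w. *)
have split_lhs : S%:R * E%:R - alpha * S%:R - (w * h - alpha * w) =
  (S%:R - w) * (E%:R - alpha) + w * (E%:R - h) by ring.
have Ea : `|E%:R - alpha| <= 1 by rewrite ler_norml; case: E {SE split_lhs} => /=; lra.
have Eh : `|E%:R - h| <= 1 by rewrite ler_norml; case: E {SE split_lhs Ea} => /=; lra.
have lhsB : `|(S%:R - w) * (E%:R - alpha)| <= B.
  by apply: le_trans SB; rewrite normrM ler_piMr.
have lhsw : `|w * (E%:R - h)| <= w by rewrite normrM (ger0_norm w0) ler_piMr.
rewrite split_lhs; apply: le_trans (ler_normD _ _) _.
have wt : 0 <= w * (t0 + ta + t1) by rewrite mulr_ge0 ?addr_ge0.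
have crude : w <= B + w * (t0 + ta + t1) + eta / e ->
    `|(S%:R - w) * (E%:R - alpha)| + `|w * (E%:R - h)| <=
    2 * B + w * (t0 + ta + t1) + eta / e.
  move=> hw; apply: le_trans (lerD lhsB lhsw) _; clear - hw; lra.
(* When the perturbation exceeds e, the term eta / e is at least 1 and covers w. *)
have [etabig|etasmall] := ltP e eta.
  have : 1 <= eta / e by rewrite ler_pdivlMr// mul1r ltW.
  by move=> h2; apply: crude; clear - h2 wt w1 B0; lra.
have near a : `|G a| <= 2 * e -> tent (2 * e) (G a) = 1 by exact: tent1.
have tent_full : 1 <= t0 + ta + t1 -> w <= B + w * (t0 + ta + t1) + eta / e.
  move=> h2; have h3 : w * 1 <= w * (t0 + ta + t1) by rewrite ler_wpM2l.
  by clear - h3 B0 etae; lra.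
have [G0s|G0b] := leP `|G 0| (2 * e).
  by apply/crude/tent_full; rewrite /t0 (near _ G0s); clear - ta0 t10; lra.
have [G1s|G1b] := leP `|G 1| (2 * e).
  by apply/crude/tent_full; rewrite /t1 (near _ G1s); clear - ta0 t00; lra.
have [Gas|Gab] := leP `|G (1 - alpha)| (2 * e).
  by apply/crude/tent_full; rewrite /ta (near _ Gas); clear - t00 t10; lra.
(* Outside the three windows the perturbation eta <= e cannot change the sign of any of the three
   gaps, and the soft step is already 0 or 1. *)
suff : S -> E%:R = h.
  case: S SB lhsB {SE split_lhs crude} => SB lhsB; last first.
    have wB : w <= B by move: SB; rewrite sub0r normrN (ger0_norm w0).
    move=> _; apply: le_trans (lerD lhsB lhsw) _.
    by clear - wB wt etae w0 B0; lra.
  move=> /(_ isT) Ehh; rewrite Ehh subrr mulr0 normr0 -Ehh addr0.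
  by apply: le_trans lhsB _; clear - wt etae B0; lra.
have i0 : 0 <= (0 : R) <= 1 by rewrite lexx ler01.
have i1 : 0 <= (1 : R) <= 1 by rewrite lexx ler01.
have ia : 0 <= 1 - alpha <= 1 by clear - al0 al1; apply/andP; split; lra.
move=> hS; rewrite SE//.
- exact: (soft_step_far e0 etasmall (GG _ ia) Gab).
- have := GG _ i0; rewrite ler_norml => /andP[G0le _].
  by rewrite (ger0_norm G0) in G0b; clear - G0b G0le etasmall e0; lra.
- have := GG _ i1; rewrite ler_norml => /andP[_ G1le].
  by rewrite (ler0_norm G1) in G1b; clear - G1b G1le etasmall e0; lra.
Qed.

End decision.

(** * The estimator in local coordinates *)

Section truncation_link.
Context {R : realType} {p : nat}.
Local Notation nu := (@normal_prob R 0 1).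
Local Notation mR := (measurableTypeR R).

(** Each row of the constraint at r + z g is affine in z. A negative slope gives a term of [Zminus],
    a positive one a term of [Zplus], and a zero slope a condition free of z, collected in
    [Zzero]. *)
Lemma trunc_pieceE q (A : 'M[R]_(q, p)) (c : 'cV[R]_q) (g r : 'cV[R]_p) z :
  trunc_piece A c g r z <-> polyhedron A c (r + z *: g).
Proof.
have rowE j : (A *m (r + z *: g)) j 0 = (A *m r) j 0 + z * (A *m g) j 0.
  by rewrite mulmxDr -scalemxAr !mxE.
split.
  rewrite /trunc_piece; case: ifPn => // /bigmin_geP[_ h0] /= [/bigmax_leP[_ hm]].
  move=> /bigmin_geP[_ hp] j; rewrite rowE.
  have [Ag|Ag|Ag] := ltgtP ((A *m g) j 0) 0.
  - have := hm j Ag; rewrite lee_fin ler_ndivrMr//; lra.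
  - have := hp j Ag; rewrite lee_fin ler_pdivlMr//; lra.
  - have := h0 j; rewrite Ag eqxx => /(_ isT); rewrite lee_fin mulr0; lra.
move=> h; rewrite /trunc_piece.
have -> : (0 <= Zzero A c g r)%E.
  apply/bigmin_geP; split; first exact: leey.
  by move=> j /eqP Ag; have := h j; rewrite rowE Ag lee_fin; lra.
split.
  apply/bigmax_leP; split; first exact: leNye.
  by move=> j Ag; have := h j; rewrite rowE lee_fin ler_ndivrMr//; lra.
apply/bigmin_geP; split; first exact: leey.
by move=> j Ag; have := h j; rewrite rowE lee_fin ler_pdivlMr//; lra.
Qed.

Context {K : nat} {q : 'I_K -> nat}.
Variable A : forall k : 'I_K, 'M[R]_(q k, p).
Variables (c : forall k : 'I_K, 'cV[R]_(q k)) (b beta l : 'cV[R]_p) (S : 'M[R]_p).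
Variables (n : nat) (alpha mstar : R).
Hypotheses (n_gt0 : (1 <= n)%N) (alpha01 : 0 < alpha < 1).
Hypothesis s2_gt0 : 0 < quad (n%:R *: S) l.
Hypothesis mstarP : mu_star_spec alpha A c b S l mstar.

(* Centring at beta leaves [local_cut] unbounded, as beta(P) is arbitrary; no
   later bound depends on its size. *)
Definition local_est : 'cV[R]_p := Num.sqrt n%:R *: (b - beta).
Definition local_cut k : 'cV[R]_(q k) :=
  Num.sqrt n%:R *: c k - A k *m (Num.sqrt n%:R *: beta).

Let sn := Num.sqrt (n%:R : R).
Let sn0 : 0 < sn. Proof. by rewrite sqrtr_gt0 ltr0n. Qed.
Let sn2 : sn ^+ 2 = n%:R. Proof. by rewrite sqr_sqrtr// ler0n. Qed.

Lemma poly_union_local y :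
  poly_union A local_cut (sn *: (y - beta)) <-> poly_union A c y.
Proof.
have E1 k (j : 'I_(q k)) : (A k *m (sn *: (y - beta))) j 0 =
    sn * (A k *m y) j 0 - sn * (A k *m beta) j 0.
  by rewrite -scalemxAr mulmxBr scalerBr !mxE.
have E2 k (j : 'I_(q k)) : local_cut k j 0 = sn * c k j 0 - sn * (A k *m beta) j 0.
  by rewrite /local_cut -scalemxAr !mxE.
by split=> -[k hk]; exists k => j; have := hk j; rewrite E1 E2 lerD2r ler_pM2l.
Qed.

Let w' := sel_weight A (@ind0 R) local_cut.
Let m' := level_vec (n%:R *: S) l.
Let g' := line_vec (n%:R *: S) l.

Let quadnE : quad (n%:R *: S) l = n%:R * quad S l.
Proof. by rewrite /quad -scalemxAl dotvZr. Qed.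

Let q0 : 0 < quad S l.
Proof.
by have := s2_gt0; rewrite quadnE pmulr_rgt0// ltr0n.
Qed.

Let s := Num.sqrt (sigma2_post S l).
Let s0 : 0 < s. Proof. by rewrite sqrtr_gt0. Qed.
Let s2 : s ^+ 2 = quad S l. Proof. by rewrite sqr_sqrtr// ltW. Qed.

Let inv_sdE : inv_sd (n%:R *: S) l = (sn * s)^-1.
Proof. by rewrite /inv_sd quadnE sqrtrM// ler0n. Qed.

Lemma level_local : dotv m' local_est = (dotv l b - dotv l beta) / s.
Proof.
rewrite /m' /level_vec /local_est inv_sdE dotvZl dotvZr dotvBr -/sn.
by field; rewrite !gt_eqF.
Qed.

(** The redrawing line through [local_est] is the rescaled line z -> r + z gamma, with z = l'beta +
    s v. The residual is the same all along it, so the weight along the line is the indicator of the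
    truncation set. *)
Lemma relevel_local v : relevel m' g' local_est v = sn *:
  (resid_post b S l + (dotv l beta + s * v) *: gamma_post S l - beta).
Proof.
rewrite /relevel level_local /g' /line_vec inv_sdE /local_est -/sn.
rewrite /resid_post /gamma_post -[sigma2_post S l]/(quad S l) -s2 -scalemxAl.
apply/matrixP => i j; rewrite !mxE -sn2.
by field; rewrite !gt_eqF.
Qed.

Lemma along_local v : along w' m' g' local_est v =
  \1_(trunc_set A c b S l) (dotv l beta + s * v).
Proof.
rewrite /along /w' sel_weight_ind0 relevel_local indicE.
congr (nat_of_bool _)%:R; apply/asboolP/idP => [/poly_union_local[k hk]|].
  by rewrite inE; exists k; apply/trunc_pieceE.
by rewrite inE => -[k /trunc_pieceE hk]; apply/poly_union_local; exists k.
Qed.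

Lemma measurable_trunc_set : measurable (trunc_set A c b S l : set mR).
Proof.
apply/(@measurable_indicP _ _ R).
pose f x := sel_weight A (@ind0 R) c x.
have bf : borelR f by apply: borelR_sel_weight; exact: measurable_ind0.
rewrite (_ : \1_(trunc_set A c b S l) = fun z : mR => f (resid_post b S l + z *: gamma_post S l)).
  apply: (bf _ _ (fun z : mR => resid_post b S l + z *: gamma_post S l)).
  apply: random_mxD; first exact: random_mx_cst.
  by apply: random_mxZ => //; exact: random_mx_cst.
apply/funext => z; rewrite /f sel_weight_ind0 indicE; congr (nat_of_bool _)%:R.
apply/idP/asboolP; rewrite inE => -[k hk]; exists k; exact/trunc_pieceE.
Qed.

Lemma selected_local :
  poly_union A local_cut local_est <-> poly_union A c b.
Proof. exact: poly_union_local. Qed.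

(** [F_TN_root] with reference mean l'beta. The sign conditions on the gaps at 0 and 1 say that the
    truncation set has mass on both sides of l'b, which makes the equation uniquely solvable. *)
Lemma mu_star_decision : poly_union A c b ->
  0 < gap_line 0 w' m' g' local_est -> gap_line 1 w' m' g' local_est < 0 ->
  (dotv l beta <= mstar) = (0 <= gap_line (1 - alpha) w' m' g' local_est).
Proof.
move=> sel; rewrite /gap_line mul0r subr0 mul1r subr_lt0 subr_ge0.
have totE : tot_line w' m' g' local_est =
    \int[nu]_v \1_(trunc_set A c b S l) (dotv l beta + s * v).
  by apply: eq_Rintegral => v _; exact: along_local.
have cumE : cum_line w' m' g' local_est =
    cumul (fun v : mR => \1_(trunc_set A c b S l) (dotv l beta + s * v))
      ((dotv l b - dotv l beta) / s).
  rewrite /cum_line level_local; congr cumul.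
  by apply/funext => v; exact: along_local.
rewrite totE cumE => cum0 cumlt.
have [m mroot mE] := F_TN_root q0 alpha01 measurable_trunc_set cum0 cumlt.
by rewrite (mstarP sel q0 mroot) mE.
Qed.

End truncation_link.

(** * Uniform error bound *)

Section one_sample.
Context {R : realType} {p K : nat} {q : 'I_K -> nat}.
Local Notation nu := (@normal_prob R 0 1).
Local Notation mR := (measurableTypeR R).

Definition good_test (C : R) (f : 'cV[R]_p -> R) : Prop :=
  [/\ borelR f, forall x, 0 <= f x <= 1 & Lip C f].

Context d (T : measurableType d) (P : probability T R).
Context d' (Omega : measurableType d') (Q : probability Omega R).
Variables (X : T -> 'cV[R]_p) (xi : Omega -> 'cV[R]_p) (dist : R).
Hypotheses (mX : random_mx X) (mxi : random_mx xi).
Hypothesis BL_close : forall f, @BL1 R p f -> borelR f ->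
  `|\int[P]_w f (X w) - \int[Q]_w f (xi w)| <= dist.

(** Dividing f by 1 + C p puts it in [BL1]: the bound stays below 1, and C p bounds its Lipschitz
    constant for the Frobenius norm. *)
Lemma good_test_transfer C f : 0 <= C -> good_test C f ->
  `|\int[P]_w f (X w) - \int[Q]_w f (xi w)| <= (1 + C * p%:R) * dist.
Proof.
move=> C0 [bf f01 fL]; set D := 1 + C * p%:R.
have D0 : 0 < D by apply: ltr_pwDl => //; exact: mulr_ge0.
have bg : borelR (fun x => D^-1 * f x).
  by apply: borelRM => //; exact: borelR_cst.
have blg : @BL1 R p (fun x => D^-1 * f x).
  split=> [x|x y].
    have /andP[f0 f1] := f01 x; rewrite ger0_norm; last first.
      by rewrite mulr_ge0// invr_ge0 ltW.
    rewrite ler_pdivrMl// mulr1; apply: le_trans f1 _.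
    by rewrite lerDl mulr_ge0.
  rewrite -mulrBr normrM gtr0_norm ?invr_gt0// ler_pdivrMl//.
  apply: le_trans (fL x y) _; apply: (@le_trans _ _ (C * (p%:R * frob_norm (x - y)))).
    by rewrite ler_wpM2l// l1_frob_norm.
  by rewrite mulrA ler_wpM2r ?frob_norm_ge0// lerDr.
have := BL_close blg bg.
rewrite !bintZ; [|exact: bmf_borelR..].
by rewrite -mulrBr normrM gtr0_norm ?invr_gt0// ler_pdivrMl.
Qed.

Variable A : forall k : 'I_K, 'M[R]_(q k, p).
Variables (Sg : 'M[R]_p) (l : 'cV[R]_p) (c : forall k : 'I_K, 'cV[R]_(q k)).
Hypotheses (nxi : centered_normal_vector Q xi Sg) (q0 : 0 < quad Sg l).
Variables (alpha e del rho M Bm Bg strip : R).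
Hypotheses (alpha01 : 0 < alpha < 1) (e0 : 0 < e) (del0 : 0 < del) (rho0 : 0 <= rho).

Let m := level_vec Sg l.
Let g := line_vec Sg l.
Hypotheses (mBm : l1 m <= Bm) (gBg : l1 g <= Bg).

Let w := sel_weight A (ramp del) c.
Let B := boundary_sum A (tent del) c.
Let G a := gap_line a w m g.
Let tk k (j : 'I_(q k)) y := tent del (slack A c y j).
(** The soft tail test rises from 0 at level M to 1 at level M + 1, so pointwise comparison is
    required up to M + 1. *)
Let M1 := M + 1.

Hypothesis strip_bound :
  \sum_k \sum_(j < q k) \int[Q]_w tk j (xi w) <= strip.

Let mg : dotv m g = 1. Proof. exact: level_line. Qed.
Let rs : resamples Q xi m g.
Proof.
have h : dotv m (Sg *m m) = 1 by rewrite -line_vecE.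
by have := resamples_normal nxi h; rewrite -line_vecE.
Qed.

Let Bm0 : 0 <= Bm. Proof. by apply: le_trans mBm; exact: l1_ge0. Qed.
Let Bg0 : 0 <= Bg. Proof. by apply: le_trans gBg; exact: l1_ge0. Qed.
Let Lw := del^-1 * A_size A.
Let Lw0 : 0 <= Lw.
Proof. by rewrite mulr_ge0 ?invr_ge0 ?(ltW del0)//; exact: A_size_ge0. Qed.
Let Z := 1 + Bm * Bg.
Let Z1 : 1 <= Z. Proof. by rewrite lerDl mulr_ge0. Qed.
Let LG := Bm + 2 * (Lw * Z).
Let LG0 : 0 <= LG.
Proof. by rewrite addr_ge0// mulr_ge0// mulr_ge0// (le_trans ler01). Qed.

(** One Lipschitz constant for all test functions: the summands account for weights and line masses,
    for steps and tents of the gaps, and for the tail test. The population enters only through the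
    bounds [Bm] and [Bg]. *)
Definition test_lip : R :=
  del^-1 * A_size A * (1 + Bm * Bg)
  + (2 * e)^-1 * (Bm + 2 * (del^-1 * A_size A * (1 + Bm * Bg))) + Bm.
Let C := test_lip.

Let ee0 : 0 < 2 * e. Proof. by rewrite mulr_gt0. Qed.
Let LwZ : Lw <= Lw * Z. Proof. by rewrite ler_peMr. Qed.
Let LGe0 : 0 <= (2 * e)^-1 * LG. Proof. by rewrite mulr_ge0// invr_ge0 ltW. Qed.
Let C0 : 0 <= C.
Proof. by rewrite /C /test_lip -/Lw -/Z -/LG !addr_ge0// (le_trans Lw0). Qed.
Let CE : C = Lw * Z + (2 * e)^-1 * LG + Bm. Proof. by []. Qed.
Let LwC : Lw <= C.
Proof. by rewrite CE -addrA; apply: le_trans LwZ _; rewrite lerDl addr_ge0. Qed.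
Let LwLG : Lw + (2 * e)^-1 * LG <= C.
Proof. by rewrite CE -[leLHS]addr0; apply: lerD => //; exact: lerD. Qed.
Let LwZC : Lw * Z <= C.
Proof. by rewrite CE -addrA lerDl addr_ge0. Qed.
Let BmC : Bm <= C.
Proof. by rewrite CE lerDr addr_ge0// (le_trans Lw0). Qed.

Let lip_inv (h : R -> R) s : (forall a b, `|h a - h b| <= `|a - b| / s) ->
  forall a b, `|h a - h b| <= s^-1 * `|a - b|.
Proof. by move=> H a b; rewrite mulrC. Qed.

Let w01 y : 0 <= w y <= 1.
Proof. by apply: sel_weight_itv => t; exact: clamp01_itv. Qed.
Let bw : borelR w.
Proof. apply: borelR_sel_weight; exact: measurable_ramp. Qed.
Let wL : Lip Lw w.
Proof.
apply: Lip_sel_weight; first by move=> t; exact: clamp01_itv.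
  by rewrite invr_ge0 ltW.
by apply: lip_inv => a b; exact: ramp_lip.
Qed.

Let gw : good_test C w.
Proof. by split => //; exact: LipW wL. Qed.

Let mgZ : 1 + l1 m * l1 g <= Z.
Proof. by rewrite lerD2l ler_pM ?l1_ge0. Qed.

Let GL a : 0 <= a <= 1 -> Lip LG (G a).
Proof.
move=> a01; apply: LipW (Lip_gap_line m g bw w01 Lw0 a01 wL).
by rewrite lerD// ler_wpM2l// ler_wpM2l.
Qed.

Let gcomp a (h : R -> R) : 0 <= a <= 1 -> measurable_fun setT (h : mR -> R) ->
  (forall t, 0 <= h t <= 1) ->
  (forall s t, `|h s - h t| <= (2 * e)^-1 * `|s - t|) ->
  good_test C (fun y => w y * h (G a y)).
Proof.
move=> a01 mh h01 hL; split.
- by apply: borelRM => //; apply: borelR_comp => //; exact: borelR_gap_line.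
- move=> x; have /andP[h1 h2] := h01 (G a x); have /andP[w1 w2] := w01 x.
  by rewrite mulr_ge0//= mulr_ile1.
- apply: (LipW LwLG); apply: LipM => //.
  + by move=> x; have /andP[w1 w2] := w01 x; rewrite ger0_norm.
  + by move=> x; have /andP[h1 h2] := h01 (G a x); rewrite ger0_norm.
  + by apply: Lip_comp => //; [rewrite invr_ge0 ltW|exact: GL].
Qed.

Let alh : 0 <= 1 - alpha <= 1.
Proof. by have /andP[? ?] := alpha01; apply/andP; split; lra. Qed.

Let msoft : measurable_fun setT (soft_step (2 * e) : mR -> R).
Proof.
apply: (measurableT_comp measurable_clamp01).
by apply: measurable_funD => //; exact: measurable_funM.
Qed.

Let gsoft : good_test C (fun y => w y * soft_step (2 * e) (G (1 - alpha) y)).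
Proof.
apply: gcomp => //.
- by move=> t; exact: clamp01_itv.
- by apply: lip_inv => a b; exact: soft_step_lip.
Qed.

Let gtent a : 0 <= a <= 1 -> good_test C (fun y => w y * tent (2 * e) (G a y)).
Proof.
move=> a01; apply: gcomp => //.
- exact: measurable_tent.
- by move=> t; exact: clamp01_itv.
- by apply: lip_inv => b b'; exact: tent_lip.
Qed.

Let gtk k (j : 'I_(q k)) : good_test Lw (tk j).
Proof.
split.
- by apply: (borelR_comp (measurable_tent del)); exact: borelR_slack.
- by move=> y; exact: clamp01_itv.
- have L : Lip (del^-1 * l1 (A k)) (tk j).
    have d0 : 0 <= del^-1 by rewrite invr_ge0 ltW.
    apply: (Lip_comp d0 _ (Lip_slack A c j)).
    by apply: lip_inv => a b; exact: tent_lip.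
  by apply: LipW L; rewrite /Lw ler_wpM2l ?invr_ge0 ?(ltW del0)//; exact: (l1_le_A_size A j).
Qed.

Let gtkC k (j : 'I_(q k)) : good_test C (tk j).
Proof. by have [? ? h] := gtk j; split => //; exact: LipW h. Qed.

Let gtot k (j : 'I_(q k)) : good_test C (tot_line (tk j) m g).
Proof.
have [bt t01 tL] := gtk j; split.
- exact: borelR_tot_line.
- by move=> x; exact: tot_line_itv.
- apply: LipW (Lip_tot_line m g bt t01 Lw0 tL).
  by apply: le_trans LwZC; rewrite ler_wpM2l.
Qed.

Let gkap : good_test C (fun y => clamp01 (`|dotv m y| - M)).
Proof.
split.
- apply: (borelR_comp measurable_clamp01); apply: borelRB; last exact: borelR_cst.
  by apply: (borelR_comp measurable_normr); exact: borelR_dotv.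
- by move=> y; exact: clamp01_itv.
- move=> x y; apply: le_trans (clamp01_lip _ _) _.
  have -> : `|dotv m x| - M - (`|dotv m y| - M) = `|dotv m x| - `|dotv m y| by ring.
  apply: le_trans (ler_dist_dist _ _) _; rewrite -dotvBr.
  apply: le_trans (l1_dotv _ _) _; rewrite ler_wpM2r ?l1_ge0//.
  exact: le_trans BmC.
Qed.

Let dd := (1 + C * p%:R) * dist.

Let up f : good_test C f -> \int[P]_w f (X w) <= \int[Q]_w f (xi w) + dd.
Proof.
move=> gf; have := good_test_transfer C0 gf.
by rewrite ler_distl => /andP[_]; rewrite addrC.
Qed.

Let bgood f : good_test C f -> bmf (fun w => f (X w)).
Proof. by move=> [bf f01 _]; exact: bmf_borelR. Qed.

Variables (S E : T -> bool) (bad : T -> bool).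
Hypotheses (mS : measurable_fun setT S) (mE : measurable_fun setT E)
  (mbad : measurable_fun setT bad).
Hypothesis pointwise : forall t, ~~ bad t -> `|dotv m (X t)| <= M1 ->
  `|(S t)%:R * (E t)%:R - alpha * (S t)%:R -
    (w (X t) * soft_step (2 * e) (G (1 - alpha) (X t)) - alpha * w (X t))| <=
  2 * B (X t) + w (X t) * (tent (2 * e) (G 0 (X t)) + tent (2 * e) (G (1 - alpha) (X t))
    + tent (2 * e) (G 1 (X t)))
    + (rho + 2 * (tail M1 + tot_line B m g (X t))) / e.

Let F1 y := w y * soft_step (2 * e) (G (1 - alpha) y).
Let Wa a y := w y * tent (2 * e) (G a y).
Let kap y := clamp01 (`|dotv m y| - M).
Let totB y := \sum_k \sum_(j < q k) tot_line (tk j) m g y.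

Let totBE y : tot_line B m g y = totB y.
Proof.
have bt k (j : 'I_(q k)) : bmf (along (tk j) m g y).
  by have [bt t01 _] := gtk j; exact: bmf_along.
transitivity (\sum_k \int[nu]_v \sum_(j < q k) along (tk j) m g y v).
  by rewrite -bint_sum// => k; apply: bmf_sum.
by apply: eq_bigr => k _; rewrite bint_sum.
Qed.

Let Sr t : R := (S t)%:R.
Let Er t : R := (E t)%:R.
Let badr t : R := (bad t)%:R.
Let bSr : bmf Sr. Proof. exact: bmf_bool. Qed.
Let bEr : bmf Er. Proof. exact: bmf_bool. Qed.
Let bbadr : bmf badr. Proof. exact: bmf_bool. Qed.

Let Rem t := 2 * B (X t) + (Wa 0 (X t) + Wa (1 - alpha) (X t) + Wa 1 (X t))
  + ((rho + 2 * tail M1) / e + 2 / e * totB (X t)) + 2 * kap (X t) + 2 * badr t.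

Let i0 : 0 <= (0 : R) <= 1. Proof. by rewrite lexx ler01. Qed.
Let i1 : 0 <= (1 : R) <= 1. Proof. by rewrite lexx ler01. Qed.

Let totB0 y : 0 <= totB y.
Proof.
apply: sumr_ge0 => k _; apply: sumr_ge0 => j _.
by have [_ /(_ y)/andP[]] := gtot j.
Qed.

(** The left side never exceeds 2. On bad realizations this is covered by 2 [badr], and beyond level
    M + 1 by 2 [kap]; elsewhere [pointwise] applies. *)
Let Rem_ge t : `|Sr t * Er t - alpha * Sr t - (F1 (X t) - alpha * w (X t))| <= Rem t.
Proof.
have Wa0 a : 0 <= Wa a (X t).
  by rewrite mulr_ge0//; [case/andP: (w01 (X t))|exact: clamp01_ge0].
have B0 : 0 <= B (X t) by exact: boundary_sum_ge0.
have tB0 : 0 <= 2 / e * totB (X t) by rewrite mulr_ge0// divr_ge0// ltW.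
have rt0 : 0 <= (rho + 2 * tail M1) / e.
  by apply: divr_ge0; [rewrite addr_ge0// mulr_ge0// tail_ge0|exact: ltW].
have k0 : 0 <= kap (X t) by exact: clamp01_ge0.
have W0 := Wa0 0; have Wal := Wa0 (1 - alpha); have W1 := Wa0 1.
have crude : `|Sr t * Er t - alpha * Sr t - (F1 (X t) - alpha * w (X t))| <= 2.
  have /andP[al0 al1] := alpha01.
  have /andP[w0 w1] := w01 (X t).
  have /andP[f0 f1] : 0 <= F1 (X t) <= 1 by case: gsoft => _ /(_ (X t)).
  have aw : 0 <= alpha * w (X t) <= 1.
    by rewrite mulr_ge0 ?(ltW al0)//= mulr_ile1 ?(ltW al0) ?(ltW al1).
  have /andP[aw0 aw1] := aw.
  rewrite /Sr /Er; move: (F1 (X t)) (alpha * w (X t)) f0 f1 aw0 aw1 => a b *.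
  by case: (S t); case: (E t) => /=; rewrite ler_norml; apply/andP; split; lra.
case: (boolP (bad t)) => [bt|nbad].
  apply: le_trans crude _; rewrite /Rem.
  have -> : badr t = 1 by rewrite /badr bt.
  by lra.
have bad0 : 0 <= badr t by [].
have [dM|dM] := leP `|dotv m (X t)| M1; last first.
  apply: le_trans crude _; rewrite /Rem.
  have -> : kap (X t) = 1 by apply: clamp01_1; rewrite lerBrDl; exact: ltW.
  by lra.
apply: le_trans (pointwise nbad dM) _; rewrite totBE.
have -> : w (X t) * (tent (2 * e) (G 0 (X t)) + tent (2 * e) (G (1 - alpha) (X t))
    + tent (2 * e) (G 1 (X t))) = Wa 0 (X t) + Wa (1 - alpha) (X t) + Wa 1 (X t).
  by rewrite /Wa; ring.
have -> : (rho + 2 * (tail M1 + totB (X t))) / e =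
  (rho + 2 * tail M1) / e + 2 / e * totB (X t) by field; rewrite gt_eqF.
by rewrite /Rem; lra.
Qed.

Definition n_constraints : R := \sum_k \sum_(j < q k) 1.

Let bB : bmf (fun t => B (X t)).
Proof. by apply: bmf_sum => k; apply: bmf_sum => j; exact: (bgood (gtkC j)). Qed.
Let btotB : bmf (fun t => totB (X t)).
Proof. by apply: bmf_sum => k; apply: bmf_sum => j; exact: (bgood (gtot j)). Qed.

Let EB : \int[P]_t B (X t) <= strip + n_constraints * dd.
Proof.
have bt k (j : 'I_(q k)) : bmf (fun t => tk j (X t)) by exact: (bgood (gtkC j)).
apply: (@le_trans _ _ (\sum_k \sum_(j < q k) (\int[Q]_w tk j (xi w) + dd))).
  rewrite bint_sum; last by move=> k; apply: bmf_sum => j; exact: bt.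
  apply: ler_sum => k _; rewrite bint_sum; last exact: bt.
  by apply: ler_sum => j _; exact: (up (gtkC j)).
rewrite /n_constraints mulr_suml; apply: le_trans (lerD strip_bound (lexx _)).
rewrite -big_split; apply: ler_sum => k _; rewrite mulr_suml -big_split.
by apply: ler_sum => j _; rewrite mul1r.
Qed.

(** Averaging a tent along the redrawing lines keeps its Gaussian expectation, so the same strip
    bound serves again. *)
Let EtotB : \int[P]_t totB (X t) <= strip + n_constraints * dd.
Proof.
have bt k (j : 'I_(q k)) : bmf (fun t => tot_line (tk j) m g (X t)).
  by exact: (bgood (gtot j)).
apply: (@le_trans _ _ (\sum_k \sum_(j < q k) (\int[Q]_w tk j (xi w) + dd))).
  rewrite bint_sum; last by move=> k; apply: bmf_sum => j; exact: bt.
  apply: ler_sum => k _; rewrite bint_sum; last exact: bt.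
  apply: ler_sum => j _; apply: le_trans (up (gtot j)) _.
  by have [b1 b2 _] := gtk j; rewrite -(expectation_resample mxi rs b1 b2).
rewrite /n_constraints mulr_suml; apply: le_trans (lerD strip_bound (lexx _)).
rewrite -big_split; apply: ler_sum => k _; rewrite mulr_suml -big_split.
by apply: ler_sum => j _; rewrite mul1r.
Qed.

Let EWa a : 0 <= a <= 1 -> \int[P]_t Wa a (X t) <= 12 * e + dd.
Proof.
move=> a01; apply: le_trans (up (gtent a01)) _; rewrite lerD2r.
apply: le_trans (expectation_window mxi rs mg bw w01 a01 ee0) _.
by lra.
Qed.

Let Ekap : \int[P]_t kap (X t) <= tail M + dd.
Proof.
apply: le_trans (up gkap) _; rewrite lerD2r.
exact: (expectation_tail mxi M rs mg).
Qed.

(** The exact level enters here: at a = 1 - alpha the smoothed rejection weight has Gaussian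
    expectation within 2 e of alpha times that of w. The other 2 dd come from transferring both
    expectations to the sample. *)
Let EF1 : `|\int[P]_t (F1 (X t) - alpha * w (X t))| <= 2 * e + 2 * dd.
Proof.
have /andP[al0 al1] := alpha01.
have bF := bgood gsoft; have bW := bgood gw.
rewrite bintB ?bintZ//; last by apply: bmfM => //; exact: bmf_cst.
have h1 := good_test_transfer C0 gsoft; have h2 := good_test_transfer C0 gw.
have h3 := expectation_soft_step mxi rs mg bw w01 alh ee0.
have dd0 : 0 <= dd by apply: le_trans h2; exact: normr_ge0.
have onem : 1 - (1 - alpha) = alpha by ring.
rewrite onem in h3.
move: h1 h2 h3; rewrite -/dd -/(G (1 - alpha)).
set a := \int[P]_w _; set b := \int[Q]_w _; set a' := \int[P]_w _; set b' := \int[Q]_w _.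
rewrite -/a -/a' => h1 h2 h3.
have -> : a - alpha * a' = (a - b) - alpha * (a' - b') + (b - alpha * b') by ring.
apply: le_trans (ler_normD _ _) _; rewrite addrC; apply: lerD => //.
apply: le_trans (ler_normB _ _) _.
have : `|alpha * (a' - b')| <= dd.
  by apply: le_trans h2; rewrite normrM (gtr0_norm al0) ler_piMl// ltW.
move=> h; apply: le_trans (lerD h1 h) _.
by rewrite mulr_natl mulr2n.
Qed.

(** 38 e is 12 e for each of the three windows plus 2 e for the soft step; the 7 counts transfers:
    three windows, two in [EF1], and the tail test twice. *)
Lemma one_sample_bound :
  `|\int[P]_t ((S t)%:R * (E t)%:R) - alpha * \int[P]_t ((S t)%:R : R)| <=
  38 * e + (2 + 2 / e) * strip + (rho + 2 * tail M1) / e + 2 * tail M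
  + (7 + (2 + 2 / e) * n_constraints) * dd + 2 * \int[P]_t (bad t)%:R.
Proof.
have bSE : bmf (fun t => Sr t * Er t) by exact: bmfM.
have bF : bmf (fun t => F1 (X t)) := bgood gsoft.
have bW := bgood gw.
have baS : bmf (fun t => alpha * Sr t) by apply: bmfM => //; exact: bmf_cst.
have baW : bmf (fun t => alpha * w (X t)) by apply: bmfM => //; exact: bmf_cst.
have bWa a (a01 : 0 <= a <= 1) : bmf (fun t => Wa a (X t)) := bgood (gtent a01).
have bW0 := bWa _ i0; have bWal := bWa _ alh; have bW1 := bWa _ i1.
have bk : bmf (fun t => kap (X t)) := bgood gkap.
have bZ (k : R) f : bmf f -> bmf (fun t : T => k * f t).
  by move=> bf; apply: bmfM => //; exact: bmf_cst.
have bRem : bmf Rem.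
  apply: bmfD; [apply: bmfD; [apply: bmfD; [apply: bmfD|]|]|]; try exact: bZ.
    by apply: bmfD => //; exact: bmfD.
  by apply: bmfD; [exact: bmf_cst|exact: bZ].
have -> : \int[P]_t ((S t)%:R * (E t)%:R) - alpha * \int[P]_t ((S t)%:R : R) =
    \int[P]_t (F1 (X t) - alpha * w (X t)) +
    \int[P]_t (Sr t * Er t - alpha * Sr t - (F1 (X t) - alpha * w (X t))).
  rewrite -/Sr -/Er -bintD; last 2 first.
  - exact: bmfB.
  - by apply: bmfB; exact: bmfB.
  rewrite -bintZ// -bintB//; apply: eq_Rintegral => t _; rewrite /Sr /Er; ring.
apply: le_trans (ler_normD _ _) _.
have h1 : `|\int[P]_t (Sr t * Er t - alpha * Sr t - (F1 (X t) - alpha * w (X t)))|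
    <= \int[P]_t Rem t.
  apply: le_trans (ler_norm_bint _ _) _; first by apply: bmfB; exact: bmfB.
  apply: ler_bint => //; apply: bmf_norm; apply: bmfB; exact: bmfB.
have RemE : \int[P]_t Rem t = 2 * \int[P]_t B (X t)
    + (\int[P]_t Wa 0 (X t) + \int[P]_t Wa (1 - alpha) (X t) + \int[P]_t Wa 1 (X t))
    + ((rho + 2 * tail M1) / e + 2 / e * \int[P]_t totB (X t))
    + 2 * \int[P]_t kap (X t) + 2 * \int[P]_t badr t.
  have b1 : bmf (fun t => 2 * B (X t)) by exact: bZ.
  have b2 : bmf (fun t => Wa 0 (X t) + Wa (1 - alpha) (X t)) by exact: bmfD.
  have b3 : bmf (fun t => Wa 0 (X t) + Wa (1 - alpha) (X t) + Wa 1 (X t)) by exact: bmfD.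
  have b4 : bmf (fun t => 2 / e * totB (X t)) by exact: bZ.
  have b5 : bmf (fun t => (rho + 2 * tail M1) / e + 2 / e * totB (X t)).
    by apply: bmfD => //; exact: bmf_cst.
  have b6 : bmf (fun t => 2 * kap (X t)) by exact: bZ.
  have b7 : bmf (fun t => 2 * badr t) by exact: bZ.
  have b8 := bmfD b1 b3; have b9 := bmfD b8 b5; have b10 := bmfD b9 b6.
  rewrite /Rem (bintD P b10 b7) (bintD P b9 b6) (bintD P b8 b5) (bintD P b1 b3).
  rewrite (bintD P b2 bW1) (bintD P bW0 bWal) !bintZ//; congr (_ + _ + _ + _).
  by rewrite (bintD P (bmf_cst _ _) b4) (bintZ P _ btotB); congr (_ + _); exact: bint_cst.
apply: le_trans (lerD EF1 h1) _; rewrite RemE -/badr.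
have e20 : 0 <= 2 / e by rewrite divr_ge0// ltW.
have h2 : 2 / e * \int[P]_t totB (X t) <= 2 / e * (strip + n_constraints * dd).
  by rewrite ler_wpM2l.
have h3 := EB; have h4 := EWa i0; have h5 := EWa alh; have h6 := EWa i1; have h7 := Ekap.
rewrite mulrDr in h2; rewrite -/dd.
have -> : (2 + 2 / e) * strip = 2 * strip + 2 / e * strip by ring.
have -> : (7 + (2 + 2 / e) * n_constraints) * dd =
    7 * dd + 2 * (n_constraints * dd) + 2 / e * (n_constraints * dd) by ring.
lra.
Qed.

End one_sample.

Section realization.
Context {R : realType} {p K : nat} {q : 'I_K -> nat}.
Variable A : forall k : 'I_K, 'M[R]_(q k, p).

Variables (Sg : 'M[R]_p) (l : 'cV[R]_p) (cc : forall k : 'I_K, 'cV[R]_(q k)).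
Variables (alpha e del rho kap M smax Bg : R).
Hypotheses (alpha01 : 0 < alpha < 1) (e0 : 0 < e) (del0 : 0 < del) (rho0 : 0 <= rho).
Hypotheses (M0 : 0 <= M) (kap01 : 0 <= kap <= 1) (q0 : 0 < quad Sg l).
Hypotheses (sd_le : Num.sqrt (quad Sg l) <= smax) (gBg : l1 (line_vec Sg l) <= Bg).
Hypothesis kap_rho : kap * (M * smax) <= rho.
Hypothesis del_ge : A_size A * (2 * M * kap + rho * (Bg + 1)) <= del / 2.

Variables (b beta : 'cV[R]_p) (S : 'M[R]_p) (c : forall k : 'I_K, 'cV[R]_(q k)).
Variables (n : nat) (mstar : R).
Hypotheses (n_gt0 : (1 <= n)%N) (mstarP : mu_star_spec alpha A c b S l mstar).
Hypothesis s2_gt0 : 0 < quad (n%:R *: S) l.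
Hypothesis sd_close : `|inv_sd (n%:R *: S) l - inv_sd Sg l| <= kap.
Hypothesis line_vec_close : l1 (line_vec (n%:R *: S) l - line_vec Sg l) <= kap.
Hypothesis cut_close : forall k (j : 'I_(q k)),
  `|(Num.sqrt n%:R *: c k) j 0 - cc k j 0| <= del / 2.

Let m := level_vec Sg l.
Let g := line_vec Sg l.
Let m' := level_vec (n%:R *: S) l.
Let g' := line_vec (n%:R *: S) l.
Let x := local_est b beta n.
Let c0 k := cc k - A k *m (Num.sqrt n%:R *: beta).
Let w := sel_weight A (ramp del) c0.
Let B := boundary_sum A (tent del) c0.
Let G a := gap_line a w m g x.

Hypothesis level_le : `|dotv m x| <= M.

(** The two level vectors are multiples of l, so the levels differ by the change of inverse standard
    deviation times |l'x|, and |l'x| <= M smax. *)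
Let level_close : `|dotv m' x - dotv m x| <= rho.
Proof.
apply: le_trans kap_rho; rewrite /m' /m /level_vec !dotvZl -mulrBl normrM.
apply: ler_pM => //.
have := level_le; rewrite /m /level_vec dotvZl normrM /inv_sd normfV.
rewrite (ger0_norm (sqrtr_ge0 _)) [X in X <= _ -> _]mulrC ler_pdivrMr ?sqrtr_gt0//.
by move=> h; apply: le_trans h _; rewrite ler_wpM2l.
Qed.

(** Both lines pass through x, so the gap between them comes from the change of direction, over a
    distance of at most 2 M, and from the change of level at x, along g'. *)
Let line_close v : `|v| <= M -> forall k (j : 'I_(q k)),
  `|(A k *m (relevel m' g' x v - relevel m g x v)) j 0| <= del / 2.
Proof.
move=> vM k j; apply: le_trans del_ge; apply: le_trans (l1_mulmx _ _ _) _.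
have /andP[kap0 kap1] := kap01.
have dE : relevel m' g' x v - relevel m g x v =
    (v - dotv m x) *: (g' - g) + (dotv m x - dotv m' x) *: g'.
  by apply/matrixP => i i'; rewrite /relevel !mxE; ring.
apply: ler_pM; [exact: l1_ge0|exact: l1_ge0|exact: (l1_le_A_size A j)|].
rewrite dE; apply: le_trans (l1D _ _) _; rewrite (l1Z (v - _)) (l1Z (dotv m x - _)).
apply: lerD; apply: ler_pM => //; try exact: l1_ge0.
- by apply: le_trans (ler_normB _ _) _; rewrite mulr_natl mulr2n lerD.
- by rewrite distrC.
have -> : g' = g + (g' - g) by rewrite addrC subrK.
by apply: le_trans (l1D _ _) _; rewrite lerD// (le_trans line_vec_close).
Qed.

Lemma realization_bound (E : bool) :
  (poly_union A c b -> E = (dotv l beta <= mstar)) ->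
  `|(`[< poly_union A c b >])%:R * E%:R - alpha * (`[< poly_union A c b >])%:R -
    (w x * soft_step (2 * e) (G (1 - alpha)) - alpha * w x)| <=
  2 * B x + w x * (tent (2 * e) (G 0) + tent (2 * e) (G (1 - alpha)) + tent (2 * e) (G 1))
    + (rho + 2 * (tail M + tot_line B m g x)) / e.
Proof.
move=> hE.
have w01 y : 0 <= w y <= 1 by apply: sel_weight_itv => t; exact: clamp01_itv.
have bw : borelR w by apply: borelR_sel_weight; exact: measurable_ramp.
have c_close k (j : 'I_(q k)) : `|local_cut A c beta n k j 0 - c0 k j 0| <= del / 2.
  by rewrite /local_cut /c0 !mxE opprB addrA addrNK; have := cut_close j; rewrite mxE.
have selE : (`[< poly_union A c b >] : bool) =
    `[< poly_union A (local_cut A c beta n) x >].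
  by apply: asbool_equiv_eq; split => /(selected_local A c b beta n_gt0).
have /andP[cum0 cumtot] := cum_line_itv m g x bw w01.
apply: (@decision_compare _ _ _ _ _ _ _ _ G
  (fun a => gap_line a (sel_weight A (@ind0 R) (local_cut A c beta n)) m' g' x)) => //.
- exact: boundary_sum_ge0.
- rewrite addr_ge0// mulr_ge0// addr_ge0 ?tail_ge0//.
  by apply: bint_ge0 => v; exact: boundary_sum_ge0.
- rewrite selE -sel_weight_ind0; apply: sel_weight_compare => // k j.
  rewrite /slack opprB addrA addrNK; apply: le_trans (c_close k j) _.
  by rewrite ler_pdivrMr// ler_peMr ?(ltW del0)// ler1n.
- move=> a a01; exact: gap_line_compare.
- move=> /asboolP sel G0 G1; rewrite (hE sel).
  exact: (mu_star_decision n_gt0 alpha01 s2_gt0 mstarP sel G0 G1).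
- by rewrite /G /gap_line mul0r subr0.
- by rewrite /G /gap_line mul1r subr_le0.
Qed.

End realization.

(** * Uniform choice of the tolerances *)

Section calibration.
Context {R : realType} {p K : nat} {q : 'I_K -> nat}.
Variable A : forall k : 'I_K, 'M[R]_(q k, p).
Hypothesis A_rows : forall k (j : 'I_(q k)), row j (A k) != 0.

Definition spectrum_within (lam : R) (S : 'M[R]_p) : Prop :=
  forall v : 'cV[R]_p, dotv v v / lam <= quad S v <= lam * dotv v v.

Definition strip_const (lam : R) : R :=
  \sum_k \sum_(j < q k) 5 / Num.sqrt (dotv (row j (A k))^T (row j (A k))^T / lam).

Lemma strip_const_ge0 lam : 0 <= strip_const lam.
Proof.
by apply: sumr_ge0 => k _; apply: sumr_ge0 => j _; rewrite divr_ge0// sqrtr_ge0.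
Qed.

(** A nonzero row and the lower spectral bound keep the standard deviation of each constraint away
    from 0, so all strips are thin uniformly, whatever the offsets c. *)
Lemma expectation_strips d (Omega : measurableType d) (Q : probability Omega R)
    (xi : Omega -> 'cV[R]_p) (S : 'M[R]_p) (c : forall k, 'cV[R]_(q k)) (lam del : R) :
  centered_normal_vector Q xi S -> 0 < lam -> spectrum_within lam S -> 0 < del ->
  \sum_k \sum_(j < q k) \int[Q]_w tent del (slack A c (xi w) j)
    <= strip_const lam * del.
Proof.
move=> nxi lam0 hS del0; rewrite /strip_const mulr_suml; apply: ler_sum => k _.
rewrite mulr_suml; apply: ler_sum => j _.
pose a := (row j (A k))^T; set r := Num.sqrt _.
have a0 : 0 < dotv a a.
  by rewrite lt_neqAle dotv_ge0 andbT eq_sym dotv_eq0 trmx_eq0.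
have r0 : 0 < r by rewrite sqrtr_gt0 divr_gt0.
have /andP[h1 _] := hS a.
have s0 : 0 < quad S a by apply: lt_le_trans h1; rewrite divr_gt0.
pose s := Num.sqrt (quad S a).
have rs : r <= s by rewrite ler_wsqrtr.
have E w : slack A c (xi w) j = c k j 0 - dotv a (xi w).
  rewrite /slack dotvE mxE; congr (_ - _); apply: eq_bigr => i _.
  by rewrite /a !mxE.
under eq_Rintegral do rewrite E.
have sE : dotv a (S *m a) = s ^+ 2 by rewrite sqr_sqrtr// ltW.
have sgt0 : 0 < s by rewrite sqrtr_gt0.
apply: le_trans (expectation_strip (random_normal nxi) _ nxi sgt0 sE del0) _.
rewrite mulrAC; apply: ler_wpM2r; first exact: ltW.
by apply: ler_wpM2l => //; rewrite lef_pV2 ?posrE// (lt_le_trans r0).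
Qed.

Lemma frob_norm_measurable d (T : measurableType d) m n (X : T -> 'M[R]_(m, n)) :
  random_mx X -> measurable_fun setT (fun t => frob_norm (X t)).
Proof.
move=> mX; apply: 
  (measurableT_comp (f := (Num.sqrt : measurableTypeR R -> measurableTypeR R))).
  exact: continuous_measurable_fun (@sqrt_continuous R).
apply: measurable_sum => i; apply: measurable_sum => j.
exact: measurable_funX (mX i j).
Qed.

Lemma measurable_selected d (T : measurableType d) (c : T -> forall k, 'cV[R]_(q k))
    (b : T -> 'cV[R]_p) : (forall k, random_mx (fun t => c t k)) -> random_mx b ->
  measurable_fun setT (fun t => `[< poly_union A (c t) (b t) >] : bool).
Proof.
move=> mc mb.
have -> : (fun t => `[< poly_union A (c t) (b t) >]) =
    (fun t => 0 < sel_weight A (@ind0 R) (c t) (b t)).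
  by apply/funext => t; rewrite sel_weight_ind0 ltr0n lt0b.
apply: measurable_fun_ltr => //; apply: measurable_funB => //.
apply: measurable_prod => k _; apply: measurable_funB => //.
apply: measurable_prod => j _; apply: (measurableT_comp measurable_ind0).
apply: measurable_funB; first exact: mc.
by have := @borelR_mulmx R _ _ (A k) j _ _ _ mb.
Qed.

End calibration.

Section tolerance.
Context {R : realType} {p K : nat} {q : 'I_K -> nat}.
Variable A : forall k : 'I_K, 'M[R]_(q k, p).
Hypothesis A_rows : forall k (j : 'I_(q k)), row j (A k) != 0.
Variables (l : 'cV[R]_p) (alpha lam tol : R).
Hypotheses (l_neq0 : l != 0) (alpha01 : 0 < alpha < 1) (lam0 : 0 < lam) (tol0 : 0 < tol).

(* The four tolerances depend on P only through the bound [lam] on the spectrum. *)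
Lemma uniform_calibration : exists eta del eps dist : R,
  [/\ 0 < eta, 0 < del, 0 < eps & 0 < dist] /\
  forall d (T : measurableType d) (P : probability T R)
    d' (Omega : measurableType d') (Q : probability Omega R) (n : nat)
    (b : T -> 'cV[R]_p) (S : T -> 'M[R]_p) (c : T -> forall k, 'cV[R]_(q k))
    (mstar : T -> R) (beta : 'cV[R]_p) (Sg : 'M[R]_p) (cc : forall k, 'cV[R]_(q k))
    (xi : Omega -> 'cV[R]_p),
  (1 <= n)%N -> random_mx b -> random_mx S -> (forall k, random_mx (fun t => c t k)) ->
  measurable_fun setT mstar ->
  (forall t, mu_star_spec alpha A (c t) (b t) (S t) l (mstar t)) ->
  Sg^T = Sg -> spectrum_within lam Sg -> centered_normal_vector Q xi Sg ->
  (forall f, @BL1 R p f -> borelR f ->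
    `|\int[P]_t f (local_est (b t) beta n) - \int[Q]_w f (xi w)| <= dist) ->
  fine (P [set t | eta < frob_norm (n%:R *: S t - Sg)]) <= eps ->
  (forall k, fine (P [set t | del < frob_norm (Num.sqrt n%:R *: c t k - cc k)]) <= eps) ->
  `|\int[P]_t ((`[< poly_union A (c t) (b t) >])%:R * (dotv l beta <= mstar t)%R%:R)
    - alpha * \int[P]_t ((`[< poly_union A (c t) (b t) >])%:R : R)| <= tol.
Proof.
have ll0 : 0 < dotv l l by rewrite lt_neqAle dotv_ge0 eq_sym dotv_eq0 l_neq0.
(* The budget of 50 e: 38 e from windows and step, 4 e from strips, 3 e from perturbed gaps, 2 e
   from the tail test, e from weak convergence, 2 e from bad realizations. *)
pose e := Num.min 1 (tol / 50).
have e0 : 0 < e by rewrite lt_min ltr01 divr_gt0.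
have e1 : e <= 1 by rewrite ge_min lexx.
have e50 : 50 * e <= tol by rewrite mulrC -ler_pdivlMr// ge_min lexx orbT.
(* Tails, strips and level shifts are later divided by e, so M, del and rho are tuned to order
   e^2. *)
have ee0 : 0 < e ^+ 2 by rewrite exprn_gt0.
have [M M0 hM] := normal_tail ee0.
have hM1 : tail (M + 1) <= e ^+ 2.
  apply: le_trans hM; apply: ler_bint; [exact: bmf_tail|exact: bmf_tail|].
  move=> v; rewrite ler_nat; case: (ltP (M + 1) `|v|) => //= h.
  by rewrite (lt_trans _ h)// ltrDl.
pose lo := dotv l l / lam; have lo0 : 0 < lo by rewrite divr_gt0.
(* Bounds on the level and line vectors valid for every admissible covariance: l'Sl is at least lo
   and the entries of S are at most lam. *)
pose Bm := l1 l / Num.sqrt lo; pose Bg := p%:R * (p%:R * lam) * Bm.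
have Bm0 : 0 <= Bm by rewrite divr_ge0 ?l1_ge0 ?sqrtr_ge0.
have Bg0 : 0 <= Bg.
  by apply: mulr_ge0 => //; apply: mulr_ge0 => //; apply: mulr_ge0 => //; exact: ltW.
pose smax := Num.sqrt (lam * dotv l l); have smax0 : 0 <= smax := sqrtr_ge0 _.
pose CA := strip_const A lam; have CA0 : 0 <= CA := strip_const_ge0 A lam.
pose LA := A_size A; have LA0 : 0 <= LA := A_size_ge0 A.
pose del := e ^+ 2 / (CA + 1).
have del0 : 0 < del by rewrite divr_gt0// ltr_wpDl.
have CAdel : CA * del <= e ^+ 2.
  rewrite /del mulrCA ler_piMr ?(ltW ee0)// ler_pdivrMr ?ltr_wpDl//.
  by rewrite mul1r lerDl.
have M10 : 0 <= M + 1 by rewrite addr_ge0// ltW.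
(* D1 and D2 let each of the two summands in [del_ge] use at most a quarter of del; the added 1
   keeps the divisors positive. *)
pose D1 := 4 * (LA * (Bg + 1) + 1).
have D10 : 0 < D1 by rewrite mulr_gt0// ltr_wpDl// mulr_ge0// addr_ge0.
pose rho := Num.min (e ^+ 2) (del / D1).
have rho0 : 0 < rho by rewrite lt_min ee0 divr_gt0.
have rho_e : rho <= e ^+ 2 by rewrite ge_min lexx.
have rho_del : rho * D1 <= del by rewrite -ler_pdivlMr// ge_min lexx orbT.
pose D2 := 4 * (2 * (M + 1) * LA + 1).
have D20 : 0 < D2 by rewrite mulr_gt0// ltr_wpDl//; apply: mulr_ge0 => //; exact: mulr_ge0.
pose D3 := (M + 1) * smax + 1.
have D30 : 0 < D3 by rewrite ltr_wpDl// mulr_ge0.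
pose kap := Num.min 1 (Num.min (rho / D3) (del / D2)).
have kap0 : 0 < kap by rewrite !lt_min ltr01/=; apply/andP; split; exact: divr_gt0.
have kap01 : 0 <= kap <= 1 by rewrite ltW//= ge_min lexx.
have kap_D3 : kap * D3 <= rho by rewrite -ler_pdivlMr// !ge_min lexx !orbT.
have kap_D2 : kap * D2 <= del by rewrite -ler_pdivlMr// !ge_min lexx !orbT.
have kap_rho : kap * ((M + 1) * smax) <= rho.
  by apply: le_trans kap_D3; rewrite ler_wpM2l ?(ltW kap0)// lerDl.
have del_ge : LA * (2 * (M + 1) * kap + rho * (Bg + 1)) <= del / 2.
  have E1 : rho * D1 = 4 * (LA * (rho * (Bg + 1))) + 4 * rho by rewrite /D1; ring.
  have E2 : kap * D2 = 4 * (LA * (2 * (M + 1) * kap)) + 4 * kap by rewrite /D2; ring.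
  by rewrite E1 in rho_del; rewrite E2 in kap_D2; rewrite mulrDr; lra.
have [eta eta0 heta] := scale_perturbation l_neq0 lam0 kap0.
pose ncon : R := @n_constraints R K q.
pose Cd := (7 + (2 + 2 / e) * ncon) * (1 + test_lip A e del Bm Bg * p%:R).
pose dist := e / (`|Cd| + 1).
have Cd1 : 0 < `|Cd| + 1 by rewrite ltr_wpDl.
have dist0 : 0 < dist by rewrite divr_gt0.
have Cd_dist : Cd * dist <= e.
  apply: (@le_trans _ _ ((`|Cd| + 1) * dist)); last by rewrite mulrC divfK// gt_eqF.
  by rewrite ler_wpM2r ?(ltW dist0)// (le_trans (ler_norm _))// lerDl.
(* There are K + 1 bad events: one for the covariance and one for each cut-off vector. *)
pose eps := e / (K%:R + 1).
have K1 : 0 < (K%:R : R) + 1 by rewrite ltr_wpDl.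
have eps0 : 0 < eps by rewrite divr_gt0.
exists eta, (del / 2), eps, dist; split; first by split => //; rewrite divr_gt0.
move=> d T P d' Omega Q n b S c mstar beta Sg cc xi n0 mb mS mc mmstar mstarP symS hS nxi
  hBL hbadS hbadc.
have /andP[ql0 ql1] := hS l.
have q0 : 0 < quad Sg l by apply: lt_le_trans ql0.
have hS' v : 0 <= quad Sg v <= lam * dotv v v.
  have /andP[h1 h2] := hS v; rewrite h2 andbT; apply: le_trans h1.
  by rewrite divr_ge0 ?dotv_ge0// ltW.
have sd_le : Num.sqrt (quad Sg l) <= smax by rewrite ler_wsqrtr.
have mBm : l1 (level_vec Sg l) <= Bm.
  rewrite /level_vec l1Z /Bm mulrC ler_wpM2l ?l1_ge0//.
  rewrite ger0_norm ?invr_ge0 ?sqrtr_ge0// lef_pV2 ?posrE ?sqrtr_gt0//.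
  by rewrite ler_wsqrtr.
have gBg : l1 (line_vec Sg l) <= Bg.
  rewrite line_vecE; apply: le_trans (l1_mulmx_col _ _) _.
  apply: ler_pM => //; try exact: l1_ge0.
  by apply: l1_le_entries => i j; exact: entry_bound symS hS' (ltW lam0).
pose X t := local_est (b t) beta n.
have mX : random_mx X.
  by apply: random_mxZ => //; apply: random_mxD.
pose badS t := eta < frob_norm (n%:R *: S t - Sg).
pose badc k t := del / 2 < frob_norm (Num.sqrt n%:R *: c t k - cc k).
have mfS : measurable_fun setT badS.
  apply: measurable_fun_ltr => //; apply: frob_norm_measurable.
  apply: random_mxD; last exact: random_mx_cst.
  exact: random_mxZ.
have mfc k : measurable_fun setT (badc k).
  apply: measurable_fun_ltr => //; apply: frob_norm_measurable.
  apply: random_mxD; last exact: random_mx_cst.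
  exact: random_mxZ.
(* N counts the bad events that occur; its expectation dominates the probability that it is
   positive, which is the union bound. *)
pose N t : R := (badS t)%:R + \sum_(k < K) (badc k t)%:R.
have bN : bmf N by apply: bmfD; [exact: bmf_bool|apply: bmf_sum => k; exact: bmf_bool].
pose bad t := 0 < N t.
have mbad : measurable_fun setT bad by apply: measurable_fun_ltr => //; case: bN.
have NE t : N t = (badS t + \sum_(k < K) badc k t)%:R by rewrite natrD natr_sum.
have Pbad : \int[P]_t (bad t)%:R <= e.
  apply: (@le_trans _ _ (\int[P]_t N t)).
    apply: ler_bint => //; first exact: bmf_bool.
    by move=> t; rewrite /bad NE ltr0n ler_nat; case: (_ + _)%N.
  rewrite bintD; [|exact: bmf_bool|by apply: bmf_sum => k; exact: bmf_bool].
  rewrite bint_sum; last by move=> k; exact: bmf_bool.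
  rewrite bint_bool//; apply: (@le_trans _ _ (eps + \sum_(k < K) eps)).
    apply: lerD; first exact: hbadS.
    by apply: ler_sum => k _; rewrite (bint_bool _ (mfc k)); exact: hbadc.
  rewrite sumr_const card_ord -mulr_natl -[X in X + _]mul1r -mulrDl /eps addrC mulrC.
  by rewrite divfK// gt_eqF.
have strip_bound := expectation_strips A_rows
  (fun k => cc k - A k *m (Num.sqrt n%:R *: beta)) nxi lam0 hS del0.
have mE : measurable_fun setT (fun t => (dotv l beta <= mstar t)%R).
  exact: measurable_fun_ler.
apply: le_trans (@one_sample_bound R p K q _ T P _ Omega Q X xi dist mX
  (random_normal nxi) hBL A Sg l _ nxi q0 alpha e del rho M Bm Bg _ alpha01 e0 del0
  (ltW rho0) mBm gBg strip_bound _ _ bad (measurable_selected A mc mb) mE mbad _) _ => [t|].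
  rewrite /bad NE ltr0n -eqn0Ngt addn_eq0 sum_nat_eq0 eqb0 => /andP[hbS hbc] level_le.
  have frobS : frob_norm (n%:R *: S t - Sg) <= eta by rewrite leNgt.
  have [s2_gt0 sd_close line_cl] := heta _ _ symS hS frobS.
  apply: (realization_bound alpha01 e0 del0 (ltW rho0) M10 kap01 q0 sd_le gBg kap_rho
    del_ge n0 (mstarP t) s2_gt0 sd_close line_cl _ level_le) => // k j.
  have /forallP/(_ k) := hbc; rewrite eqb0 -leNgt => h.
  apply: le_trans h; have := frob_norm_entry (Num.sqrt n%:R *: c t k - cc k) j 0.
  by rewrite !mxE.
apply: le_trans e50.
set Pb := \int[P]_t _ in Pbad *; rewrite -/CA.
have e_neq0 : e != 0 by rewrite gt_eqF.
have s1 : (2 + 2 / e) * (CA * del) <= 4 * e.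
  apply: (@le_trans _ _ ((2 + 2 / e) * e ^+ 2)).
    by rewrite ler_wpM2l// addr_ge0// divr_ge0// ltW.
  have -> : (2 + 2 / e) * e ^+ 2 = 2 * e ^+ 2 + 2 * e by field.
  have : e ^+ 2 <= e by rewrite expr2 ler_piMr// ltW.
  lra.
have s2 : (rho + 2 * tail (M + 1)) / e <= 3 * e.
  by rewrite ler_pdivrMr// -mulrA -expr2; lra.
have s3 : tail M <= e by apply: le_trans hM _; rewrite expr2 ler_piMr// ltW.
have s4 : (7 + (2 + 2 / e) * ncon) * ((1 + test_lip A e del Bm Bg * p%:R) * dist) <= e.
  by rewrite mulrA.
rewrite -/ncon; lra.
Qed.

End tolerance.

(** * Passage to the limit *)

Lemma ereal_cvg0P {R : realType} (u : nat -> \bar R) :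
  u @ \oo --> 0%E <->
  forall e : R, 0 < e -> \forall n \near \oo, (- e%:E <= u n <= e%:E)%E.
Proof.
split=> [/fine_cvgP[ufin /cvgrPdist_le u0] e e0|h].
  near=> n.
  have un : u n \is a fin_num by near: n.
  have : `|0 - fine (u n)| <= e by near: n; exact: u0.
  by rewrite sub0r normrN ler_norml -(fineK un) -EFinN !lee_fin fineK.
apply/fine_cvgP; split.
  apply: filterS (h 1 ltr01) => n /andP[n1 n2].
  by rewrite fin_numE -ltNye -ltey; apply/andP; split;
    [apply: lt_le_trans n1; rewrite -EFinN ltNyr|apply: le_lt_trans n2 _; rewrite ltry].
apply/cvgrPdist_le => e e0; apply: filterS (h e e0) => n /andP[n1 n2].
have un : u n \is a fin_num.
  by rewrite fin_numE -ltNye -ltey; apply/andP; split;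
    [apply: lt_le_trans n1; rewrite -EFinN ltNyr|apply: le_lt_trans n2 _; rewrite ltry].
by move: n1 n2; rewrite sub0r normrN -(fineK un) -EFinN !lee_fin ler_norml => -> ->.
Unshelve. all: by end_near. Qed.

(** Multiplying through by P(F) removes the conditioning and leaves |P(E and F) - alpha P(F)|, the
    quantity that [uniform_calibration] bounds. *)
Lemma cond_prob_discrepancy {R : realType} d (T : measurableType d) (P : probability T R)
    (E F : T -> bool) (alpha : R) :
  measurable_fun setT E -> measurable_fun setT F ->
  `|cond_prob P [set t | E t] [set t | F t] - alpha| * fine (P [set t | F t]) =
  if fine (P [set t | F t]) == 0 then 0 else
  `|\int[P]_t ((F t)%:R * (E t)%:R) - alpha * \int[P]_t ((F t)%:R : R)|.
Proof.
move=> mE mF.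
rewrite (bint_bool P mF).
have -> : \int[P]_t ((F t)%:R * (E t)%:R) = fine (P ([set t | E t] `&` [set t | F t])).
  rewrite -bint_indic; last by apply: measurableI; exact: measurable_bool_set.
  apply: eq_Rintegral => t _; rewrite indicE in_setI !mem_setE.
  by rewrite !unfold_in; case: (E t); case: (F t); rewrite /= ?mul0r ?mulr0 ?mulr1.
case: ifPn => [/eqP ->|P0]; first by rewrite mulr0.
have Pge0 : 0 <= fine (P [set t | F t]) by exact: fine_ge0.
by rewrite /cond_prob -[X in _ * X](ger0_norm Pge0) -normrM mulrBl divfK.
Qed.

Theorem proposition7 (R : realType)
  (* samples of size n and their possible distributions *)
  (d : nat -> measure_display) (T : forall n, measurableType (d n))
  (calP : forall n, set (probability (T n) R))
  (* fixed quantities *)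
  (alpha : R) (p K : nat) (l : 'cV[R]_p)
  (q : 'I_K -> nat) (A : forall k : 'I_K, 'M[R]_(q k, p))
  (* quantities computed from the sample *)
  (bhat : forall n, T n -> 'cV[R]_p)
  (Shat : forall n, T n -> 'M[R]_p)
  (chat : forall n, T n -> forall k : 'I_K, 'cV[R]_(q k))
  (mustar : forall n, T n -> R)
  (* population quantities *)
  (beta : forall n, probability (T n) R -> 'cV[R]_p)
  (Sigma : forall n, probability (T n) R -> 'M[R]_p)
  (c : forall n, probability (T n) R -> forall k : 'I_K, 'cV[R]_(q k))
  (dO : measure_display) (Omega : measurableType dO) (Q : probability Omega R)
  (xi : forall n, probability (T n) R -> Omega -> 'cV[R]_p)
  (alpha01 : 0 < alpha < 1) (l_neq0 : l != 0) (K_ge1 : (1 <= K)%N)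
  (A_rows : forall k j, row j (A k) != 0)
  (bhat_meas : forall n, (1 <= n)%N -> random_mx (bhat n))
  (Shat_meas : forall n, (1 <= n)%N -> random_mx (Shat n))
  (Shat_sym : forall n, (1 <= n)%N -> forall x : T n, (Shat n x)^T = Shat n x)
  (chat_meas : forall n, (1 <= n)%N ->
     forall k, random_mx (fun x : T n => chat n x k))
  (disjoint_polyhedra : forall n, (1 <= n)%N -> forall x : T n,
     trivIset setT (fun k => polyhedron (A k) (chat n x k)))
  (mustar_meas : forall n, (1 <= n)%N -> measurable_fun setT (mustar n))
  (mustarP : forall n, (1 <= n)%N -> forall x : T n,
     mu_star_spec alpha A (chat n x) (bhat n x) (Shat n x) l (mustar n x))
  (* assumption 1 *)
  (Sigma_cov : forall n, (1 <= n)%N -> forall P, calP n P ->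
     covariance_mx (Sigma n P))
  (xi_normal : forall n, (1 <= n)%N -> forall P, calP n P ->
     centered_normal_vector Q (xi n P) (Sigma n P))
  (bhat_cvg :
     (fun n => ereal_sup [set
        ereal_sup [set
          (`| 'E_P[(fun x => f (Num.sqrt n%:R *: (bhat n x - beta n P)))]
              - 'E_Q[(fun w => f (xi n P w))] |)%E
          | f in @BL1 R p]
        | P in calP n]) @ \oo --> 0%E)
  (Sigma_bounds : exists lam : R, 0 < lam /\
     forall n, (1 <= n)%N -> forall P, calP n P ->
       1 / lam <= lambda_min (Sigma n P) /\
       lambda_min (Sigma n P) <= lambda_max (Sigma n P) /\
       lambda_max (Sigma n P) <= lam)
  (* assumption 2 *)
  (Shat_cvg : forall eps : R, 0 < eps ->
     (fun n => ereal_sup [set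
        P [set x | frob_norm (n%:R *: Shat n x - Sigma n P) > eps]
        | P in calP n]) @ \oo --> 0%E)
  (* assumption 3 *)
  (chat_cvg : forall (k : 'I_K) (eps : R), 0 < eps ->
     (fun n => ereal_sup [set
        P [set x | frob_norm (Num.sqrt n%:R *: chat n x k - c n P k) > eps]
        | P in calP n]) @ \oo --> 0%E)
  (c_bounded : exists lamc : R, 0 < lamc /\
     forall n, (1 <= n)%N -> forall P, calP n P ->
       forall k, frob_norm (c n P k) <= lamc) :
  (fun n => ereal_sup [set
     (let selected := [set x : T n | poly_union A (chat n x) (bhat n x)] in
      `| cond_prob P [set x | mustar n x >= dotv l (beta n P)] selected - alpha |
      * fine (P selected))%:E
     | P in calP n]) @ \oo --> 0%E.
Proof.
have [lam [lam0 hlam]] := Sigma_bounds.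
apply/ereal_cvg0P => tol tol0.
have [eta [del [eps [dist [[eta0 del0 eps0 dist0] calib]]]]] :=
  uniform_calibration A_rows l_neq0 alpha01 lam0 tol0.
near=> n.
have n1 : (1 <= n)%N by near: n; exact: nbhs_infty_ge.
have /andP[BL_ge BL_le] : (- dist%:E <= ereal_sup [set
    ereal_sup [set (`| 'E_P[(fun x => f (Num.sqrt n%:R *: (bhat n x - beta n P)))]
      - 'E_Q[(fun w => f (xi n P w))] |)%E | f in @BL1 R p] | P in calP n] <= dist%:E)%E.
  by near: n; exact: (ereal_cvg0P _).1.
have /andP[_ badS_le] : (- eps%:E <= ereal_sup [set
    P [set x | (frob_norm (n%:R *: Shat n x - Sigma n P) > eta)%R] | P in calP n] <= eps%:E)%E.
  by near: n; apply: (ereal_cvg0P _).1 => //; exact: Shat_cvg.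
have badc_le : forall k, (- eps%:E <= ereal_sup [set
    P [set x | (frob_norm (Num.sqrt n%:R *: chat n x k - c n P k) > del)%R]
    | P in calP n] <= eps%:E)%E.
  near: n; apply: filter_forall => k.
  by apply: (ereal_cvg0P _).1 => //; exact: chat_cvg.
(* A supremum over an empty class is -oo, which the lower bound on the weak convergence supremum
   excludes. The witness is what bounds the final supremum from below. *)
have [P0 calP0] : calP n !=set0.
  apply/set0P/negP => /eqP calP0; move: BL_ge; rewrite calP0 image_set0 ereal_sup0.
  by rewrite leNgt -EFinN ltNyr.
have mselected := measurable_selected A (chat_meas n n1) (bhat_meas n n1).
have value_itv P : calP n P ->
    0 <= `|cond_prob P [set x | mustar n x >= dotv l (beta n P)]
             [set x | poly_union A (chat n x) (bhat n x)] - alpha|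
         * fine (P [set x | poly_union A (chat n x) (bhat n x)]) <= tol.
  move=> PP.
  have mE : measurable_fun setT (fun x => dotv l (beta n P) <= mustar n x).
    by apply: measurable_fun_ler => //; exact: mustar_meas.
  have selE : [set x | poly_union A (chat n x) (bhat n x)] =
      [set x | `[< poly_union A (chat n x) (bhat n x) >]].
    by apply/seteqP; split => x /= /asboolP.
  have fine0 : 0 <= fine (P [set x | poly_union A (chat n x) (bhat n x)]).
    exact: fine_ge0.
  apply/andP; split; first exact: mulr_ge0.
  rewrite selE cond_prob_discrepancy//; case: ifPn => [_|_]; first exact: ltW.
  have symS : (Sigma n P)^T = Sigma n P by case: (Sigma_cov n n1 P PP).
  have hS : spectrum_within lam (Sigma n P).
    have [h1 [_ h2]] := hlam n n1 P PP; move=> v; apply/andP; split.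
      apply: le_trans (quad_ge_lambda_min v symS).
      by rewrite mulrC -div1r ler_wpM2r// dotv_ge0.
    apply: le_trans (quad_le_lambda_max v symS) _.
    by rewrite ler_wpM2r// dotv_ge0.
  have nxi := xi_normal n n1 P PP.
  have fine_le_eps (B : set (T n)) : (P B <= eps%:E)%E -> fine (P B) <= eps.
    by have := measure_ge0 P B; case: (P B) => [r|//|//] _; rewrite ?lee_fin/= ?(ltW eps0).
  apply: (calib _ _ _ _ _ _ _ _ _ _ _ _ _ (c n P) _ n1 (bhat_meas n n1) (Shat_meas n n1)
    (chat_meas n n1) (mustar_meas n n1) (mustarP n n1) symS hS nxi).
  - move=> f blf bf.
    have bmfX d' (T' : measurableType d') (X : T' -> 'cV[R]_p) :
        random_mx X -> bmf (fun t => f (X t)).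
      by move=> mX; split; [exact: bf|exists 1 => t; case: blf].
    have mX : random_mx (fun x => local_est (bhat n x) (beta n P) n).
      apply: random_mxZ => //; apply: (random_mxD (Y := fun=> - beta n P)).
        exact: bhat_meas.
      exact: random_mx_cst.
    rewrite -lee_fin; apply: le_trans BL_le.
    apply: (@le_trans _ _ (ereal_sup [set (`| 'E_P[(fun x => f (Num.sqrt n%:R *:
       (bhat n x - beta n P)))] - 'E_Q[(fun w => f (xi n P w))] |)%E | f in @BL1 R p])).
      apply: ereal_sup_ubound; exists f => //.
      rewrite unlock (bmf_EFin P (bmfX _ _ _ mX)).
      by rewrite (bmf_EFin Q (bmfX _ _ _ (random_normal nxi))).
    by apply: ereal_sup_ubound; exists P.
  - apply: fine_le_eps; apply: le_trans badS_le; apply: ereal_sup_ubound.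
    by exists P.
  - move=> k; apply: fine_le_eps; have /andP[_ h] := badc_le k.
    by apply: le_trans h; apply: ereal_sup_ubound; exists P.
apply/andP; split.
  have /andP[v0 _] := value_itv P0 calP0.
  apply: (@le_trans _ _ 0%E); first by rewrite -EFinN lee_fin oppr_le0 ltW.
  apply: le_trans (ereal_sup_ubound _); last by exists P0.
  by rewrite lee_fin.
apply: ge_ereal_sup => _ [P PP <-] /=; rewrite lee_fin.
by have /andP[] := value_itv P PP.
Unshelve. all: by end_near. Qed.
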